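(* Let $\mathfrak g\subset\mathfrak{gl}(V,V_* )$ be a splittable subalgebra. Then there exists a locally reductive subalgebra $\mathfrak g_{red}\subset\mathfrak g$ such that $\mathfrak g=\mathfrak n_{\mathfrak g}\rtimes\mathfrak g_{red}$ (vector space direct sum of the ideal $\mathfrak n_{\mathfrak g}$ and the subalgebra $\mathfrak g_{red}$). Furthermore $\mathfrak l:=[\mathfrak g_{red},\mathfrak g_{red}]$ is a Levi component of $\mathfrak g$, and there exists a toral subalgebra $\mathfrak t\subset\mathfrak g$ such that $\mathfrak g_{red}=\mathfrak l\rtimes\mathfrak t$ (vector space direct sum of $\mathfrak l$ and $\mathfrak t$).
   Context: $V,V_*$: countable-dimensional complex spaces with nondegenerate pairing; $\mathfrak{gl}(V,V_* )$ is the Lie algebra of $V\otimes V_*$ with product $(v\otimes w)(v'\otimes w')=\langle v',w\rangle v\otimes w'$, acting on $V$ by finite-rank endomorphisms $(v\otimes w)u=\langle u,w\rangle v$. Every $X\in\mathfrak{gl}(V,V_* )$ has a Jordan decomposition $X=X_{ss}+X_{nil}$ (semisimple and nilpotent parts as endomorphisms of $V$) with $X_{ss},X_{nil}\in\mathfrak{gl}(V,V_* )$. A subalgebra $\mathfrak g$ is splittable if $X_{ss},X_{nil}\in\mathfrak g$ for all $X\in\mathfrak g$. A Lie algebra is locally reductive if it is a union of nested finite-dimensional reductive Lie algebras $\mathfrak g_n\subset\mathfrak g_{n+1}$ with each $\mathfrak g_n$ reductive in $\mathfrak g_{n+1}$ (i.e. $\mathfrak g_{n+1}$ is a semisimple $\mathfrak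 g_n$-module). A toral subalgebra is a subalgebra consisting of semisimple elements. Linear nilradical $\mathfrak n_{\mathfrak g}$: elements of the largest locally solvable ideal $\mathfrak r$ of $\mathfrak g$ that are nilpotent. A Levi component of $\mathfrak g$ is a subalgebra $\mathfrak l$ with $[\mathfrak g,\mathfrak g]=(\mathfrak r\cap[\mathfrak g,\mathfrak g])\oplus\mathfrak l$ as vector spaces. *)

(* Defs.v *)
From HB Require Import structures.
From mathcomp Require Import all_boot all_order all_algebra.
Set Implicit Arguments. Unset Strict Implicit. Unset Printing Implicit Defensive.
Import GRing.Theory.
Local Open Scope ring_scope.

Section GlVVstar.
Variable F : closedFieldType.

Definition bilinear_pairing (V W : lmodType F) (pair : V -> W -> F) : Prop :=
  (forall (a : F) (u u' : V) (w : W), pair (a *: u + u') w = a * pair u w + pair u' w) /\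
  (forall (a : F) (u : V) (w w' : W), pair u (a *: w + w') = a * pair u w + pair u w').

Definition nondeg_pairing (V W : lmodType F) (pair : V -> W -> F) : Prop :=
  (forall u : V, (forall w, pair u w = 0) -> u = 0) /\
  (forall w : W, (forall u, pair u w = 0) -> w = 0).

Definition countable_dim (V : lmodType F) : Prop :=
  exists e : nat -> V,
    (forall (n : nat) (c : nat -> F),
        \sum_(i < n) c i *: e i = 0 -> forall i, (i < n)%N -> c i = 0) /\
    (forall v : V, exists (n : nat) (c : nat -> F), v = \sum_(i < n) c i *: e i).

Variable V : lmodType F.

Definition Endo := V -> V.
Definition fzero : Endo := fun _ => 0.
Definition fadd (X Y : Endo) : Endo := fun u => X u + Y u.
Definition fscale (a : F) (X : Endo) : Endo := fun u => a *: X u.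
Definition fbr (X Y : Endo) : Endo := fun u => X (Y u) - Y (X u).

Definition is_linear_map (X : Endo) : Prop :=
  forall (a : F) (u u' : V), X (a *: u + u') = a *: X u + X u'.

(* gl(V,V_star) = V (x) V_star, acting on V by finite-rank endomorphisms
   (v (x) w) u = <u,w> v.  Since the pairing is nondeg_pairing this action is
   faithful, so gl(V,V_star) is identified with its image in Endo; the
   associative product (v(x)w)(v'(x)w') = <v',w> v(x)w' is composition,
   hence the Lie bracket is the commutator fbr. *)
Definition in_gl (W : lmodType F) (pair : V -> W -> F) (X : Endo) : Prop :=
  exists (n : nat) (v : 'I_n -> V) (w : 'I_n -> W),
    X = fun u => \sum_(i < n) pair u (w i) *: v i.

Definition pset := Endo -> Prop.
Definition psubset (A B : pset) : Prop := forall X, A X -> B X.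

Definition subspace (A : pset) : Prop :=
  A fzero /\ (forall X Y, A X -> A Y -> A (fadd X Y)) /\
  (forall a X, A X -> A (fscale a X)).

Definition span (P : pset) : pset := fun X =>
  exists (n : nat) (c : 'I_n -> F) (x : 'I_n -> Endo),
    (forall i, P (x i)) /\ X = fun u => \sum_(i < n) c i *: x i u.

Definition brack (A B : pset) : pset :=
  span (fun Z => exists X Y, A X /\ B Y /\ Z = fbr X Y).

Definition lie_subalg (A : pset) : Prop :=
  subspace A /\ (forall X Y, A X -> A Y -> A (fbr X Y)).

Definition gl_subalg (W : lmodType F) (pair : V -> W -> F) (g : pset) : Prop :=
  lie_subalg g /\ psubset g (in_gl pair).

Definition fin_dim (A : pset) : Prop :=
  exists (n : nat) (x : 'I_n -> Endo),
    (forall i, A (x i)) /\ psubset A (span (fun X => exists i, X = x i)).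

Definition ideal (g I : pset) : Prop :=
  subspace I /\ psubset I g /\ (forall X Y, g X -> I Y -> I (fbr X Y)).

Fixpoint derived (A : pset) (n : nat) : pset :=
  match n with O => A | S m => brack (derived A m) (derived A m) end.

Definition solvable (A : pset) : Prop :=
  exists n, forall X, derived A n X -> X = fzero.

Definition gen_subalg (S : pset) : pset := fun X =>
  forall B, lie_subalg B -> psubset S B -> B X.

Definition locally_solvable (A : pset) : Prop :=
  forall (n : nat) (x : 'I_n -> Endo), (forall i, A (x i)) ->
    solvable (gen_subalg (fun X => exists i, X = x i)).

(* largest locally solvable ideal: union of all locally solvable ideals *)
Definition radical (g : pset) : pset := fun X =>
  exists J, ideal g J /\ locally_solvable J /\ J X.

Definition nilpotent_end (X : Endo) : Prop :=
  exists n, forall u, iter n X u = 0.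

Definition semisimple_end (X : Endo) : Prop :=
  forall u : V, exists (n : nat) (c : 'I_n -> F) (v : 'I_n -> V),
    (forall i, X (v i) = c i *: v i) /\ u = \sum_(i < n) v i.

Definition jordan_decomp (X S N : Endo) : Prop :=
  is_linear_map S /\ is_linear_map N /\ X = fadd S N /\
  semisimple_end S /\ nilpotent_end N /\ (forall u, S (N u) = N (S u)).

Definition splittable (g : pset) : Prop :=
  forall X S N, g X -> jordan_decomp X S N -> g S /\ g N.

Definition lin_nilrad (g : pset) : pset := fun X => radical g X /\ nilpotent_end X.

(* B is a semisimple A-module under the adjoint action *)
Definition reductive_in (A B : pset) : Prop :=
  forall Wd, subspace Wd -> psubset Wd B ->
    (forall X Y, A X -> Wd Y -> Wd (fbr X Y)) ->
    exists Wc, subspace Wc /\ psubset Wc B /\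
      (forall X Y, A X -> Wc Y -> Wc (fbr X Y)) /\
      (forall Y, Wd Y -> Wc Y -> Y = fzero) /\
      (forall Y, B Y -> exists Y1 Y2, Wd Y1 /\ Wc Y2 /\ Y = fadd Y1 Y2).

Definition reductive (A : pset) : Prop := reductive_in A A.

Definition locally_reductive (A : pset) : Prop :=
  exists gs : nat -> pset,
    (forall n, lie_subalg (gs n)) /\ (forall n, fin_dim (gs n)) /\
    (forall n, reductive (gs n)) /\
    (forall n, psubset (gs n) (gs n.+1)) /\
    (forall n, reductive_in (gs n) (gs n.+1)) /\
    (forall X, A X <-> exists n, gs n X).

Definition direct_sum (C A B : pset) : Prop :=
  (forall X, C X <-> exists Xa Xb, A Xa /\ B Xb /\ X = fadd Xa Xb) /\
  (forall X, A X -> B X -> X = fzero).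

Definition pinter (A B : pset) : pset := fun X => A X /\ B X.

Definition levi_component (g l : pset) : Prop :=
  lie_subalg l /\
  direct_sum (brack g g) (pinter (radical g) (brack g g)) l.

Definition toral (t : pset) : Prop :=
  lie_subalg t /\ (forall X, t X -> semisimple_end X).

End GlVVstar.

(* Main.v *)
Require Import Defs.
From Stdlib Require Import Ncring Ncring_tac.
From HB Require Import structures.
From mathcomp Require Import all_boot all_order all_algebra.
From mathcomp Require Import boolp ring.
From mathcomp Require classical_sets.

(** Let e_i and f_i be bases of V and V_*.  The elements of g with image in the
    span of e_i, i < m, and killing every vector annihilated by f_i, i < m, form
    an increasing sequence of finite-dimensional splittable Lie algebras with
    union g.  Each has a Levi-Mostow decomposition, but these need not be nested:
    the nilradical of one level may act reductively in the next.  The remedy is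
    to look, from a fixed level m1, at a longest chain of invariant subspaces
    whose steps are visible on the span of e_i, i < m1, or through f_i, i < m1.
    Between two consecutive terms of the chain a single simple subquotient then
    carries everything level m1 sees, and a suitable conjugate of the reductive
    part of a higher level contains level m1 modulo elements lowering the chain;
    those lie in the linear nilradical n of g.  Conjugating by exponentials of
    elements of n makes the reductive parts r_1, r_2, ... so obtained increase,
    and g_red is their union.  Its derived algebra l is the union of the
    semisimple parts of the r_k; the toral parts are central in the r_k containing
    them, so they span an abelian algebra of semisimple elements, in which t is a
    complement of its intersection with l. *)

Set Implicit Arguments. Unset Strict Implicit. Unset Printing Implicit Defensive.
Import GRing.Theory.
Local Open Scope ring_scope.

(** Conjugation is needed because level m1 and the reductive part r of a higher level pick out the
    simple blocks V j / M j differently. Level m1 acts through them by a projection f adapted to the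
    first basis vectors and functionals; r acts through them by an e commuting with r, obtained from
    f by complete reducibility. For idempotents, u = e f + (1 - e)(1 - f) satisfies e u = u f. Here
    e and f are idempotent only modulo the refined flag, so u intertwines up to matrices dropping
    three steps, which is the distance from A (j+1) to A j. Since u need not come from g, it is
    traded for a product of exponentials of nilpotent elements of the level. Elements lowering a
    chain lie in the nilradical of a single level, and these nilradicals shrink as levels grow; on a
    fixed level they stabilize, so the chain is taken invariant under a level beyond that point.
    Quotient Lie algebras are never formed: quotient modules become row spaces with smaller
    matrices, and semisimplicity modulo an ideal is [psemi]. Over a general field of characteristic
    0, Cartan's criterion replaces complex conjugation by rational weights keeping all rational
    relations between eigenvalues. *)

Section MatrixNcring.
Variables (R : pzRingType) (n : nat).
Let M := 'M[R]_n.
#[global] Instance mx_ring_ops : @Ncring.Ring_ops 'M[R]_n 0 1%:M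
  (fun x y => x + y) (fun x y => x *m y) (fun x y => x - y) (fun x => - x) (@eq _) := {}.
#[global] Instance mx_ring : @Ncring.Ring 'M[R]_n _ _ _ _ _ _ _ mx_ring_ops.
Proof.
split; rewrite /=; try (exact: eq_equivalence).
all: try by move=> x y -> z t ->.
all: try by move=> x y ->.
- exact: add0r.
- exact: addrC.
- exact: addrA.
- exact: mul1mx.
- exact: mulmx1.
- exact: mulmxA.
- exact: mulmxDl.
- by move=> x y z; exact: mulmxDr.
- by [].
- exact: addrN.
Qed.
End MatrixNcring.

Ltac mxnc := intros; non_commutative_ring.

(** * Subspaces cut out by predicates *)

Section Vsp.
Variables (F : fieldType) (T : vectType F).
Implicit Types (P Q : T -> Prop) (S : {vspace T}).

Definition lclosed P := P 0 /\ forall a x y, P x -> P y -> P (a *: x + y).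

Lemma memvPa S a x y : x \in S -> y \in S -> a *: x + y \in S.
Proof. by move=> xS yS; rewrite memvD ?memvZ. Qed.

Lemma lclosed_vs S : lclosed (fun x => x \in S).
Proof. by split=> [|a x y]; [exact: mem0v | exact: memvPa]. Qed.

Lemma dim_eq_sub S S' : (S <= S')%VS -> (\dim S' <= \dim S)%N -> S = S'.
Proof. by move=> s d; apply/eqP; rewrite eqEdim s d. Qed.

Lemma vs_max (Q : {vspace T} -> Prop) : (exists S, Q S) ->
  exists S, Q S /\ forall S', Q S' -> (\dim S' <= \dim S)%N.
Proof.
move=> [S0 QS0].
pose p n := `[< exists S, Q S /\ \dim S = n >].
have ex : exists n, p n by exists (\dim S0); apply/asboolP; exists S0.
have bd n : p n -> (n <= \dim {:T})%N.
  by move=> /asboolP [S [_ <-]]; apply/dimvS/subvf.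
case: (ex_maxnP ex bd) => m /asboolP [S [QS dS]] mx.
by exists S; split=> // S' QS'; rewrite dS; apply: mx; apply/asboolP; exists S'.
Qed.

Lemma vs_min (Q : {vspace T} -> Prop) : (exists S, Q S) ->
  exists S, Q S /\ forall S', Q S' -> (\dim S <= \dim S')%N.
Proof.
move=> [S0 QS0].
pose p n := `[< exists S, Q S /\ \dim S = n >].
have ex : exists n, p n by exists (\dim S0); apply/asboolP; exists S0.
case: (ex_minnP ex) => m /asboolP [S [QS dS]] mx.
by exists S; split=> // S' QS'; rewrite dS; apply: mx; apply/asboolP; exists S'.
Qed.

(** A subspace of largest dimension inside [P] absorbs every vector satisfying [P], since adding the
    line of that vector stays inside [P]. *)
Lemma vs_of_ex P : lclosed P -> exists S, forall x, x \in S <-> P x.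
Proof.
move=> [P0 PD].
have [|S [SP mx]] := @vs_max (fun S => forall x, x \in S -> P x).
  by exists 0%VS => x; rewrite memv0 => /eqP ->.
exists S => x; split; first exact: SP.
move=> Px; have /mx : forall y, y \in (<[x]> + S)%VS -> P y.
  move=> y /memv_addP [u /vlineP [a ->] [v vS ->]].
  by apply: PD => //; apply: SP.
move=> /(dim_eq_sub (addvSr <[x]> S)) ->.
by apply: (subvP (addvSl _ _)); exact: memv_line.
Qed.

(** Chosen classically, so that subspaces given by quantified conditions have a dimension and can
    enter extremal arguments; 0 is a default for predicates that are not linearly closed. *)
Definition vsp P : {vspace T} :=
  if pselect (exists S, forall x, x \in S <-> P x) is left h then sval (cid h) else 0%VS.

Lemma vspP P : lclosed P -> forall x, (x \in vsp P) <-> P x.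
Proof.
move=> /vs_of_ex h; rewrite /vsp; case: pselect => [h'|/(_ h) //].
case: cid => S /= HS. exact: HS.
Qed.

End Vsp.

Lemma lclosed_and (F : fieldType) (T : vectType F) (P Q : T -> Prop) :
  lclosed P -> lclosed Q -> lclosed (fun x => P x /\ Q x).
Proof.
by move=> [? HP] [? HQ]; split=> // a x y [? ?] [? ?]; split; [apply: HP|apply: HQ].
Qed.

Lemma lclosed_all (F : fieldType) (T : vectType F) I (P : I -> T -> Prop) :
  (forall i, lclosed (P i)) -> lclosed (fun x => forall i, P i x).
Proof.
by move=> H; split=> [i|a x y Hx Hy i]; [case: (H i)|case: (H i) => _; apply].
Qed.

Lemma lclosed_imp (F : fieldType) (T : vectType F) (Q : Prop) (P : T -> Prop) :
  lclosed P -> lclosed (fun x => Q -> P x).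
Proof. by move=> [P0 PD]; split=> // a x y Hx Hy q; apply: PD; auto. Qed.

Lemma lclosed_lin (F : fieldType) (T T' : vectType F) (f : {linear T -> T'})
  (S : {vspace T'}) : lclosed (fun x => f x \in S).
Proof. by split=> [|a x y]; rewrite ?linear0 ?mem0v // linearP; exact: memvPa. Qed.

(** * Brackets of subspaces of matrices *)

Section Bracket.
Variables (F : fieldType) (n : nat).
Implicit Types (x y z : 'M[F]_n) (A B S L I : {vspace 'M[F]_n}).

Definition lb x y := x *m y - y *m x.

Lemma lbPl a x y z : lb (a *: x + y) z = a *: lb x z + lb y z.
Proof. by rewrite /lb mulmxDl mulmxDr -scalemxAl -scalemxAr scalerBr opprD addrACA. Qed.

Lemma lbN x y : lb y x = - lb x y.
Proof. by rewrite /lb opprB. Qed.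

Lemma lbPr a x y z : lb z (a *: x + y) = a *: lb z x + lb z y.
Proof. by rewrite !(lbN _ z) lbPl opprD scalerN. Qed.

Lemma lb0l z : lb 0 z = 0. Proof. by rewrite /lb mul0mx mulmx0 subrr. Qed.
Lemma lb0r z : lb z 0 = 0. Proof. by rewrite lbN lb0l oppr0. Qed.
Lemma lbDl x y z : lb (x + y) z = lb x z + lb y z.
Proof. by rewrite -[x]scale1r lbPl !scale1r. Qed.
Lemma lbDr x y z : lb z (x + y) = lb z x + lb z y.
Proof. by rewrite !(lbN _ z) lbDl opprD. Qed.
Lemma lbZl a x z : lb (a *: x) z = a *: lb x z.
Proof. by rewrite -[a *: x]addr0 lbPl lb0l addr0. Qed.
Lemma lbZr a x z : lb z (a *: x) = a *: lb z x.
Proof. by rewrite !(lbN _ z) lbZl scalerN. Qed.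
Lemma lbNl x z : lb (- x) z = - lb x z.
Proof. by rewrite -scaleN1r lbZl scaleN1r. Qed.
Lemma lbBl x y z : lb (x - y) z = lb x z - lb y z.
Proof. by rewrite lbDl lbNl. Qed.
Lemma lbxx x : lb x x = 0. Proof. exact: subrr. Qed.

Lemma lb_jac x y z : lb (lb x y) z = lb (lb x z) y + lb x (lb y z).
Proof. by rewrite /lb; mxnc. Qed.

Lemma lclosed_lbr z S : lclosed (fun x => lb z x \in S).
Proof. by split=> [|a x y]; rewrite ?lb0r ?mem0v // lbPr; exact: memvPa. Qed.

(** The span of the brackets, written as the intersection of all subspaces containing them, so that
    [br_sub] and [br_ind] come without handling linear combinations. *)
Definition br A B : {vspace 'M[F]_n} :=
  vsp (fun z => forall S, (forall x y, x \in A -> y \in B -> lb x y \in S) -> z \in S).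

Lemma br_lclosed A B : lclosed (fun z => forall S,
  (forall x y, x \in A -> y \in B -> lb x y \in S) -> z \in S).
Proof. by apply: lclosed_all => S; apply/lclosed_imp/lclosed_vs. Qed.

Lemma mem_br A B x y : x \in A -> y \in B -> lb x y \in br A B.
Proof. by move=> xA yB; apply/(vspP (br_lclosed A B)) => S; apply. Qed.

Lemma br_sub A B S : (forall x y, x \in A -> y \in B -> lb x y \in S) -> (br A B <= S)%VS.
Proof. by move=> h; apply/subvP => z /(vspP (br_lclosed A B)); apply. Qed.

Lemma br_ind A B (P : 'M[F]_n -> Prop) : lclosed P ->
  (forall x y, x \in A -> y \in B -> P (lb x y)) -> forall z, z \in br A B -> P z.
Proof.
move=> cP h z zb; apply/(vspP cP); apply: (subvP _ _ zb); apply: br_sub => x y xA yB.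
by apply/(vspP cP)/h.
Qed.

Lemma brS A B A' B' : (A <= A')%VS -> (B <= B')%VS -> (br A B <= br A' B')%VS.
Proof. by move=> /subvP sA /subvP sB; apply: br_sub => x y /sA ? /sB ?; exact: mem_br. Qed.

Definition lie L := forall x y, x \in L -> y \in L -> lb x y \in L.

Lemma br_lie L : lie L -> (br L L <= L)%VS.
Proof. by move=> hL; apply: br_sub. Qed.

Lemma lie_br L : lie L -> lie (br L L).
Proof. by move=> hL x y /(subvP (br_lie hL)) ? /(subvP (br_lie hL)) ?; exact: mem_br. Qed.

(* Modulo a kernel K, every ideal of L is perfect. *)
Definition psemi L K := forall I, (I <= L)%VS ->
  (forall x y, x \in L -> y \in I -> lb x y \in I) -> (I <= br I I + K)%VS.
Definition semis L := psemi L 0%VS.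

Lemma semisP L I : semis L -> (I <= L)%VS ->
  (forall x y, x \in L -> y \in I -> lb x y \in I) -> (I <= br I I)%VS.
Proof. by move=> sL sI hI; have := sL I sI hI; rewrite addv0. Qed.

Definition linimg m (f : 'M[F]_n -> 'M[F]_m) L : {vspace 'M[F]_m} :=
  vsp (fun y : 'M[F]_m => exists2 x, x \in L & y = f x).

Lemma linimgP m (f : {linear 'M[F]_n -> 'M[F]_m}) L (y : 'M[F]_m) :
  y \in linimg f L <-> exists2 x, x \in L & y = f x.
Proof.
rewrite /linimg; apply: (vspP (P := fun y : 'M[F]_m => exists2 x, x \in L & y = f x)).
split; first by exists 0; rewrite ?mem0v ?linear0.
by move=> a u v [x xL ->] [z zL ->]; exists (a *: x + z); rewrite ?memvPa ?linearP.
Qed.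

Lemma mem_linimg m (f : {linear 'M[F]_n -> 'M[F]_m}) L x : x \in L -> f x \in linimg f L.
Proof. by move=> xL; apply/linimgP; exists x. Qed.
End Bracket.

(** An ideal of the image pulls back to an ideal of [L], to which [psemi] applies. Compatibility
    with brackets is asked on [L] only, because passing to a subquotient respects brackets only for
    matrices that stabilize it. *)
Lemma psemi_img (F : fieldType) (n m : nat) (f : {linear 'M[F]_n -> 'M[F]_m})
  (L K : {vspace 'M[F]_n}) :
  (forall x y, x \in L -> y \in L -> f (lb x y) = lb (f x) (f y)) ->
  lie L -> psemi L K -> psemi (linimg f L) (linimg f K).
Proof.
move=> fh hL sL I sI hI.
have cl : lclosed (fun x => x \in L /\ f x \in I).
  by apply: lclosed_and; [exact: lclosed_vs|exact: lclosed_lin].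
have J_sub : (vsp (fun x => x \in L /\ f x \in I) <= L)%VS.
  by apply/subvP => x /(vspP cl) [].
have /(sL _ J_sub)/subvP JJ : forall x y, x \in L ->
    y \in vsp (fun x => x \in L /\ f x \in I) ->
    lb x y \in vsp (fun x => x \in L /\ f x \in I).
  move=> x y xL /(vspP cl) [yL fyI]; apply/(vspP cl); split; first exact: hL.
  by rewrite fh //; apply: hI => //; exact: mem_linimg.
apply/subvP => y yI; have /linimgP [x xL yE] := subvP sI _ yI.
have /JJ/memv_addP [u ub [k kK xE]] : x \in vsp (fun x => x \in L /\ f x \in I).
  by apply/(vspP cl); rewrite -yE.
rewrite yE xE linearD memv_add //; last exact: mem_linimg.
apply: (br_ind (P := fun u => f u \in br I I)) ub; first exact: lclosed_lin.
move=> a b /(vspP cl) [aL aI] /(vspP cl) [bL bI].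
by rewrite fh //; exact: mem_br.
Qed.

Lemma semis_img (F : fieldType) (n m : nat) (f : {linear 'M[F]_n -> 'M[F]_m})
  (L K : {vspace 'M[F]_n}) :
  (forall x y, x \in L -> y \in L -> f (lb x y) = lb (f x) (f y)) ->
  (forall x, x \in K -> f x = 0) ->
  lie L -> psemi L K -> semis (linimg f L).
Proof.
move=> fh f0 hL sL; have := psemi_img fh hL sL.
rewrite (_ : linimg f K = 0%VS) //; apply/eqP; rewrite -subv0; apply/subvP => y.
by move=> /linimgP [x /f0 fx ->]; rewrite fx mem0v.
Qed.

Lemma lie_img (F : fieldType) (n m : nat) (f : {linear 'M[F]_n -> 'M[F]_m})
  (L : {vspace 'M[F]_n}) :
  (forall x y, x \in L -> y \in L -> f (lb x y) = lb (f x) (f y)) ->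
  lie L -> lie (linimg f L).
Proof.
move=> fh hL _ _ /linimgP [x xL ->] /linimgP [y yL ->].
by rewrite -fh //; apply: mem_linimg; exact: hL.
Qed.

Lemma linear_ex (F : fieldType) (U V : lmodType F) (f : U -> V) : linear f ->
  exists g : {linear U -> V}, g =1 f.
Proof.
move=> lf; pose g : {linear U -> V} := HB.pack f (GRing.isLinear.Build F U V _ f lf).
by exists g.
Qed.

(** [kap] takes coordinates along a complement of [B] in [A], and [lam] is its section. *)
Lemma subquot (F : fieldType) (T : vectType F) (A B : {vspace T}) : (B <= A)%VS ->
  exists d (kap : {linear T -> 'rV[F]_d}) (lam : {linear 'rV[F]_d -> T}),
  [/\ (d + \dim B = \dim A)%N, forall c, lam c \in A, forall c, kap (lam c) = c
    & forall v, v \in A -> (kap v = 0 <-> v \in B)].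
Proof.
move=> sBA; pose C := (A :\: B)%VS; pose X := vbasis C.
have CB : (C :&: B)%VS = 0%VS by exact: capv_diff.
have CBA : (C + B)%VS = A by rewrite /C addv_diff; apply/addv_idPl.
have frX : free X := basis_free (vbasisP C).
pose pC := daddv_pi C B.
have lk : linear (fun v => (\row_i coord X i (pC v) : 'rV[F]_(\dim C))).
  by move=> a u v; apply/rowP => i; rewrite !mxE !linearP.
have ll : linear (fun c : 'rV[F]_(\dim C) => \sum_i c 0 i *: X`_i).
  move=> a u v; rewrite scaler_sumr -big_split /=; apply: eq_bigr => i _.
  by rewrite !mxE scalerDl scalerA.
have [kap kapE] := linear_ex lk; have [lam lamE] := linear_ex ll.
have lamC c : lam c \in C.
  by rewrite lamE; apply: memv_suml => i _; apply/memvZ/vbasis_mem/mem_nth; rewrite size_tuple.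
exists (\dim C), kap, lam; split=> [|c|c|v vA].
- by rewrite -(dimv_cap_compl A B) addnC (capv_idPr sBA).
- by rewrite -CBA -[lam c]addr0 memv_add ?mem0v.
- apply/rowP => i; rewrite kapE mxE /pC daddv_pi_id //.
  by rewrite lamE coord_sum_free.
- rewrite kapE; have pcE := daddv_pi_add CB; rewrite CBA in pcE; split.
    move=> /rowP k0; rewrite -(pcE _ vA).
    rewrite (coord_vbasis (memv_pi C B v)) big1 ?add0r ?memv_pi // => i _.
    by have := k0 i; rewrite !mxE => ->; rewrite scale0r.
  move=> vB; apply/rowP => i; rewrite !mxE.
  suff -> : pC v = 0 by rewrite linear0.
  apply: (addIr v); rewrite add0r -[RHS](pcE _ vA) (daddv_pi_id _ vB) //.
  by rewrite capvC.
Qed.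

(** * Semisimple and nilpotent matrices *)

(** Chinese remainder theorem. With [phi] the identity it produces semisimple parts; with [phi] a
    map between eigenvalues of adjoint actions it produces the operator of Cartan's criterion. *)
Lemma poly_crt (F : fieldType) (s : seq F) (phi : F -> F) K : uniq s ->
  exists q : {poly F}, forall c, c \in s -> ('X - c%:P) ^+ K %| q - (phi c)%:P.
Proof.
elim: s => [|c0 s IH] /=; first by exists 0.
move=> /andP [c0s /IH [q hq]].
pose p := (\prod_(c <- s) ('X - c%:P)) ^+ K.
have dvp c : c \in s -> ('X - c%:P) ^+ K %| p.
  by move=> cs; rewrite /p dvdp_exp2r // (big_rem c) //= dvdp_mulr.
have /Bezout_eq1_coprimepP [[u v] /= uv] : coprimep p (('X - c0%:P) ^+ K).
  by rewrite coprimep_expl // coprimep_expr // coprimep_XsubC root_prod_XsubC.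
exists (q + ((phi c0)%:P - q) * (u * p)) => c; rewrite inE => /predU1P [->|cs].
  have -> : u * p = 1 - v * ('X - c0%:P) ^+ K by rewrite -uv addrK.
  by rewrite mulrBr mulr1 addrA addrCA subrr addr0 addrAC subrr sub0r dvdpNr mulrA dvdp_mull.
by rewrite addrAC dvdp_add ?hq // !dvdp_mull // dvp.
Qed.

Lemma dvdp_prod_const (F : fieldType) (r : seq F) (p : {poly F}) :
  (forall z, z \in r -> ('X - z%:P) %| p) -> \prod_(z <- r) ('X - z%:P) %| p ^+ size r.
Proof.
elim: r => [|z r IH] h; first by rewrite big_nil dvd1p.
rewrite big_cons exprS dvdp_mul ?h ?mem_head // IH // => y yr.
by apply: h; rewrite inE yr orbT.
Qed.

Section Diag.
Variables (F : fieldType).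

Definition dg n (A : 'M[F]_n) :=
  exists P (a : 'rV[F]_n), P \in unitmx /\ P *m A = diag_mx a *m P.

Lemma dgP n (A : 'M[F]_n) :
  dg A <-> exists2 P : 'M_n, P \in unitmx & mxpoly.diagonalizable_for P A.
Proof.
split=> [[P [a [Pu e]]]|[P Pu]].
  by exists P => //; apply/mxpoly.diagonalizable_forPex; exists a; apply/simmxP.
by move=> /mxpoly.diagonalizable_forPex [a /(simmxP Pu) e]; exists P, a.
Qed.

Lemma dg_poly n (A : 'M[F]_n.+1) :
  dg A <-> exists2 s : seq F, uniq s & horner_mx A (\prod_(c <- s) ('X - c%:P)) = 0.
Proof.
apply: (iff_trans (dgP A)); apply: (iff_trans (mxpoly.diagonalizableP A)).
by split=> -[s us h]; exists s => //; apply/mxminpoly_minP.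
Qed.

Lemma dg_add n (A B : 'M[F]_n) : A *m B = B *m A -> dg A -> dg B -> dg (A + B).
Proof.
move=> AB /dgP dA /dgP dB.
have /mxpoly.codiagonalizableP [P Pu /= /and3P [PA PB _]] :
  {in [:: A; B] &, forall f g : 'M_n, comm_mx f g} /\
  {in [:: A; B], forall f, exists2 P : 'M_n, P \in unitmx & mxpoly.diagonalizable_for P f}.
  split=> f; last by rewrite !inE => /orP [/eqP ->|/eqP ->].
  by move=> g; rewrite /comm_mx !inE => /orP [/eqP ->|/eqP ->] /orP [/eqP ->|/eqP ->].
have /mxpoly.diagonalizable_forPex [a /(simmxP Pu) ea] := PA.
have /mxpoly.diagonalizable_forPex [b /(simmxP Pu) eb] := PB.
exists P, (a + b); split=> //.
by rewrite mulmxDr ea eb linearD mulmxDl.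
Qed.

Lemma dg_scale n (A : 'M[F]_n) c : dg A -> dg (c *: A).
Proof.
move=> [P [a [Pu e]]]; exists P, (c *: a); split=> //.
by rewrite -scalemxAr e linearZ /= -scalemxAl.
Qed.

Lemma dg0 n : dg (0 : 'M[F]_n).
Proof. by exists 1%:M, 0; rewrite unitmx1 mulmx0 linear0 mul0mx. Qed.

Lemma dg_conj n (A g h : 'M[F]_n) : g *m h = 1%:M -> dg A -> dg (g *m A *m h).
Proof.
move=> gh [P [a [Pu e]]]; have hg := mulmx1C gh; exists (P *m h), a; split.
  by rewrite unitmx_mul Pu (mulmx1_unit gh).2.
by rewrite !mulmxA -(mulmxA P) hg mulmx1 e.
Qed.

Lemma eigen_dg n (A : 'M[F]_n) (rs : seq F) :
  (forall v : 'rV[F]_n, exists k (w : 'I_k -> 'rV[F]_n) (c : 'I_k -> F),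
     [/\ v = \sum_i w i, forall i, w i *m A = c i *: w i & forall i, c i \in rs]) ->
  dg A.
Proof.
move=> h; apply/dgP/mxpoly.diagonalizablePeigen; exists (undup rs); first exact: undup_uniq.
apply/eqmxP; rewrite submx1 /=; apply/row_subP => i.
have [k [w [c [-> hw hc]]]] := h (row i 1%:M).
apply: summx_sub => j _; rewrite (big_rem (c j)) ?mem_undup //=.
by apply: submx_trans (addsmxSl _ _); apply/eigenspaceP.
Qed.

Lemma stab_horner n (A : 'M[F]_n.+1) (S : {vspace 'rV[F]_n.+1}) (p : {poly F}) :
  (forall v, v \in S -> v *m A \in S) -> forall v, v \in S -> v *m horner_mx A p \in S.
Proof.
move=> SA; elim/poly_ind: p => [|p c IH] v vS; first by rewrite rmorph0 mulmx0 mem0v.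
rewrite rmorphD rmorphM /= horner_mx_X horner_mx_C mulmxDr mulmxA mul_mx_scalar.
by rewrite memvD ?memvZ ?SA ?IH.
Qed.

(* On the image of a diagonalizable A, the matrix G inverts A. *)
Lemma dg_regular n (A : 'M[F]_n) : dg A -> exists G, [/\ forall x, x *m A = A *m x -> x *m G = G *m x,
  A = A *m A *m G & forall S : {vspace 'rV[F]_n},
    (forall v, v \in S -> v *m A \in S) -> forall v, v \in S -> v *m G \in S].
Proof.
case: n A => [|n] A.
  by exists 0; split=> [x _||S _ v _]; rewrite ?mulmx0 ?mul0mx ?mem0v // flatmx0.
move=> /dg_poly [s us hs].
(* Keeping only the nonzero roots gives A p0(A) = 0 with p0(0) nonzero. Writing p0 = p0(0) + X g,
   the matrix - g(A) / p0(0) serves as [G]; as a polynomial in [A] it inherits commutation and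
   stable subspaces. *)
pose p0 := \prod_(c <- s | c != 0) ('X - c%:P).
have Ap0 : A *m horner_mx A p0 = 0.
  have [s0|s0] := boolP (0 \in s); last first.
    rewrite /p0 big_seq_cond (eq_bigl (fun c => (c \in s) && true)) => [|c].
      by rewrite -big_seq_cond hs mulmx0.
    by case cs: (c \in s) => //=; apply: contraNneq s0 => <-.
  transitivity (horner_mx A ('X * p0)); first by rewrite rmorphM /= horner_mx_X.
  rewrite -[RHS]hs; congr horner_mx.
  rewrite (big_rem 0 s0) /= subr0 /p0; congr (_ * _).
  rewrite (rem_filter _ us) big_filter; exact: eq_bigl.
have p00 : p0.[0] != 0.
  rewrite horner_prod prodf_seq_neq0; apply/allP => c _.
  by apply/implyP => c0; rewrite hornerXsubC sub0r oppr_eq0.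
have [g p0E] : exists g, p0 = (p0.[0])%:P + 'X * g.
  have : root (p0 - (p0.[0])%:P) 0 by rewrite /root !hornerE subrr.
  rewrite root_factor_theorem subr0 => /dvdpP [g e]; exists g.
  by rewrite [RHS]addrC mulrC -e subrK.
pose G := horner_mx A ((- (p0.[0])^-1) *: g).
exists G; split; last by move=> S SA v vS; apply: stab_horner.
  by move=> x xA; exact: comm_mx_horner.
rewrite /G linearZ -!scalemxAr -mulmxA scaleNr; apply: (scalerI p00).
rewrite scalerN scalerA divff // scale1r; apply/eqP; rewrite -addr_eq0; apply/eqP.
move: Ap0; rewrite {1}p0E rmorphD rmorphM /= horner_mx_C horner_mx_X mulmxDr.
by rewrite mul_mx_scalar => e; rewrite -[RHS]e.
Qed.
End Diag.

Section Nilpotent.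
Variables (F : fieldType).
Definition nilm n (x : 'M[F]_n) := exists k, x ^+ k = 0.

(** Regularity gives x = x (x G)^j for every j, and x G is nilpotent because [G] commutes with
    [x]. *)
Lemma nilm_dg n (x : 'M[F]_n) : nilm x -> dg x -> x = 0.
Proof.
move=> [k xk] /dg_regular [G [xG xE _]].
have h j : x = x * (x * G) ^+ j.
  elim: j => [|j IH]; first by rewrite expr0 mulr1.
  by rewrite exprS mulrA [x * (x * G)]mulrA -mulmxE -xE.
have xG' : GRing.comm x G by apply: xG.
by rewrite (h k) exprMn_comm // xk mul0r mulr0.
Qed.

Lemma nilm_sub n (x y : 'M[F]_n) : x *m y = y *m x -> nilm x -> nilm y -> nilm (x - y).
Proof.
move=> xy [k xk] [l yl]; exists (k + l)%N; rewrite exprBn_comm //.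
rewrite big1 // => i _; case: (leqP l i) => li.
  have -> : y ^+ i = 0 by rewrite -(subnK li) exprD yl mulr0.
  by rewrite mulr0 mul0rn.
have -> : x ^+ (k + l - i) = 0 by rewrite -addnBA ?(ltnW li) // exprD xk mul0r.
by rewrite !(mulr0, mul0r, mul0rn).
Qed.

Lemma nilm_comm_mul n (x y : 'M[F]_n) : x *m y = y *m x -> nilm x -> nilm (x *m y).
Proof.
by move=> xy [k xk]; exists k; rewrite mulmxE exprMn_comm // xk mul0r.
Qed.
End Nilpotent.

Section Closed.
Variables (F : closedFieldType).

Lemma nilm_tr n (x : 'M[F]_n) : nilm x -> \tr x = 0.
Proof.
case: n x => [|n] x; first by rewrite /mxtrace big_ord0.
move=> [k xk]; have [r rE] := closed_field_poly_normal (char_poly x).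
rewrite (monicP (char_poly_monic x)) scale1r in rE.
have r0 z : z \in r -> z = 0.
  rewrite -root_prod_XsubC -rE -eigenvalue_root_char => /eigenvalueP [v vx vn0].
  have vk j : v *m x ^+ j = z ^+ j *: v.
    elim: j => [|j IH]; first by rewrite !expr0 mulmx1 scale1r.
    by rewrite exprS -mulmxE mulmxA vx -scalemxAl IH scalerA exprS.
  have := vk k; rewrite xk mulmx0 => /esym/eqP; rewrite scaler_eq0 (negPf vn0) orbF.
  by rewrite expf_eq0 => /andP [_ /eqP].
have cE : char_poly x = 'X ^+ (size r).
  rewrite rE; elim: r r0 {rE} => [|z r IH] r0; first by rewrite big_nil.
  rewrite big_cons IH => [|y yr]; last by apply: r0; rewrite inE yr orbT.
  by rewrite (r0 z) ?mem_head // subr0 exprS.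
have := char_poly_trace x isT; have := size_char_poly x.
rewrite cE size_polyXn => [[->]]; rewrite coefXn /=.
by rewrite ltn_eqF // => /esym/eqP; rewrite oppr_eq0 => /eqP.
Qed.

(** [q] is congruent to c modulo a high power of X - c at each eigenvalue c. A semisimple part that
    is a polynomial in [x] commutes with whatever commutes with [x] and preserves its stable
    subspaces. *)
Lemma jordan n (x : 'M[F]_n.+1) : exists q : {poly F},
  [/\ q.[0] = 0, dg (horner_mx x q) & nilm (x - horner_mx x q)].
Proof.
have [r rE] := closed_field_poly_normal (char_poly x).
rewrite (monicP (char_poly_monic x)) scale1r in rE.
(* 0 is put among the roots to force q(0) = 0, which makes the semisimple part a multiple of [x];
   [K] exceeds every multiplicity. *)
pose s := undup (0 :: r); pose K := (size r).+1.
have [q hq] := poly_crt id K (undup_uniq (0 :: r)).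
have rs z : z \in r -> z \in s by rewrite mem_undup inE => ->; rewrite orbT.
have dq z : z \in s -> ('X - z%:P) %| q - z%:P.
  by move=> /hq; apply: dvdp_trans; rewrite exprS dvdp_mulIl.
have x0 p : char_poly x %| p -> horner_mx x p = 0.
  by move=> /dvdpP [u ->]; rewrite rmorphM /= Cayley_Hamilton mulr0.
exists q; split.
- have /dq : 0 \in s by rewrite mem_undup mem_head.
  by rewrite -root_factor_theorem polyC0 subr0 => /rootP.
- apply/dg_poly; exists s; first exact: undup_uniq.
  have -> : horner_mx (horner_mx x q) (\prod_(c <- s) ('X - c%:P)) =
            horner_mx x (\prod_(c <- s) (q - c%:P)).
    rewrite !rmorph_prod; apply: eq_bigr => c _.
    by rewrite !rmorphB /= horner_mx_X !horner_mx_C.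
  apply: x0; rewrite rE; apply: (@dvdp_trans _ ((\prod_(c <- s) ('X - c%:P)) ^+ K)).
    apply: (@dvdp_trans _ ((\prod_(c <- s) ('X - c%:P)) ^+ size r)).
      apply: dvdp_prod_const => z /rs zs.
      by rewrite (big_rem z zs) /= dvdp_mulr.
    by rewrite /K exprSr dvdp_mulr.
  rewrite -prodrXl big_seq [X in _ %| X]big_seq.
  elim/big_ind2: _ => [|p1 p2 q1 q2|c /hq //]; first exact: dvdpp.
  exact: dvdp_mul.
- exists (size r); rewrite -[x in x - _](horner_mx_X x) -rmorphB -rmorphXn /=.
  apply: x0; rewrite rE; apply: dvdp_prod_const => z /rs/dq zq.
  have -> : 'X - q = ('X - z%:P) - (q - z%:P) by rewrite opprB addrA subrK.
  by rewrite dvdp_sub.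
Qed.
End Closed.

(** * The adjoint representation on [ 'M_(n * n) ] *)
Section Adjoint.
Variables (F : closedFieldType) (n : nat).
Implicit Types (x y D Y : 'M[F]_n).

(** The sign, Y to [Y, x], makes [Ad] a Lie homomorphism for matrices acting on rows from the
    right. *)
Definition Ad x : 'M[F]_(n * n) := lin_mulmxr x - lin_mulmx x.
Lemma AdE x Y : mxvec Y *m Ad x = mxvec (lb Y x).
Proof. by rewrite mulmxBr !mul_vec_lin /= linearB. Qed.

Lemma mx_ext (A B : 'M[F]_(n * n)) : (forall Y : 'M_n, mxvec Y *m A = mxvec Y *m B) -> A = B.
Proof. by move=> h; apply/row_matrixP => i; rewrite !rowE -[delta_mx _ _]vec_mxK. Qed.

Fact Ad_linear : linear Ad.
Proof.
move=> a x y; apply: mx_ext => Y.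
by rewrite AdE lbPr linearP [RHS]mulmxDr -scalemxAr !AdE.
Qed.
HB.instance Definition _ := GRing.isLinear.Build F _ _ _ Ad Ad_linear.

Lemma Ad_lb x y : Ad (lb x y) = lb (Ad x) (Ad y).
Proof.
apply: mx_ext => Y; rewrite AdE [RHS]mulmxBr !mulmxA !AdE -linearB /=; congr mxvec.
by rewrite (lb_jac Y x y) addrAC subrr add0r.
Qed.

Section EigenUnits.
Variables (P : 'M[F]_n) (a : 'rV[F]_n) (D : 'M[F]_n).
Hypotheses (Pu : P \in unitmx) (PD : P *m D = diag_mx a *m P).
(** Matrix units in the eigenbasis formed by the rows of [P]: a basis of eigenvectors for [Ad D]. *)
Definition eunit i j := invmx P *m delta_mx i j *m P.

Lemma lb_eunit i j : lb (eunit i j) D = (a 0 j - a 0 i) *: eunit i j.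
Proof.
have e' : D = invmx P *m diag_mx a *m P by rewrite -mulmxA -PD mulKmx.
have -> : lb (eunit i j) D = invmx P *m (delta_mx i j *m diag_mx a - diag_mx a *m delta_mx i j) *m P.
  by rewrite /lb /eunit e' !(mulmxA, mulmxBr, mulmxBl) !mulmxK.
have -> : delta_mx i j *m diag_mx a = a 0 j *: delta_mx i j.
  apply/matrixP => k l; rewrite mul_mx_diag !mxE.
  by case: (l =P j) => [->|_]; rewrite ?andbT ?andbF ?mul0r ?mulr0 // mulrC.
have -> : diag_mx a *m delta_mx i j = a 0 i *: delta_mx i j.
  apply/matrixP => k l; rewrite mul_diag_mx !mxE.
  by case: (k =P i) => [->|_] //; rewrite !mulr0.
by rewrite -scalerBl -scalemxAr -scalemxAl.
Qed.

Lemma eunit_sum Y :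
  Y = \sum_(ij : 'I_n * 'I_n) (P *m Y *m invmx P) ij.1 ij.2 *: eunit ij.1 ij.2.
Proof.
have {1}-> : Y = invmx P *m (P *m Y *m invmx P) *m P.
  by rewrite !mulmxA mulVmx // mul1mx mulmxKV.
move: (P *m Y *m _) => Z.
rewrite [Z in LHS]matrix_sum_delta pair_bigA /= mulmx_sumr mulmx_suml.
by apply: eq_bigr => ij _; rewrite -scalemxAr -scalemxAl.
Qed.
End EigenUnits.

Lemma dg_Ad D : dg D -> dg (Ad D).
Proof.
move=> [P [a [Pu e]]].
apply: (@eigen_dg _ _ _ [seq a 0 ij.2 - a 0 ij.1 | ij <- enum (predT : pred ('I_n * 'I_n))]) => v.
pose T : finType := ('I_n * 'I_n)%type.
pose Y := P *m vec_mx v *m invmx P.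
exists #|T|, (fun k => Y (enum_val k).1 (enum_val k).2 *: mxvec (eunit P (enum_val k).1 (enum_val k).2)),
  (fun k => a 0 (enum_val k).2 - a 0 (enum_val k).1); split.
- rewrite -[LHS]vec_mxK [vec_mx v](eunit_sum Pu) linear_sum /=.
  rewrite (reindex (enum_val : 'I_#|T| -> T)) /=; last first.
    by apply: onW_bij; apply: enum_val_bij.
  by apply: eq_bigr => k _; rewrite linearZ.
- by move=> k; rewrite -scalemxAl AdE (lb_eunit Pu e) linearZ /= scalerA mulrC -scalerA.
- by move=> k; apply: map_f; rewrite mem_enum.
Qed.
End Adjoint.

(** * Engel's theorem *)
Section RowAction.
Variables (F : fieldType) (n : nat).
Implicit Types (S : {vspace 'rV[F]_n}) (K L : {vspace 'M[F]_n}).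

Definition ra S K : {vspace 'rV[F]_n} :=
  vsp (fun z => forall S', (forall v x, v \in S -> x \in K -> v *m x \in S') -> z \in S').

Lemma ra_lclosed S K : lclosed (fun z => forall S',
  (forall v x, v \in S -> x \in K -> v *m x \in S') -> z \in S').
Proof. by apply: lclosed_all => S'; apply/lclosed_imp/lclosed_vs. Qed.

Lemma mem_ra S K v x : v \in S -> x \in K -> v *m x \in ra S K.
Proof. by move=> vS xK; apply/(vspP (ra_lclosed S K)) => S'; apply. Qed.

Lemma ra_sub S K S' : (forall v x, v \in S -> x \in K -> v *m x \in S') -> (ra S K <= S')%VS.
Proof. by move=> h; apply/subvP => z /(vspP (ra_lclosed S K)); apply. Qed.

Lemma raS S S' K : (S <= S')%VS -> (ra S K <= ra S' K)%VS.
Proof. by move=> /subvP s; apply: ra_sub => v x /s; exact: mem_ra. Qed.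

(** Its reaching 0 is the form in which simultaneous strict triangularity is used. *)
Definition rpow K m := iter m (ra^~ K) fullv.

Lemma rpow_step K a v x : v \in rpow K a -> x \in K -> v *m x \in rpow K a.+1.
Proof. exact: mem_ra. Qed.

Lemma rpowS K a : (rpow K a.+1 <= rpow K a)%VS.
Proof. by elim: a => [|a IH]; [exact: subvf | exact: raS IH]. Qed.

Lemma rpow_le K a b : (a <= b)%N -> (rpow K b <= rpow K a)%VS.
Proof.
move=> /subnK <-; elim: (b - a)%N => [|c IH]; first exact: subvv.
by rewrite addSn; apply: subv_trans (rpowS _ _) IH.
Qed.

Lemma row_mem0 (x : 'M[F]_n) : (forall v : 'rV_n, v *m x = 0) -> x = 0.
Proof. by move=> h; apply/row_matrixP => i; rewrite rowE h row0. Qed.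

(** Elements of [L] lower the filtration by one step. A bracket of an element lowering by j with one
    lowering by 1 lowers by j + 1, so perfectness makes every element lower by arbitrarily much. *)
Lemma nil_perfect0 L m : rpow L m = 0%VS -> (L <= br L L)%VS -> L = 0%VS.
Proof.
move=> Lm LL.
have h j x : x \in L -> forall a v, v \in rpow L a -> v *m x \in rpow L (a + j).
  elim: j x => [|j IH] x xL.
    by move=> a v va; rewrite addn0; apply: (subvP (rpowS _ _)); exact: mem_ra.
  have : x \in br L L by exact: (subvP LL).
  pose Q (x : 'M[F]_n) := forall a v, v \in rpow L a -> v *m x \in rpow L (a + j.+1).
  apply: (br_ind (P := Q)).
    split=> [a v _|c y z Hy Hz a v va]; first by rewrite mulmx0 mem0v.
    by rewrite mulmxDr -scalemxAr memvPa ?Hy ?Hz.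
  move=> y z yL zL a v va; rewrite /lb mulmxBr !mulmxA memvB //.
    by rewrite addnS; apply: mem_ra => //; exact: IH.
  by rewrite addnS -addSn; apply: IH => //; exact: mem_ra.
apply/eqP; rewrite -subv0; apply/subvP => x xL; rewrite memv0; apply/eqP/row_mem0 => v.
by apply/eqP; rewrite -memv0 -Lm; apply: (h m x xL 0%N); exact: memvf.
Qed.

(** A maximal subalgebra [K] whose filtration vanishes is, unless it is [L], normalized by some [y]
    of [L] outside it; then K + <[y]> still has vanishing filtration. *)
Lemma engel L : lie L -> (forall x, x \in L -> nilm x) -> exists m, rpow L m = 0%VS.
Proof.
move=> hL nL.
pose Q (K : {vspace 'M[F]_n}) := [/\ (K <= L)%VS, lie K & exists m, rpow K m = 0%VS].
have [|K [[KL hK [m Km]] mx]] := @vs_max _ _ Q.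
  exists 0%VS; split; first exact: sub0v.
    by move=> x y; rewrite !memv0 => /eqP -> /eqP ->; rewrite lb0l.
  exists 1%N; apply/eqP; rewrite -subv0; apply: ra_sub => v x _.
  by rewrite memv0 => /eqP ->; rewrite mulmx0 mem0v.
have [LK|] := pselect (L <= K)%VS.
  by exists m; rewrite -Km; congr rpow; apply/eqP; rewrite eqEsubv LK KL.
move=> /negP; rewrite -diffv_eq0 => nLK.
have [y0 y0L y0K] : exists2 y, y \in L & y \notin K.
  by apply: contrapT => h; case/negP: nLK; rewrite diffv_eq0; apply/subvP => y yL;
     apply: contrapT => /negP yK; apply: h; exists y.
have [y [yL yK yn]] : exists y, [/\ y \in L, y \notin K & forall x, x \in K -> lb y x \in K].
  apply: contrapT => hn.
  have step y : y \in L -> y \notin K -> exists2 x, x \in K & lb y x \notin K.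
    move=> yL yK; apply: contrapT => h; apply: hn; exists y; split=> // x xK.
    by apply: contrapT => /negP xyK; apply: h; exists x.
  (* If bracketing with [K] could always avoid landing in [K], it could be repeated. Any matrix
     shifts the filtration by -m at worst, as [rpow K m] is 0, and each bracket improves the shift
     by one; after m + m brackets the result is 0, which does lie in [K]. *)
  have chain j : exists y, [/\ y \in L, y \notin K &
      forall a v, v \in rpow K a -> v *m y \in rpow K (a + j - m)].
    elim: j => [|j [y [yL yK hy]]].
      exists y0; split=> // a v va; rewrite addn0; case: (leqP a m) => am.
        by move: am; rewrite -subn_eq0 => /eqP ->; exact: memvf.
      move: va; have := rpow_le K (ltnW am); rewrite Km subv0 => /eqP ->.
      by rewrite memv0 => /eqP ->; rewrite mul0mx mem0v.
    have [x xK xyK] := step y yL yK; exists (lb y x); split=> //.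
      by apply: hL => //; apply: (subvP KL).
    move=> a v va; rewrite /lb mulmxBr !mulmxA memvB //.
      apply: (subvP (@rpow_le K _ (a + j - m).+1 _)); last by apply: mem_ra => //; exact: hy.
      by rewrite addnS; case: (leqP m (a + j)) => h; [rewrite subSn|rewrite (eqP h)].
    by rewrite addnS -addSn; apply: hy; exact: mem_ra.
  have [y [_ /negP yK hy]] := chain (m + m)%N; case: yK.
  have -> : y = 0; last exact: mem0v.
  apply: row_mem0 => v; apply/eqP; rewrite -memv0 -Km.
  by have := hy 0%N v (memvf v); rewrite add0n addnK.
have Ty a v : v \in rpow K a -> v *m y \in rpow K a.
  elim: a v => [|a IH] v; first by move=> _; exact: memvf.
  move=> va.
  have cl : lclosed (fun v => v *m y \in rpow K a.+1).
    by split=> [|c u w]; rewrite ?mul0mx ?mem0v // mulmxDl -scalemxAl; exact: memvPa.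
  apply/(vspP cl); apply: (subvP _ _ va); apply: ra_sub => u x ua xK; apply/(vspP cl).
  have -> : u *m x *m y = u *m y *m x - u *m lb y x by rewrite /lb mulmxBr !mulmxA subKr.
  by rewrite memvB //; apply: mem_ra => //; [exact: IH | exact: yn].
pose K' := (K + <[y]>)%VS.
have KK' : (K <= K')%VS := addvSl _ _.
have yK' : y \in K' by apply: (subvP (addvSr _ _)); exact: memv_line.
have K'P x : x \in K' -> exists2 k, k \in K & exists c, x = k + c *: y.
  by move=> /memv_addP [k kK [u /vlineP [c ->] ->]]; exists k => //; exists c.
have : (\dim K' <= \dim K)%N.
  apply: mx; split.
  - by apply/subvP => x /K'P [k kK [c ->]]; rewrite memvD ?memvZ //; exact: (subvP KL).
  - move=> x z /K'P [k kK [c ->]] /K'P [l lK [d ->]].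
    apply: (subvP KK'); rewrite lbDl !lbDr !lbZl !lbZr lbxx !scaler0 addr0.
    apply: memvD; last by apply: memvZ; exact: yn.
    by apply: memvD; [exact: hK | apply: memvZ; rewrite lbN memvN; exact: yn].
  have [N yN] := nL y yL.
  exists (N * m)%N; apply/eqP; rewrite -subv0 -Km.
  have iterS j S S' : (S <= S')%VS -> (iter j (ra^~ K') S <= iter j (ra^~ K') S')%VS.
    by move=> s; elim: j => //= j IH; exact: raS.
  have h a : (iter N (ra^~ K') (rpow K a) <= rpow K a.+1)%VS.
    (* On [rpow K a] modulo [rpow K a.+1] only the multiples of [y] act, so [N] successive factors
       from [K'] act as a multiple of y^N = 0. This explains the exponent N * m. *)
    pose Qj j (u : 'rV[F]_n) := exists2 v, v \in rpow K a & u - v *m y ^+ j \in rpow K a.+1.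
    have cl j : lclosed (Qj j).
      split; first by exists 0; rewrite ?mem0v // mul0mx subrr mem0v.
      move=> c u w [v1 v1a h1] [v2 v2a h2]; exists (c *: v1 + v2); first exact: memvPa.
      have -> : c *: u + w - (c *: v1 + v2) *m y ^+ j = c *: (u - v1 *m y ^+ j) + (w - v2 *m y ^+ j).
        by rewrite mulmxDl -scalemxAl opprD addrACA scalerBr.
      exact: memvPa.
    have hj j : forall u, u \in iter j (ra^~ K') (rpow K a) -> Qj j u.
      elim: j => [|j IH] u.
        by move=> ua; exists u => //; rewrite expr0 mulmx1 subrr mem0v.
      move=> uj; apply/(vspP (cl _)); apply: (subvP _ _ uj); apply: ra_sub => v x /IH [w wa hv].
      move=> /K'P [k kK [c ->]]; apply/(vspP (cl _)); exists (c *: w); first exact: memvZ.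
      rewrite exprSr -mulmxE mulmxDr -!scalemxAr -scalemxAl mulmxA -addrA -scalerBr -mulmxBl.
      rewrite memvD ?memvZ //; last exact: Ty.
      apply: mem_ra => //; rewrite -[v](subrK (w *m y ^+ j)) memvD //.
        exact: (subvP (rpowS _ _)).
      by elim: (j) => [|i IHi]; rewrite ?expr0 ?mulmx1 // exprSr -mulmxE mulmxA Ty.
    by apply/subvP => u /hj [v va]; rewrite yN mulmx0 subr0.
  elim: m {Km} => [|m IH]; first by rewrite muln0 subvf.
  rewrite mulnS /rpow iterD; apply: subv_trans (h m); exact: iterS.
move=> /(dim_eq_sub KK') E; case/negP: yK; by rewrite E.
Qed.
End RowAction.

(** * Cartan's criterion *)
Section RatrChar0.
Variables (F : fieldType) (HF : [pchar F] =i pred0).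
Local Notation rt := (@ratr F).

Lemma natr0 n : (n%:R == 0 :> F) = (n == 0)%N.
Proof. by move/pcharf0P: HF => ->. Qed.

Lemma intr0 (z : int) : (z%:~R == 0 :> F) = (z == 0).
Proof. by case: z => n; rewrite ?NegzE ?mulrNz ?oppr_eq0 -?pmulrn natr0. Qed.

Lemma ratr0 : rt 0 = 0. Proof. exact: (ratr_nat F 0). Qed.
Lemma ratr1 : rt 1 = 1. Proof. exact: (ratr_nat F 1). Qed.

(** Identities for [ratr] are checked after multiplying by denominators, which stay nonzero in
    characteristic 0. *)
Lemma ratr_frac (x : rat) (a d : int) : d != 0 -> x * d%:~R = a%:~R ->
  rt x * d%:~R = a%:~R.
Proof.
move=> d0 e; have dx : (denq x)%:~R != 0 :> F by rewrite intr0 denq_eq0.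
apply: (mulIf dx); rewrite /ratr mulrAC divfK // -!rmorphM /=; congr _%:~R.
apply: (@intr_inj rat); rewrite !rmorphM /= -e numqE; ring.
Qed.

Lemma ratr_den (x : rat) : rt x * (denq x)%:~R = (numq x)%:~R.
Proof. by apply: ratr_frac; rewrite ?denq_eq0 // numqE. Qed.

Lemma ratr_add (x y : rat) : rt (x + y) = rt x + rt y.
Proof.
have d0 : denq x * denq y != 0 by rewrite mulf_neq0 ?denq_eq0.
have d0F : (denq x * denq y)%:~R != 0 :> F by rewrite intr0.
apply: (mulIf d0F); rewrite (@ratr_frac _ (numq x * denq y + numq y * denq x)) //.
  by rewrite rmorphD !rmorphM /= -!ratr_den; ring.
by rewrite rmorphD !rmorphM /= !numqE; ring.
Qed.

Lemma ratr_mul (x y : rat) : rt (x * y) = rt x * rt y.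
Proof.
have d0 : denq x * denq y != 0 by rewrite mulf_neq0 ?denq_eq0.
have d0F : (denq x * denq y)%:~R != 0 :> F by rewrite intr0.
apply: (mulIf d0F); rewrite (@ratr_frac _ (numq x * numq y)) //.
  by rewrite !rmorphM /= -!ratr_den; ring.
by rewrite !rmorphM /= !numqE; ring.
Qed.

(* The additive relations between the a_i are also satisfied by the b_i. *)
Lemma rational_shadow n (a : 'rV[F]_n) : a != 0 -> exists b : 'rV[rat]_n, b != 0 /\
  forall k : 'rV[rat]_n, \sum_i rt (k 0 i) * a 0 i = 0 -> \sum_i k 0 i * b 0 i = 0.
Proof.
move=> a0; pose P (k : 'rV[rat]_n) := \sum_i rt (k 0 i) * a 0 i = 0.
have cP : lclosed P.
  split=> [|c k l Hk Hl]; rewrite /P.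
    by apply: big1 => i _; rewrite mxE ratr0 mul0r.
  transitivity (rt c * (\sum_i rt (k 0 i) * a 0 i) + \sum_i rt (l 0 i) * a 0 i); last first.
    by rewrite Hk Hl mulr0 addr0.
  rewrite mulr_sumr -big_split /=; apply: eq_bigr => i _.
  by rewrite !mxE ratr_add ratr_mul mulrDl mulrA.
(* Q^n is divided by the relations among the a_i. A coordinate of the quotient map that does not
   vanish on a basis vector i0 with a_i0 nonzero provides [b]. *)
have [d [kap [lam [_ _ _ kapP]]]] := subquot (subvf (vsp P)).
have [i0 ai0] : exists i, a 0 i != 0 by apply/rV0Pn.
have : kap (delta_mx 0 i0) != 0.
  apply/eqP => /kapP; rewrite memvf => /(_ isT) /(vspP cP).
  rewrite /P (bigD1 i0) //= big1 => [|j ji]; last by rewrite mxE (negPf ji) andbF ratr0 mul0r.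
  by rewrite mxE !eqxx ratr1 mul1r addr0 => /eqP; rewrite (negPf ai0).
move=> /rV0Pn [j kj]; exists (\row_i kap (delta_mx 0 i) 0 j); split.
  by apply/rV0Pn; exists i0; rewrite mxE.
move=> k Pk; have /(kapP _ (memvf k)) : k \in vsp P by apply/(vspP cP).
move=> /rowP /(_ j); rewrite mxE => e; rewrite -[RHS]e [in RHS](row_sum_delta k) linear_sum summxE.
by apply: eq_bigr => i _; rewrite linearZ !mxE.
Qed.
End RatrChar0.

Section Cartan.
Variables (F : closedFieldType) (HF : [pchar F] =i pred0).
Local Notation rt := (@ratr F).

Lemma nilm_Ad n (x : 'M[F]_n) : nilm x -> nilm (Ad x).
Proof.
move=> [k xk]; apply: nilm_sub.
- apply: mx_ext => Y; rewrite !mulmxA !mul_vec_lin /=.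
  by rewrite ?mul_vec_lin /= ?mulmxA.
- exists k; apply: mx_ext => Y; rewrite mulmx0.
  have -> : mxvec Y *m lin_mulmxr x ^+ k = mxvec (Y *m x ^+ k).
    elim: k {xk} => [|k IH]; first by rewrite !expr0 !mulmx1.
    by rewrite !exprSr -!mulmxE !mulmxA IH mul_vec_lin.
  by rewrite xk mulmx0 linear0.
- exists k; apply: mx_ext => Y; rewrite mulmx0.
  have -> : mxvec Y *m lin_mulmx x ^+ k = mxvec (x ^+ k *m Y).
    elim: k {xk} => [|k IH]; first by rewrite !expr0 !mulmx1 mul1mx.
    by rewrite exprSr exprS -!mulmxE !mulmxA IH mul_vec_lin /= !mulmxA.
  by rewrite xk mul0mx linear0.
Qed.

(** On an eigenvector of S for c, S + N - c acts as N, so its k-th power kills the vector and Q acts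
    by its residue e. This evaluates polynomials in [Ad x] on eigenvectors of [Ad s], where s is the
    semisimple part of x. *)
Lemma horner_eigen_nil n (S N : 'M[F]_n.+1) (v : 'rV[F]_n.+1) c e (Q : {poly F}) k :
  S *m N = N *m S -> N ^+ k = 0 -> v *m S = c *: v -> ('X - c%:P) ^+ k %| Q - e%:P ->
  v *m horner_mx (S + N) Q = e *: v.
Proof.
move=> SN Nk vS /dvdpP [g gE].
have vk : v *m (S + N - c%:M) ^+ k = v *m N ^+ k.
  elim: k {Nk gE} => [|k IH]; first by rewrite !expr0.
  have cm : GRing.comm ((S + N - c%:M) ^+ k) N.
    apply/commr_sym/commrX; rewrite /GRing.comm mulrBl mulrBr mulrDl mulrDr -!mulmxE SN.
    by rewrite scalar_mxC.
  rewrite exprS -mulmxE mulmxA mulmxBr mulmxDr vS mul_mx_scalar addrAC subrr add0r.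
  by rewrite -mulmxA mulmxE -cm -mulmxE mulmxA IH -mulmxA mulmxE -exprSr.
have -> : Q = e%:P + ('X - c%:P) ^+ k * g by rewrite mulrC -gE addrC subrK.
rewrite rmorphD rmorphM rmorphXn rmorphB /= horner_mx_X !horner_mx_C mulmxDr mul_mx_scalar.
by rewrite -mulmxE mulmxA vk Nk mulmx0 mul0mx addr0.
Qed.

(** Let s be the semisimple part of x, with eigenvalues a, and let y have the rational shadow b as
    eigenvalues in the same basis. As [Ad y] preserves I and I is perfect, invariance of the trace
    form gives tr(x y) = 0, and this forces b = 0. *)
Lemma trace_form_nil n (I : {vspace 'M[F]_n}) : lie I -> (I <= br I I)%VS ->
  (forall x y, x \in I -> y \in I -> \tr (x *m y) = 0) -> forall x, x \in I -> nilm x.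
Proof.
case: n I => [|n] I hI pI tI x xI; first by exists 1%N; rewrite flatmx0.
have [q [_ [P [a [Pu Pa]]] nu_nil]] := jordan x.
set s := horner_mx x q in Pa nu_nil; pose nu := x - s.
have sx : s *m x = x *m s by apply/esym/comm_mx_horner.
suff a0 : a = 0.
  have s0 : s = 0.
    by rewrite -[s](mulKmx Pu) Pa a0 linear0 mul0mx mulmx0.
  by move: nu_nil; rewrite s0 subr0.
apply/eqP; apply: contrapT => /negP a0.
have [b [b0 hb]] := rational_shadow HF a0.
pose rb : 'rV[F]_n.+1 := \row_i rt (b 0 i).
have shadow (k : 'rV[int]_n.+1) : \sum_i (k 0 i)%:~R * a 0 i = 0 ->
    \sum_i (k 0 i)%:~R * rb 0 i = 0.
  move=> ka; pose k' : 'rV[rat]_n.+1 := \row_i (k 0 i)%:~R.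
  have /hb e : \sum_i rt (k' 0 i) * a 0 i = 0.
    by rewrite -[RHS]ka; apply: eq_bigr => i _; rewrite mxE ratr_int.
  rewrite -[RHS](ratr0 F) -[in RHS]e (@big_morph _ _ rt 0 +%R 0 +%R); [|exact: ratr_add|exact: ratr0].
  by apply: eq_bigr => i _; rewrite ratr_mul // !mxE ratr_int.
have sum_delta (v : 'rV[F]_n.+1) i : \sum_j ((i == j)%:Z)%:~R * v 0 j = v 0 i.
  rewrite (bigD1 i) //= eqxx mul1r big1 ?addr0 // => j /negPf ji.
  by rewrite eq_sym ji mul0r.
(* Equality of two eigenvalue differences is an integer relation, so it passes from [a] to [rb];
   this makes the map [phi] below, from differences for [a] to differences for [rb], well
   defined. *)
have shadow2 i j k l : a 0 j - a 0 i = a 0 l - a 0 k -> rb 0 j - rb 0 i = rb 0 l - rb 0 k.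
  pose kk : 'rV[int]_n.+1 := \row_m ((j == m)%:Z - (i == m)%:Z - ((l == m)%:Z - (k == m)%:Z)).
  have kkE (v : 'rV[F]_n.+1) : \sum_m (kk 0 m)%:~R * v 0 m = v 0 j - v 0 i - (v 0 l - v 0 k).
    rewrite -!sum_delta -!sumrB; apply: eq_bigr => m _.
    by rewrite mxE !rmorphB /= !mulrBl.
  move=> e; apply/eqP; rewrite -subr_eq0; apply/eqP; rewrite -kkE; apply: shadow.
  by rewrite kkE e subrr.
pose y := invmx P *m diag_mx rb *m P.
have Py : P *m y = diag_mx rb *m P by rewrite /y !mulmxA mulmxV // mul1mx.
have nus : nu *m s = s *m nu by rewrite /nu mulmxBl mulmxBr sx.
have nuy : nu *m y = y *m nu.
  have [nu' nuE] : exists nu', nu = invmx P *m nu' *m P.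
    by exists (P *m nu *m invmx P); rewrite !mulmxA mulVmx // mul1mx mulmxKV.
  have sE : s = invmx P *m diag_mx a *m P by rewrite -mulmxA -Pa mulKmx.
  have c1 : nu' *m diag_mx a = diag_mx a *m nu'.
    have := congr1 (fun z => P *m z *m invmx P) nus.
    by rewrite nuE sE !mulmxA !(mulmxK Pu) !mulmxV // !mul1mx.
  have c2 : nu' *m diag_mx rb = diag_mx rb *m nu'.
    apply/matrixP => i j; move/matrixP: c1 => /(_ i j).
    rewrite !mul_mx_diag !mul_diag_mx !mxE => e.
    have [->|nz] := eqVneq (nu' i j) 0; first by rewrite mul0r mulr0.
    have aij : a 0 j = a 0 i by apply: (mulfI nz); rewrite e mulrC.
    have := shadow2 i j i i; rewrite aij !subrr => /(_ erefl) /eqP.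
    by rewrite !mxE subr_eq0 => /eqP ->; rewrite mulrC.
  rewrite nuE /y !mulmxA !(mulmxK Pu) -!(mulmxA (invmx P)); congr (_ *m _).
  by rewrite c2.
(* On the matrix units of the eigenbasis, a polynomial in [Ad x] agrees with [Ad y]; hence [Ad y]
   preserves the subalgebra [I]. *)
have Iy z : z \in I -> lb z y \in I.
  pose K := (n.+1 * n.+1)%N.
  have [KK nuK] := nilm_Ad nu_nil.
  pose s0 := undup [seq a 0 ij.2 - a 0 ij.1 | ij <- enum (predT : pred ('I_n.+1 * 'I_n.+1))].
  pose phi c := if [pick ij : 'I_n.+1 * 'I_n.+1 | a 0 ij.2 - a 0 ij.1 == c] is Some ij
                then rb 0 ij.2 - rb 0 ij.1 else 0.
  have phiE i j : phi (a 0 j - a 0 i) = rb 0 j - rb 0 i.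
    rewrite /phi; case: pickP => [[k l] /= /eqP e|/(_ (i, j))]; last by rewrite /= eqxx.
    exact: shadow2.
  have [Q hQ] := poly_crt phi KK (undup_uniq [seq a 0 ij.2 - a 0 ij.1 | ij <- enum (predT : pred ('I_n.+1 * 'I_n.+1))]).
  pose T : 'M[F]_((n + n * n.+1).+1) := Ad s + Ad nu.
  pose HT : 'M[F]_(n.+1 * n.+1) := horner_mx T Q.
  have key i j : mxvec (eunit P i j) *m HT = (rb 0 j - rb 0 i) *: mxvec (eunit P i j).
    apply: (@horner_eigen_nil (n + n * n.+1) (Ad s) (Ad nu) (mxvec (eunit P i j)) (a 0 j - a 0 i) _ Q KK).
    - apply/eqP; rewrite -subr_eq0; apply/eqP; transitivity (lb (Ad s) (Ad nu)); first by [].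
      by rewrite -Ad_lb /lb nus subrr linear0.
    - exact: nuK.
    - by apply: (etrans (AdE s (eunit P i j))); rewrite (lb_eunit Pu Pa) linearZ.
    - rewrite -phiE; apply: hQ; rewrite mem_undup.
      by apply/mapP; exists (i, j); rewrite // mem_enum.
  have keyY (Y : 'M[F]_n.+1) : mxvec Y *m HT = mxvec (lb Y y).
    rewrite (eunit_sum Pu Y) linear_sum /= mulmx_suml.
    have -> : lb (\sum_ij (P *m Y *m invmx P) ij.1 ij.2 *: eunit P ij.1 ij.2) y =
        \sum_(ij : 'I_n.+1 * 'I_n.+1) lb ((P *m Y *m invmx P) ij.1 ij.2 *: eunit P ij.1 ij.2) y.
      by rewrite /lb mulmx_suml mulmx_sumr -sumrB.
    rewrite linear_sum /=; apply: eq_bigr => ij _.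
    by rewrite lbZl (lb_eunit Pu Py) !linearZ /= -scalemxAl key.
  have cS : lclosed (fun w : 'rV[F]_(n.+1 * n.+1) => vec_mx w \in I) by exact: lclosed_lin.
  have step (v : 'rV[F]_(n.+1 * n.+1)) : vec_mx v \in I -> vec_mx (v *m (Ad s + Ad nu)) \in I.
    move=> vI; have -> : v *m (Ad s + Ad nu) = mxvec (lb (vec_mx v) x).
      by rewrite -AdE vec_mxK -linearD /nu subrKC.
    by rewrite mxvecK; exact: hI.
  move=> zI.
  have /(vspP cS) : mxvec z *m HT \in vsp (fun w : 'rV[F]_(n.+1 * n.+1) => vec_mx w \in I).
    apply: (@stab_horner F (n + n * n.+1) T) => [v /(vspP cS) vI|]; apply/(vspP cS).
      exact: step.
    by rewrite mxvecK.
  by rewrite keyY mxvecK.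
have t0 z : z \in I -> \tr (z *m y) = 0.
  move=> /(subvP pI); apply: (br_ind (P := fun z => \tr (z *m y) = 0)).
    by split=> [|c u v Hu Hv]; rewrite ?mul0mx ?mxtrace0 // mulmxDl -scalemxAl mxtraceD mxtraceZ Hu Hv mulr0 addr0.
  move=> u v uI vI; rewrite -[RHS](tI u (lb v y) uI (Iy v vI)).
  rewrite /lb !(mulmxBl, mulmxBr) !linearB /= !mulmxA; congr (_ - _).
  by rewrite -!mulmxA mxtrace_mulC !mulmxA.
have := t0 x xI; have -> : x = s + nu by rewrite /nu addrC subrK.
rewrite mulmxDl mxtraceD (nilm_tr (nilm_comm_mul nuy nu_nil)) addr0.
have -> : s = invmx P *m diag_mx a *m P by rewrite -mulmxA -Pa mulKmx.
rewrite /y !mulmxA (mulmxK Pu) mxtrace_mulC !mulmxA mulmxV // mul1mx.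
(* The trace is the sum of the a_i b_i. Read as a rational relation among the a_i with coefficients
   b_i, it holds for [b] too, so the squares of the rational b_i sum to 0. *)
rewrite mulmx_diag mxtrace_diag => e.
have /hb/eqP : \sum_i rt (b 0 i) * a 0 i = 0.
  by rewrite -[RHS]e; apply: eq_bigr => i _; rewrite !mxE mulrC.
rewrite Num.Theory.psumr_eq0 => [/allP h|i _]; last by rewrite -expr2 Num.Theory.sqr_ge0.
case/negP: b0; apply/eqP/rowP => i; rewrite mxE.
by have := h i (mem_index_enum i); rewrite /= mulf_eq0 orbb => /eqP.
Qed.

Lemma trace_form_perfect0 n (I : {vspace 'M[F]_n}) : lie I -> (I <= br I I)%VS ->
  (forall x y, x \in I -> y \in I -> \tr (x *m y) = 0) -> I = 0%VS.
Proof.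
move=> hI pI tI; have [m Im] := engel hI (trace_form_nil hI pI tI).
exact: nil_perfect0 Im pI.
Qed.
End Cartan.

(** * Weyl's theorem *)
Section Subquotient.
Variables (F : fieldType) (n : nat).
Implicit Types (A B : {vspace 'rV[F]_n}) (x y : 'M[F]_n).

Definition stab A x := forall v, v \in A -> v *m x \in A.

Lemma subrep A B : (B <= A)%VS -> exists d (K : 'M[F]_(n, d)) (J : 'M[F]_(d, n)),
  [/\ (d + \dim B = \dim A)%N, J *m K = 1%:M, forall c, c *m J \in A
    & forall v, v \in A -> (v *m K = 0 <-> v \in B)].
Proof.
move=> /subquot [d [kap [lam [dd lamA kl kapP]]]].
exists d, (lin1_mx kap), (lin1_mx lam); split=> // [|c|v vA]; rewrite ?mul_rV_lin1 //.
  by apply/row_matrixP => i; rewrite row_mul mul_rV_lin1 rowE mul_rV_lin1 kl row1.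
exact: kapP.
Qed.

Variables (A B : {vspace 'rV[F]_n}) (d : nat) (K : 'M[F]_(n, d)) (J : 'M[F]_(d, n)).
Hypotheses (JK : J *m K = 1%:M) (JA : forall c, c *m J \in A).
Hypothesis KP : forall v, v \in A -> (v *m K = 0 <-> v \in B).

Lemma subrep_back v : v \in A -> v *m K *m J - v \in B.
Proof.
move=> vA; apply/KP; first by rewrite memvB.
by rewrite mulmxBl -(mulmxA _ J K) JK mulmx1 subrr.
Qed.

Hypothesis BA : (B <= A)%VS.

Lemma subrep_act v x : v \in A -> stab A x -> stab B x -> v *m x *m K = v *m K *m (J *m x *m K).
Proof.
move=> vA Ax Bx; apply/eqP; rewrite eq_sym -subr_eq0 !mulmxA -!mulmxBl; apply/eqP.
by apply/KP; [apply/(subvP BA) | ]; apply: Bx; apply: subrep_back.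
Qed.

Lemma subrep_mul x y : stab A x -> stab A y -> stab B y ->
  J *m (x *m y) *m K = (J *m x *m K) *m (J *m y *m K).
Proof.
move=> Ax Ay By; apply/row_matrixP => i; rewrite !rowE !mulmxA.
rewrite (@subrep_act (_ *m J *m x) y) // ?mulmxA //.
by apply: Ax; apply: JA.
Qed.

Lemma subrep_lb x y : stab A x -> stab A y -> stab B x -> stab B y ->
  J *m lb x y *m K = lb (J *m x *m K) (J *m y *m K).
Proof. by move=> Ax Ay Bx By; rewrite /lb mulmxBr mulmxBl !subrep_mul. Qed.

(** The action of [x] on A / B in the coordinates of [subrep]. It is linear in every [x], but
    respects brackets only among matrices stabilizing [A] and [B]. *)
Definition sq (x : 'M[F]_n) : 'M[F]_d := J *m x *m K.
Fact sq_linear : linear sq.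
Proof. by move=> a x y; rewrite /sq mulmxDr mulmxDl -scalemxAr -scalemxAl. Qed.
HB.instance Definition _ := GRing.isLinear.Build F _ _ _ sq sq_linear.
End Subquotient.

Section Weyl.
Variables (F : closedFieldType) (HF : [pchar F] =i pred0).

Section Casimir.
Variables (n : nat) (L : {vspace 'M[F]_n}).
Hypotheses (hL : lie L) (sL : semis L).
Let k := \dim L.
Let X := vbasis L.
Let G : 'M[F]_k := \matrix_(i, j) \tr (X`_i *m X`_j).

Lemma Xmem i : (i < k)%N -> X`_i \in L.
Proof. by move=> ik; apply/vbasis_mem/mem_nth; rewrite size_tuple. Qed.

Lemma trC (x y : 'M[F]_n) : \tr (x *m y) = \tr (y *m x). Proof. exact: mxtrace_mulC. Qed.

Lemma tr_lb (x y z : 'M[F]_n) : \tr (lb x y *m z) = \tr (x *m lb y z).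
Proof.
rewrite /lb !(mulmxBl, mulmxBr) !linearB /= !mulmxA; congr (_ - _).
by rewrite -!mulmxA mxtrace_mulC !mulmxA.
Qed.

(** The radical of the trace form is an ideal of [L], hence perfect, and the form vanishes on it;
    Cartan's criterion kills it. *)
Lemma trace_radical0 : forall x, x \in L -> (forall y, y \in L -> \tr (x *m y) = 0) -> x = 0.
Proof.
pose P (x : 'M[F]_n) := x \in L /\ forall y, y \in L -> \tr (x *m y) = 0.
have cP : lclosed P.
  apply: lclosed_and; first exact: lclosed_vs.
  apply: lclosed_all => y; apply: lclosed_imp.
  by split=> [|c u v Hu Hv]; rewrite ?mul0mx ?mxtrace0 // mulmxDl -scalemxAl mxtraceD mxtraceZ Hu Hv mulr0 addr0.
have RL : (vsp P <= L)%VS by apply/subvP => x /(vspP cP) [].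
have Rid x y : x \in L -> y \in vsp P -> lb x y \in vsp P.
  move=> xL /(vspP cP) [yL hy]; apply/(vspP cP); split; first exact: hL.
  by move=> z zL; rewrite lbN mulNmx linearN /= tr_lb hy ?oppr0 //; exact: hL.
have : vsp P = 0%VS.
  apply: (trace_form_perfect0 HF); last 1 first.
  - by move=> x y /(vspP cP) [_ hx] /(vspP cP) [yL _]; exact: hx.
  - by move=> x y xR yR; apply: Rid => //; exact: (subvP RL).
  - by apply: (semisP sL RL) => x y; exact: Rid.
move=> R0 x xL hx; apply/eqP; rewrite -memv0 -R0; exact/(vspP cP).
Qed.

Lemma G_unit : G \in unitmx.
Proof.
rewrite -row_free_unit; apply: inj_row_free => c cG.
have e : \sum_(i < k) c 0 i *: X`_i = 0.
  apply: trace_radical0 => [|y yL].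
    by apply: memv_suml => i _; apply/memvZ/Xmem.
  rewrite (coord_vbasis yL) mulmx_sumr linear_sum big1 // => j _.
  rewrite -scalemxAr linearZ /= mulmx_suml linear_sum /=.
  move/rowP: cG => /(_ j); rewrite !mxE => e.
  rewrite (eq_bigr (fun i => c 0 i * G i j)) ?e ?mulr0 // => i _.
  by rewrite -scalemxAl linearZ mxE.
apply/rowP => i; rewrite mxE; move/freeP: (basis_free (vbasisP L)) => /(_ (c 0)).
exact.
Qed.

Definition om (C : 'M[F]_k) : 'M[F]_n := \sum_i \sum_j C i j *: (X`_i *m X`_j).
Definition casimir := om (invmx G).

(** [A] is the matrix of ad y on the basis. Invariance of the trace form is A G + G A^T = 0, which
    for C = G^-1 is the same as A^T C + C A = 0, so the Casimir element is central. *)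
Lemma om_comm y : y \in L -> exists A : 'M[F]_k,
  [/\ A *m G + G *m A^T = 0 & forall C, lb y (om C) = om (A^T *m C + C *m A)].
Proof.
move=> yL; have [A AE] : exists A : 'M[F]_k, forall i : 'I_k, lb y X`_i = \sum_j A i j *: X`_j.
  exists (\matrix_(i, j) coord X j (lb y X`_i)) => i.
  rewrite [LHS](coord_vbasis (hL yL (Xmem (ltn_ord i)))).
  by apply: eq_bigr => j _; rewrite mxE.
exists A; split.
  apply/matrixP => i j; rewrite !mxE.
  have -> : \sum_l A i l * G l j = \tr (lb y X`_i *m X`_j).
    rewrite AE mulmx_suml linear_sum; apply: eq_bigr => l _.
    by rewrite -scalemxAl linearZ [G _ _]mxE.
  have -> : \sum_l G i l * A^T l j = \tr (X`_i *m lb y X`_j).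
    rewrite AE mulmx_sumr linear_sum; apply: eq_bigr => l _.
    by rewrite -scalemxAr linearZ [G _ _]mxE [A^T _ _]mxE mulrC.
  by rewrite -(tr_lb X`_i) -linearD -mulmxDl [lb X`_i y]lbN subrr mul0mx linear0.
move=> D; have -> : lb y (om D) = \sum_i \sum_j D i j *: (lb y X`_i *m X`_j + X`_i *m lb y X`_j).
  rewrite /lb /om mulmx_sumr mulmx_suml -sumrB; apply: eq_bigr => i _.
  rewrite mulmx_sumr mulmx_suml -sumrB; apply: eq_bigr => j _.
  rewrite -scalemxAr -scalemxAl -scalerBr; congr (_ *: _); mxnc.
have -> : \sum_i \sum_j D i j *: (lb y X`_i *m X`_j + X`_i *m lb y X`_j) =
   \sum_i \sum_j D i j *: (lb y X`_i *m X`_j) + \sum_i \sum_j D i j *: (X`_i *m lb y X`_j).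
  rewrite -big_split /=; apply: eq_bigr => i _; rewrite -big_split /=.
  by apply: eq_bigr => j _; rewrite scalerDr.
have omD U W : om (U + W) = om U + om W.
  rewrite /om -big_split /=; apply: eq_bigr => i _; rewrite -big_split /=.
  by apply: eq_bigr => j _; rewrite mxE scalerDl.
rewrite omD; congr (_ + _).
  rewrite /om exchange_big [RHS]exchange_big /=; apply: eq_bigr => j _.
  rewrite (eq_bigr (fun i => \sum_l (D i j * A i l) *: (X`_l *m X`_j))) => [|i _].
    rewrite exchange_big; apply: eq_bigr => l _; rewrite -scaler_suml; congr (_ *: _).
    by rewrite mxE; apply: eq_bigr => i _; rewrite mxE mulrC.
  by rewrite AE mulmx_suml scaler_sumr; apply: eq_bigr => l _; rewrite -scalemxAl scalerA.
rewrite /om; apply: eq_bigr => i _.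
rewrite (eq_bigr (fun j => \sum_l (D i j * A j l) *: (X`_i *m X`_l))) => [|j _].
  rewrite exchange_big; apply: eq_bigr => l _; rewrite -scaler_suml; congr (_ *: _).
  by rewrite mxE.
by rewrite AE mulmx_sumr scaler_sumr; apply: eq_bigr => l _; rewrite -scalemxAr scalerA.
Qed.

Lemma casimir_comm y : y \in L -> y *m casimir = casimir *m y.
Proof.
move=> yL; have [A [AG omE]] := om_comm yL.
apply/eqP; rewrite -subr_eq0 -/(lb y casimir) omE.
have -> : A^T *m invmx G + invmx G *m A = invmx G *m (A *m G + G *m A^T) *m invmx G.
  rewrite mulmxDr mulmxDl !mulmxA mulVmx ?G_unit // mul1mx addrC; congr (_ + _).
  by rewrite -!mulmxA mulmxV ?G_unit // mulmx1.
rewrite AG mulmx0 mul0mx /om big1 // => i _; rewrite big1 // => j _.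
by rewrite mxE scale0r.
Qed.

Lemma casimir_tr : \tr casimir = k%:R.
Proof.
have <- : \tr (invmx G *m G) = k%:R by rewrite mulVmx ?G_unit // mxtrace1.
rewrite /casimir /om linear_sum; apply: eq_bigr => i _; rewrite linear_sum mxE.
by apply: eq_bigr => j _; rewrite linearZ [G _ _]mxE trC.
Qed.

Lemma casimir_ra (v : 'rV[F]_n) : v *m casimir \in ra fullv L.
Proof.
rewrite /casimir /om mulmx_sumr; apply: memv_suml => i _; rewrite mulmx_sumr.
apply: memv_suml => j _; rewrite -scalemxAr mulmxA memvZ // mem_ra ?memvf //.
exact: Xmem.
Qed.

Lemma casimir_inv (v : 'rV[F]_n) : (forall x, x \in L -> v *m x = 0) -> v *m casimir = 0.
Proof.
move=> h; rewrite /casimir /om mulmx_sumr big1 // => i _; rewrite mulmx_sumr big1 // => j _.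
by rewrite -scalemxAr mulmxA h ?mul0mx ?scaler0 //; exact: Xmem.
Qed.
End Casimir.

(* The sum decomposes as invariants plus L-moved vectors: on the generalized
   kernel of the Casimir element one recurses, and that kernel is proper
   because the Casimir element has trace dim L. *)
Lemma weyl_split n (L : {vspace 'M[F]_n}) : lie L -> semis L ->
  (forall v : 'rV[F]_n, exists v0 v1, [/\ v = v0 + v1,
     forall x, x \in L -> v0 *m x = 0 & v1 \in ra fullv L]) /\
  (forall v : 'rV[F]_n, v \in ra fullv L -> (forall x, x \in L -> v *m x = 0) -> v = 0).
Proof.
elim/ltn_ind: n L => n IH L hL sL.
have [L0|Ln0] := eqVneq (\dim L) 0%N.
  have {}L0 : L = 0%VS by apply/eqP; rewrite -dimv_eq0 L0.
  split=> [v|v vr _].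
    exists v, 0; split; rewrite ?addr0 ?mem0v // => x.
    by rewrite L0 memv0 => /eqP ->; rewrite mulmx0.
  apply/eqP; rewrite -memv0; apply: (subvP _ _ vr); apply: ra_sub => u x _.
  by rewrite L0 memv0 => /eqP ->; rewrite mulmx0 mem0v.
case: n => [|n] in L IH hL sL Ln0 *.
  by case/eqP: Ln0; apply/eqP; rewrite -leqn0; apply: leq_trans (dimvS (subvf L)) _; rewrite dimvf /dim /= muln0.
set O := casimir L.
have [q [q0 sdg snil]] := jordan O.
set s := horner_mx O q in sdg snil.
have [G [cG sE stG]] := dg_regular sdg; have sG := cG s erefl.
(* q(0) = 0 makes [s] a multiple of the Casimir element, so [s] maps everything into [ra fullv L]
   and kills the invariants. *)
have [g gE] : exists g, s = horner_mx O g *m O.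
  have : root q 0 by apply/rootP.
  rewrite root_factor_theorem subr0 => /dvdpP [g qE]; exists g.
  by rewrite /s qE rmorphM /= horner_mx_X.
have sL' x : x \in L -> x *m s = s *m x.
  by move=> xL; apply: comm_mx_horner; exact: casimir_comm.
have cE : lclosed (fun v : 'rV[F]_n.+1 => v *m s = 0).
  by split=> [|a u v Hu Hv]; rewrite ?mul0mx // mulmxDl -scalemxAl Hu Hv scaler0 addr0.
pose E := vsp (fun v : 'rV[F]_n.+1 => v *m s = 0).
have imra v : v *m s \in ra fullv L.
  by rewrite gE mulmxA; exact: casimir_ra.
have EP v : v - v *m G *m s \in E.
  have GsS : G *m (s *m s) = s by rewrite mulmxA -sG -mulmxA -sG mulmxA -sE.
  by apply/(vspP cE); rewrite mulmxBl -!mulmxA GsS subrr.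
have stE x : x \in L -> stab E x.
  by move=> xL v /(vspP cE) vs; apply/(vspP cE); rewrite -mulmxA sL' // mulmxA vs mul0mx.
have st0 x : stab (0%VS : {vspace 'rV[F]_n.+1}) x.
  by move=> v; rewrite memv0 => /eqP ->; rewrite mul0mx mem0v.
have [d [K [J [dd JK JE KP]]]] := subrep (sub0v E).
have dn : (d < n.+1)%N.
  have -> : d = \dim E by rewrite -dd dimv0 addn0.
  have dimn : \dim {:'rV[F]_n.+1} = n.+1 by rewrite dimvf /dim /= mul1n.
  rewrite -[X in (_ < X)%N]dimn ltn_neqAle (dimvS (subvf E)) andbT; apply/negP => /eqP e.
  have Ef : E = fullv by apply: dim_eq_sub; rewrite ?subvf // e.
  have s0 : s = 0.
    by apply: row_mem0 => v; apply/(vspP cE); rewrite -/E Ef memvf.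
  move: snil; rewrite s0 subr0 => /nilm_tr; rewrite casimir_tr // => /eqP.
  by rewrite natr0 // (negPf Ln0).
pose phi := sq K J.
have phiM x y : x \in L -> y \in L -> phi (lb x y) = lb (phi x) (phi y).
  by move=> xL yL; apply: (subrep_lb JK JE KP (sub0v _)) => //; exact: stE.
have act v x : v \in E -> x \in L -> v *m x *m K = v *m K *m phi x.
  by move=> vE xL; apply: (subrep_act JK JE KP (sub0v _)) => //; exact: stE.
have hL' : lie (linimg phi L) by apply: lie_img.
have sL'' : semis (linimg phi L).
  apply: (@semis_img _ _ _ _ L 0) => // x; rewrite memv0 => /eqP ->; exact: linear0.
have [IH1 IH2] := IH d dn _ hL' sL''.
have backE v : v \in E -> v = v *m K *m J.
  move=> vE; have := subrep_back JK JE KP vE; rewrite memv0 subr_eq0 => /eqP //.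
have KJ0 c : c *m J *m K = c by rewrite -mulmxA JK mulmx1.
split=> [v|v vr vL].
  have [c0 [c1 [cc c0L c1r]]] := IH1 ((v - v *m G *m s) *m K).
  exists (c0 *m J), (c1 *m J + v *m G *m s); split.
  - by rewrite addrA -mulmxDl -cc -backE // subrK.
  - move=> x xL; rewrite (backE (c0 *m J *m x)); last exact: stE.
    by rewrite act // KJ0 c0L ?mul0mx //; apply: mem_linimg.
  - rewrite memvD //.
    have cl : lclosed (fun c : 'rV[F]_d => c *m J \in ra fullv L).
      by split=> [|a x y]; rewrite ?mul0mx ?mem0v // mulmxDl -scalemxAl; exact: memvPa.
    apply/(vspP cl); apply: (subvP _ _ c1r); apply: ra_sub => c y _ /linimgP [x xL ->].
    apply/(vspP cl); rewrite -[c]KJ0 -act // -backE; last exact: stE.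
    by apply: mem_ra => //; exact: memvf.
have vE : v \in E.
  by apply/(vspP cE); rewrite gE (_ : horner_mx O g *m O = O *m horner_mx O g) ?mulmxA;
    [rewrite /O casimir_inv ?mul0mx | rewrite -[O in LHS]/O; apply/esym/comm_mx_horner].
have e : v *m K = 0.
  apply: IH2 => [|_ /linimgP [x xL ->]]; last by rewrite -act // vL // mul0mx.
  (* The projection u - u G s onto [E] commutes with [L], so it carries vectors moved by [L] to
     vectors moved inside [E], where the induction hypothesis applies. *)
  pose Q (u : 'rV[F]_n.+1) := (u - u *m G *m s) *m K \in ra fullv (linimg phi L).
  have cQ : lclosed Q.
    split=> [|a x y Hx Hy]; rewrite /Q ?mul0mx ?subrr ?mul0mx ?mem0v //.
    have -> : a *: x + y - (a *: x + y) *m G *m s = a *: (x - x *m G *m s) + (y - y *m G *m s).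
      by rewrite !mulmxDl -!scalemxAl scalerBr opprD addrACA.
    by rewrite mulmxDl -scalemxAl memvPa.
  suff : Q v.
    rewrite /Q -mulmxA -sG mulmxA; move/(vspP cE): vE => ->.
    by rewrite mul0mx subr0.
  apply/(vspP cQ); apply: (subvP _ _ vr); apply: ra_sub => u x _ xL; apply/(vspP cQ).
  rewrite /Q.
  have Gx : x *m (G *m s) = G *m s *m x.
    have xG : x *m G = G *m x by apply: cG; exact: sL'.
    by rewrite mulmxA xG -!mulmxA (sL' x xL).
  have -> : u *m x - u *m x *m G *m s = (u - u *m G *m s) *m x.
    by rewrite mulmxBl -!mulmxA Gx -!mulmxA.
  by rewrite act // mem_ra ?memvf //; exact: mem_linimg.
by rewrite (backE v vE) e mul0mx.
Qed.
End Weyl.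

Section WeylSubquotient.
Variables (F : closedFieldType) (HF : [pchar F] =i pred0).

(** Since [K] acts as 0 on A / B, the image of [L] there is genuinely semisimple. The first half is
    existence of the decomposition into invariants and moved vectors, the second its uniqueness. *)
Lemma weyl_subquot n (L K : {vspace 'M[F]_n}) (A B : {vspace 'rV[F]_n}) :
  lie L -> psemi L K -> (B <= A)%VS ->
  (forall x, x \in L -> stab A x) -> (forall x, x \in L -> stab B x) ->
  (forall x v, x \in K -> v \in A -> v *m x \in B) ->
  (forall v, v \in A -> exists v0 v1, [/\ v = v0 + v1, v0 \in A,
     forall x, x \in L -> v0 *m x \in B & v1 \in (ra A L + B)%VS]) /\
  (forall v, v \in A -> v \in (ra A L + B)%VS -> (forall x, x \in L -> v *m x \in B) -> v \in B).
Proof.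
move=> hL sL BA LA LB KAB.
have [d [Q [J [dd JQ JA QP]]]] := subrep BA.
pose phi := sq Q J.
have phiM x y : x \in L -> y \in L -> phi (lb x y) = lb (phi x) (phi y).
  by move=> xL yL; apply: (subrep_lb JQ JA QP BA); auto.
have act v x : v \in A -> x \in L -> v *m x *m Q = v *m Q *m phi x.
  by move=> vE xL; apply: (subrep_act JQ JA QP BA); auto.
have hL' : lie (linimg phi L) by apply: lie_img.
have sL' : semis (linimg phi L).
  apply: (@semis_img _ _ _ _ L K) => // x xK; apply: row_mem0 => c.
  rewrite /phi /= /sq !mulmxA; apply/QP; last by apply: KAB.
  by apply: (subvP BA); apply: KAB.
have [W1 W2] := weyl_split HF hL' sL'.
have back v : v \in A -> v - v *m Q *m J \in B.
  by move=> vA; rewrite -memvN opprB; exact: subrep_back JQ JA QP v vA.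
have raB v w : v \in A -> v - w \in B -> w \in (ra A L + B)%VS -> v \in (ra A L + B)%VS.
  by move=> vA vw wr; rewrite -[v](subrK w) memvD //; apply: (subvP (addvSr _ _)).
have JQ0 c : c *m J *m Q = c by rewrite -mulmxA JQ mulmx1.
split=> [v vA|v vA vr vL].
  have [c0 [c1 [cc c0L c1r]]] := W1 (v *m Q).
  exists (c0 *m J), (v - c0 *m J); split; rewrite ?subrKC //.
    move=> x xL; apply/QP; first by apply: LA => //; exact: JA.
    by rewrite act // JQ0 c0L //; exact: mem_linimg.
  apply: (raB _ (c1 *m J)); first by rewrite memvB.
    by rewrite -addrA -opprD -mulmxDl -cc; exact: back.
  have cl : lclosed (fun c : 'rV[F]_d => c *m J \in (ra A L + B)%VS).
    by split=> [|a x y]; rewrite ?mul0mx ?mem0v // mulmxDl -scalemxAl; exact: memvPa.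
  apply/(vspP cl); apply: (subvP _ _ c1r); apply: ra_sub => c y _ /linimgP [x xL ->].
  apply/(vspP cl); apply: (raB _ (c *m J *m x)); first exact: JA.
    rewrite -memvN opprB; have -> : c *m phi x *m J = c *m J *m x *m Q *m J.
      by rewrite /phi /= /sq !mulmxA.
    by apply: back; apply: LA => //; exact: JA.
  by apply: (subvP (addvSl _ _)); apply: mem_ra => //; exact: JA.
apply/(QP _ vA); apply: W2 => [|_ /linimgP [x xL ->]]; last first.
  by rewrite -act //; apply/QP; [exact: LA|exact: vL].
have cl : lclosed (fun u : 'rV[F]_n => u *m Q \in ra fullv (linimg phi L)).
  by split=> [|a x y]; rewrite ?mul0mx ?mem0v // mulmxDl -scalemxAl; exact: memvPa.
apply/(vspP cl); apply: (subvP _ _ vr); rewrite subv_add; apply/andP; split.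
  apply: ra_sub => u x uA xL; apply/(vspP cl); rewrite act // mem_ra ?memvf //.
  exact: mem_linimg.
by apply/subvP => u uB; apply/(vspP cl); rewrite (QP _ _).2 ?mem0v // (subvP BA).
Qed.

Lemma lclosed_vec n (S : {vspace 'M[F]_n}) : lclosed (fun v : 'rV[F]_(n * n) => vec_mx v \in S).
Proof. exact: lclosed_lin. Qed.

Definition rowsp n (S : {vspace 'M[F]_n}) : {vspace 'rV[F]_(n * n)} :=
  vsp (fun v => vec_mx v \in S).
Lemma rowspP n (S : {vspace 'M[F]_n}) v : v \in rowsp S <-> vec_mx v \in S.
Proof. exact: vspP (lclosed_vec S) v. Qed.

Lemma vec_Ad n (v : 'rV[F]_(n * n)) (x : 'M[F]_n) : vec_mx (v *m Ad x) = lb (vec_mx v) x.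
Proof. by rewrite -[v in LHS]vec_mxK AdE mxvecK. Qed.

(** [weyl_subquot] for the adjoint action on M / P, with matrices read as rows. *)
Lemma weyl_ad n (L K M P : {vspace 'M[F]_n}) :
  lie L -> psemi L K -> (P <= M)%VS ->
  (forall x y, x \in L -> y \in M -> lb y x \in M) ->
  (forall x y, x \in L -> y \in P -> lb y x \in P) ->
  (forall x y, x \in K -> y \in M -> lb y x \in P) ->
  (forall y, y \in M -> exists y0 y1, [/\ y = y0 + y1, y0 \in M,
     forall x, x \in L -> lb y0 x \in P & y1 \in (br M L + P)%VS]) /\
  (forall y, y \in M -> y \in (br M L + P)%VS -> (forall x, x \in L -> lb y x \in P) -> y \in P).
Proof.
move=> hL sL PM LM LP KMP.
have AdM x y : x \in L -> y \in L -> Ad (lb x y) = lb (Ad x) (Ad y) by move=> _ _; exact: Ad_lb.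
have sPM : (rowsp P <= rowsp M)%VS.
  by apply/subvP => v /rowspP vP; apply/rowspP; exact: (subvP PM).
have [|||W1 W2] := weyl_subquot (lie_img AdM hL) (psemi_img AdM hL sL) sPM.
- by move=> _ /linimgP [x xL ->] v /rowspP vM; apply/rowspP; rewrite vec_Ad; exact: LM.
- by move=> _ /linimgP [x xL ->] v /rowspP vM; apply/rowspP; rewrite vec_Ad; exact: LP.
- by move=> _ v /linimgP [x xL ->] /rowspP vM; apply/rowspP; rewrite vec_Ad; exact: KMP.
have raE v : v \in (ra (rowsp M) (linimg (@Ad F _) L) + rowsp P)%VS <-> vec_mx v \in (br M L + P)%VS.
  split=> [vr|].
    have cl := lclosed_vec (br M L + P)%VS.
    apply/(vspP cl); apply: (subvP _ _ vr); rewrite subv_add; apply/andP; split.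
      apply: ra_sub => u _ /rowspP uM /linimgP [x xL ->]; apply/(vspP cl).
      by rewrite vec_Ad; apply: (subvP (addvSl _ _)); exact: mem_br.
    by apply/subvP => u /rowspP uP; apply/(vspP cl); exact: (subvP (addvSr _ _)).
  have cl : lclosed (fun y => mxvec y \in (ra (rowsp M) (linimg (@Ad F _) L) + rowsp P)%VS).
    exact: lclosed_lin.
  move=> vr; rewrite -[v]vec_mxK; apply/(vspP cl); apply: (subvP _ _ vr).
  rewrite subv_add; apply/andP; split.
    apply: br_sub => y x yM xL; apply/(vspP cl); apply: (subvP (addvSl _ _)).
    by rewrite -AdE; apply: mem_ra; [apply/rowspP; rewrite mxvecK|exact: mem_linimg].
  by apply/subvP => u uP; apply/(vspP cl); apply: (subvP (addvSr _ _)); apply/rowspP; rewrite mxvecK.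
split=> [y yM|y yM yb yL].
  have [|v0 [v1 [e v0M v0L v1r]]] := W1 (mxvec y); first by apply/rowspP; rewrite mxvecK.
  exists (vec_mx v0), (vec_mx v1); split.
  - by rewrite -[y in LHS]mxvecK e linearD.
  - exact/rowspP.
  - by move=> x xL; rewrite -vec_Ad; apply/rowspP; apply: v0L; exact: mem_linimg.
  - exact/raE.
have := W2 (mxvec y); rewrite raE !rowspP !mxvecK; apply=> // _ /linimgP [x xL ->].
by rewrite rowspP vec_Ad mxvecK; exact: yL.
Qed.

(** * Reductive subalgebras: a semisimple part and a commuting toral part *)
Definition Red n (l t : {vspace 'M[F]_n}) :=
  [/\ lie l, semis l, forall x y, x \in l -> y \in t -> lb x y = 0,
      forall x y, x \in t -> y \in t -> lb x y = 0 & forall x, x \in t -> dg x].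

Section EquivariantProjection.
Variables (n : nat) (l t S : {vspace 'M[F]_n}).
Hypotheses (R : Red l t) (lS : forall x y, x \in l -> y \in S -> lb y x \in S).
Hypothesis tS : forall x y, x \in t -> y \in S -> lb y x \in S.

Definition app (Phi : 'M[F]_(n * n)) (Y : 'M[F]_n) : 'M[F]_n := vec_mx (mxvec Y *m Phi).
Lemma appP a Phi Psi Y : app (a *: Phi + Psi) Y = a *: app Phi Y + app Psi Y.
Proof. by rewrite /app mulmxDr -scalemxAr linearP. Qed.
Lemma app0 Y : app 0 Y = 0. Proof. by rewrite /app mulmx0 linear0. Qed.
Lemma app_lb Phi x Y : app (lb Phi (Ad x)) Y = lb (app Phi Y) x - app Phi (lb Y x).
Proof. by rewrite /app mulmxBr !mulmxA AdE linearB /= vec_Ad. Qed.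

(** [inM] is Hom(gl, S) and [inP] its part vanishing on S. A projection onto S lies in [inM], and
    its bracket with any [Ad x] preserving S lies in [inP]; so projections form an affine space over
    [inP]. *)
Let inM Phi := forall Y, app Phi Y \in S.
Let inP Phi := inM Phi /\ forall Y, Y \in S -> app Phi Y = 0.
Let comm Phi (s : pred 'M[F]_n) := forall x, s x -> lb Phi (Ad x) = 0.

Let cM : lclosed inM.
Proof. by apply: lclosed_all => Y; split=> [|a x y]; rewrite ?app0 ?mem0v // appP; exact: memvPa. Qed.
Let cP : lclosed inP.
Proof.
apply: lclosed_and => //; apply: lclosed_all => Y; apply: lclosed_imp.
by split=> [|a x y Hx Hy]; rewrite ?app0 // appP Hx Hy scaler0 addr0.
Qed.
Let cC s : lclosed (comm^~ s).
Proof.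
apply: lclosed_all => x; apply: lclosed_imp.
by split=> [|a u v Hu Hv]; rewrite ?lb0l // lbPl Hu Hv scaler0 addr0.
Qed.

Let stM x : (forall y, y \in S -> lb y x \in S) -> forall Phi, inM Phi -> inM (lb Phi (Ad x)).
Proof. by move=> xS Phi h Y; rewrite app_lb memvB ?xS. Qed.
Let stP x : (forall y, y \in S -> lb y x \in S) -> forall Phi, inP Phi -> inP (lb Phi (Ad x)).
Proof.
move=> xS Phi [h0 h]; split; first exact: stM.
by move=> Y YS; rewrite app_lb !h ?lb0l ?subr0 //; exact: xS.
Qed.
Let stC (s : pred 'M[F]_n) x : (forall z, s z -> lb x z = 0) ->
  forall Phi, comm Phi s -> comm (lb Phi (Ad x)) s.
Proof.
move=> xs Phi h z sz; rewrite lb_jac h // lb0l add0r -Ad_lb xs //.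
by rewrite linear0 lb0r.
Qed.

Let projP x : (forall y, y \in S -> lb y x \in S) ->
  forall Phi, inM Phi -> (forall Y, Y \in S -> app Phi Y = Y) -> inP (lb Phi (Ad x)).
Proof.
move=> xS Phi h i; split; first exact: stM.
by move=> Y YS; rewrite app_lb !i ?subrr //; exact: xS.
Qed.

(** Generators of [t] are treated one at a time. The operator A = Ad (Ad x) is diagonalizable, and
    Phi - Phi A G is the component of Phi in its kernel; the correction Phi A G lies in [inP]
    because Phi A does and [G] preserves A-stable subspaces. *)
Lemma toral_step (s : seq 'M[F]_n) : {subset s <= t} ->
  exists Phi, [/\ inM Phi, forall Y, Y \in S -> app Phi Y = Y & comm Phi (mem s)].
Proof.
have [_ _ _ tt tdg] := R.
elim: s => [_|x s IH xst].
  exists (lin1_mx (mxvec \o (projv S) \o vec_mx)).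
  have E Y : app (lin1_mx (mxvec \o (projv S) \o vec_mx)) Y = projv S Y.
    by rewrite /app mul_rV_lin1 /= !mxvecK.
  by split=> [Y|Y YS|//]; rewrite E; [exact: memv_proj|exact: projv_id].
have [|Phi [PM PS PC]] := IH; first by move=> y ys; apply: xst; rewrite inE ys orbT.
have xt : x \in t by apply: xst; exact: mem_head.
have [G [cG AE stG]] := dg_regular (dg_Ad (dg_Ad (tdg x xt))).
set A := Ad (Ad x) in cG AE stG.
pose V := vsp (fun Phi => inM Phi /\ comm Phi (mem s)).
have cV : lclosed (fun Phi => inM Phi /\ comm Phi (mem s)) by apply: lclosed_and.
have xS y : y \in S -> lb y x \in S by exact: tS.
have stV v : v \in rowsp V -> v *m A \in rowsp V.
  move=> /rowspP /(vspP cV) [h1 h2]; apply/rowspP/(vspP cV); rewrite vec_Ad; split.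
    exact: stM.
  apply: stC => // z /= zs; apply: tt => //; apply: xst; by rewrite inE zs orbT.
have stPv v : v \in rowsp (vsp inP) -> v *m A \in rowsp (vsp inP).
  by move=> /rowspP /(vspP cP) h; apply/rowspP/(vspP cP); rewrite vec_Ad; exact: stP.
pose w := mxvec Phi *m A *m G.
have wP : inP (vec_mx w).
  apply/(vspP cP)/rowspP; apply: stG => //; apply/rowspP/(vspP cP).
  by rewrite vec_Ad mxvecK; exact: projP.
have /rowspP /(vspP cV) [w1 w2] : w \in rowsp V.
  apply: stG => //; apply: stV; apply/rowspP/(vspP cV); rewrite mxvecK; by split.
have appB Y : app (Phi - vec_mx w) Y = app Phi Y - app (vec_mx w) Y.
  by rewrite /app mulmxBr linearB.
exists (Phi - vec_mx w); split=> [Y|Y YS|y /=].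
- by rewrite appB memvB.
- by rewrite appB PS // wP.2 // subr0.
- rewrite inE => /predU1P [->|ys]; last by rewrite lbBl PC // w2 // subr0.
  apply/(can_inj mxvecK); rewrite linear0 -AdE.
  have -> : mxvec (Phi - vec_mx w) = mxvec Phi - w by rewrite linearB /= vec_mxK.
  have GA : A *m G = G *m A by rewrite cG.
  by rewrite -/A mulmxBl /w -(mulmxA _ G) -GA !mulmxA -2!(mulmxA (mxvec Phi)) -AE subrr.
Qed.

(** Weyl's theorem splits a t-equivariant projection as Phi0 + Phi1 with Phi0 invariant under [l].
    In the quotient by the maps vanishing on S, Phi1 is both moved and invariant, hence 0; so Phi0
    is still the identity on S. *)
Lemma equivariant_proj : exists p : {linear 'M[F]_n -> 'M[F]_n},
  [/\ forall Y, p Y \in S, forall Y, Y \in S -> p Y = Y &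
      forall x Y, x \in (l + t)%VS -> p (lb Y x) = lb (p Y) x].
Proof.
have [hl sl lt _ _] := R.
have [Phi [PM PS PC]] := @toral_step (vbasis t) (fun x => @vbasis_mem _ _ x t).
have {PC} PC : comm Phi (mem t).
  move=> x /coord_vbasis ->; rewrite linear_sum /lb mulmx_sumr mulmx_suml -sumrB big1 // => i _.
  rewrite linearZ /= -[X in X = _]/(lb Phi (_ *: Ad _)) lbZr PC ?scaler0 //.
  by apply: mem_nth; rewrite size_tuple.
pose V := vsp (fun Phi => inM Phi /\ comm Phi (mem t)).
have cV : lclosed (fun Phi => inM Phi /\ comm Phi (mem t)) by apply: lclosed_and.
pose Q := vsp (fun Phi => inP Phi /\ comm Phi (mem t)).
have cQ : lclosed (fun Phi => inP Phi /\ comm Phi (mem t)) by apply: lclosed_and.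
have AdM x y : x \in l -> y \in l -> Ad (lb x y) = lb (Ad x) (Ad y) by move=> _ _; exact: Ad_lb.
have hA := lie_img AdM hl.
have sA : semis (linimg (@Ad F _) l).
  by apply: (semis_img AdM _ hl sl) => x; rewrite memv0 => /eqP ->; exact: linear0.
have stV x y : x \in linimg (@Ad F _) l -> y \in V -> lb y x \in V.
  move=> /linimgP [z zl ->] /(vspP cV) [h1 h2]; apply/(vspP cV); split.
    by apply: stM => // u; exact: lS.
  by apply: stC => // u; exact: lt.
have stQ x y : x \in linimg (@Ad F _) l -> y \in Q -> lb y x \in Q.
  move=> /linimgP [z zl ->] /(vspP cQ) [h1 h2]; apply/(vspP cQ); split.
    by apply: stP => // u; exact: lS.
  by apply: stC => // u; exact: lt.
have QV : (Q <= V)%VS by apply/subvP => u /(vspP cQ) [[h _] h2]; apply/(vspP cV).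
have PhiV : Phi \in V by apply/(vspP cV).
have [||W1 _] := weyl_ad hA sA (sub0v V) stV.
- by move=> x y _; rewrite !memv0 => /eqP ->; rewrite lb0l.
- by move=> x y; rewrite !memv0 => /eqP -> _; rewrite lb0r.
have [Phi0 [Phi1 [e P0V P0l P1b]]] := W1 _ PhiV.
have [|_ W2] := weyl_ad hA sA QV stV stQ.
  by move=> x y; rewrite memv0 => /eqP -> _; rewrite lb0r mem0v.
have P1 : Phi1 = Phi - Phi0 by rewrite e addrAC subrr add0r.
have /(vspP cQ) [[_ Phi1S] _] : Phi1 \in Q.
  apply: W2; first by rewrite P1 memvB.
    by apply: (subvP _ _ P1b); rewrite addv0; exact: addvSl.
  move=> _ /linimgP [x xl ->]; rewrite P1 lbBl.
  have := P0l (Ad x) (mem_linimg _ xl); rewrite memv0 => /eqP ->; rewrite subr0.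
  apply/(vspP cQ); split; first by apply: projP => // u; exact: lS.
  by apply: stC => // u; exact: lt.
have /(vspP cV) [P0M P0t] := P0V.
have lin : linear (app Phi0) by move=> a x y; rewrite /app linearP mulmxDl -scalemxAl linearP.
have [p pE] := linear_ex lin.
exists p; split=> [Y|Y YS|x Y].
- by rewrite pE.
- have := PS Y YS; rewrite e -[Phi0]scale1r appP scale1r Phi1S // addr0 -pE //.
- move=> /memv_addP [u ul [v vt ->]]; rewrite !pE.
  have H z : lb Phi0 (Ad z) = 0 -> app Phi0 (lb Y z) = lb (app Phi0 Y) z.
    by move=> h; have := app_lb Phi0 z Y; rewrite h app0 => /esym/eqP; rewrite subr_eq0 => /eqP.
  rewrite !lbDr -!H //; first by rewrite -!pE linearD.
    exact: P0t.
  by apply/eqP; rewrite -memv0; apply: P0l; exact: mem_linimg.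
Qed.

(* Vanishing of first cohomology *)
Lemma equivariant_fix (e0 : 'M[F]_n) : (forall x, x \in (l + t)%VS -> lb e0 x \in S) ->
  exists e, e0 - e \in S /\ forall x, x \in (l + t)%VS -> lb e x = 0.
Proof.
move=> h; have [p [p1 p2 p3]] := equivariant_proj; exists (e0 - p e0); split.
  by rewrite opprB subrKC.
by move=> x xl; rewrite lbBl -p3 // p2 ?h // subrr.
Qed.
End EquivariantProjection.
End WeylSubquotient.

(** * Solvable ideals and flags *)
Definition der (F : fieldType) n (J : {vspace 'M[F]_n}) k := iter k (fun I => br I I) J.

Definition ideal_of (F : fieldType) n (L J : {vspace 'M[F]_n}) :=
  forall x y, x \in L -> y \in J -> lb x y \in J.

Lemma ideal_br (F : fieldType) n (L I J : {vspace 'M[F]_n}) :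
  ideal_of L I -> ideal_of L J -> ideal_of L (br I J).
Proof.
move=> iI iJ x y xL; apply: (br_ind (P := fun y => lb x y \in br I J)); first exact: lclosed_lbr.
move=> u v uI vJ; have -> : lb x (lb u v) = lb (lb x u) v + lb u (lb x v).
  by rewrite (lb_jac x u v) -[lb u (lb x v)]opprK -lbN addrAC subrr add0r.
by rewrite memvD ?mem_br ?iI ?iJ.
Qed.

Lemma der_sub (F : fieldType) n (J : {vspace 'M[F]_n}) k : lie J -> (der J k <= J)%VS.
Proof.
move=> hJ; elim: k => [|k IH] /=; first exact: subvv.
by apply: subv_trans (brS IH IH) (br_lie hJ).
Qed.

Lemma der_img (F : fieldType) (n m : nat) (f : {linear 'M[F]_n -> 'M[F]_m})
  (L J : {vspace 'M[F]_n}) k :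
  (forall x y, x \in L -> y \in L -> f (lb x y) = lb (f x) (f y)) ->
  (J <= L)%VS -> lie J -> (der (linimg f J) k <= linimg f (der J k))%VS.
Proof.
move=> fM JL hJ; elim: k => [|k IH] /=; first exact: subvv.
apply: br_sub => _ _ /(subvP IH) /linimgP [x xD ->] /(subvP IH) /linimgP [y yD ->].
have DL := subvP (subv_trans (der_sub k hJ) JL).
by rewrite -fM ?DL //; apply: mem_linimg; exact: mem_br.
Qed.

Section Solvable.
Variables (F : closedFieldType) (HF : [pchar F] =i pred0).

Lemma nilm_pt n (b : 'M[F]_n) : (forall v : 'rV_n, exists j, v *m b ^+ j = 0) -> nilm b.
Proof.
move=> h; have [f hf] := choice (fun i : 'I_n => h (row i 1%:M)).
exists (\max_i f i)%N; apply/row_matrixP => i.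
rewrite row0 -[_ ^+ _]mul1mx row_mul.
have /subnKC <- : (f i <= \max_i f i)%N by exact: leq_bigmax.
by rewrite exprD -mulmxE mulmxA hf mul0mx.
Qed.

(** [b^(i+1), x] = (i+1) b^i c. It makes the generalized eigenspaces of an abelian ideal stable
    under the whole algebra. *)
Lemma expr_comm_step (R : pzRingType) (b x c : R) i :
  b * x = x * b + c -> c * b = b * c ->
  b ^+ i.+1 * x = x * b ^+ i.+1 + (b ^+ i * c) *+ i.+1.
Proof.
move=> bx cb; elim: i => [|i IH]; first by rewrite expr1 expr0 mul1r mulr1n.
have cbi : c * b ^+ i.+1 = b ^+ i.+1 * c by apply: (commrX i.+1 cb).
rewrite exprS -mulrA IH mulrDr mulrA bx mulrDl -addrA -mulrA -exprS; congr (_ + _).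
by rewrite cbi mulrnAr mulrA -exprS -mulrS.
Qed.

Lemma tr_scalar0 n (c : F) : \tr (c%:M : 'M[F]_n) = 0 -> (c%:M : 'M[F]_n) = 0.
Proof.
case: n => [|n]; first by rewrite flatmx0.
by rewrite mxtrace_scalar => /eqP; rewrite -mulr_natr mulf_eq0 natr0 //= orbF => /eqP ->; rewrite -scalemx1 scale0r.
Qed.

Lemma comm_sub_scalar n (z a : 'M[F]_n) c : z *m a = a *m z ->
  z *m (a - c%:M) = (a - c%:M) *m z.
Proof. by move=> e; rewrite mulmxBr mulmxBl e scalar_mxC. Qed.

Lemma tr_br n (A B : {vspace 'M[F]_n}) x : x \in br A B -> \tr x = 0.
Proof.
apply: (br_ind (P := fun x => \tr x = 0)).
  by split=> [|a u v Hu Hv]; rewrite ?mxtrace0 // mxtraceD mxtraceZ Hu Hv mulr0 addr0.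
by move=> u v _ _; rewrite linearB /= mxtrace_mulC subrr.
Qed.

(** Induction on the derived length: [J, J] consists of scalars of trace 0, so J is abelian.
    Generalized eigenspaces are then stable, so each element of J is a scalar plus a nilpotent.
    Elements of [L, J] have trace 0, hence are nilpotent; by Engel they generate a proper stable
    subspace, so [L, J] = 0, and Schur's lemma concludes. *)
Lemma irr_solvable_scalar n (L : {vspace 'M[F]_n}) : lie L ->
  (forall S : {vspace 'rV[F]_n}, (forall x, x \in L -> stab S x) -> S = 0%VS \/ S = fullv) ->
  forall k (J : {vspace 'M[F]_n}), (J <= L)%VS -> ideal_of L J -> der J k = 0%VS ->
  forall x, x \in J -> exists c, x = c%:M.
Proof.
case: n L => [|n] L hL irr.
  by move=> k J _ _ _ x _; exists 0; rewrite !flatmx0.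
elim=> [|k IH] J JL iJ dJ.
  by move=> x; rewrite (dJ : J = _) memv0 => /eqP ->; exists 0; rewrite -scalemx1 scale0r.
have hJ : lie J by move=> x y xJ yJ; apply: iJ => //; exact: (subvP JL).
have JJ0 x y : x \in J -> y \in J -> lb x y = 0.
  move=> xJ yJ; have xyb := mem_br xJ yJ.
  have [|||c ec] := IH (br J J) _ _ _ _ xyb.
  - by apply: subv_trans (br_lie hJ) JL.
  - exact: ideal_br.
  - by rewrite /der -iterSr.
  by have := tr_br xyb; rewrite ec; exact: tr_scalar0.
have eig a : exists c (v : 'rV[F]_n.+1), v != 0 /\ v *m a = c *: v.
  have /closed_rootP [c] : size (char_poly a) != 1%N by rewrite size_char_poly.
  by rewrite -eigenvalue_root_char => /eigenvalueP [v va v0]; exists c, v.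
have full S : (forall x, x \in L -> stab S x) -> forall v : 'rV[F]_n.+1, v != 0 -> v \in S -> S = fullv.
  move=> st v v0 vS; case: (irr S st) => // S0; case/eqP: v0.
  by apply/eqP; rewrite -memv0 -S0.
have locnil a : a \in J -> exists c, nilm (a - c%:M).
  move=> aJ; have [c [v [v0 va]]] := eig a; exists c; set b := a - c%:M.
  pose P (v : 'rV[F]_n.+1) := exists j, v *m b ^+ j = 0.
  have up (u : 'rV[F]_n.+1) i j : (i <= j)%N -> u *m b ^+ i = 0 -> u *m b ^+ j = 0.
    by move=> /subnKC <- ui; rewrite exprD -mulmxE mulmxA ui mul0mx.
  have cP : lclosed P.
    split; first by exists 0%N; rewrite mul0mx.
    move=> e u w [i ui] [j wj]; exists (maxn i j); rewrite mulmxDl -scalemxAl.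
    by rewrite (up u i) ?leq_maxl // (up w j) ?leq_maxr // scaler0 addr0.
  have E : vsp P = fullv.
    apply: (full _ _ v v0); last first.
      by apply/(vspP cP); exists 1%N; rewrite expr1 mulmxBr va mul_mx_scalar subrr.
    move=> x xL u /(vspP cP) [j uj]; apply/(vspP cP); exists j.+1.
    have bx : lb b x \in J.
      by rewrite /b lbBl [lb c%:M x]/lb scalar_mxC subrr subr0 lbN memvN; exact: iJ.
    have cbx : lb b x *m b = b *m lb b x.
      have := JJ0 _ _ bx aJ; rewrite -[LHS]/(lb b x *m a - a *m lb b x).
      move=> /eqP; rewrite subr_eq0 => /eqP e.
      exact: comm_sub_scalar.
    have pw := expr_comm_step j (_ : b * x = x * b + lb b x) cbx.
    have {}pw := pw (esym (subrKC _ _)).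
    have : u *m (b ^+ j.+1 *m x) = 0 by rewrite mulmxA (up u j) // mul0mx.
    rewrite mulmxE pw mulmxDr -[u *m (_ *+ _)]/(mulmx u (_ *+ _)) (raddfMn (mulmx u)) /=.
    by rewrite -!mulmxE !mulmxA uj mul0mx mul0rn addr0.
  by apply: nilm_pt => u; apply/(vspP cP); rewrite E memvf.
have [J2J J2t] : (br L J <= J)%VS /\ (forall x, x \in br L J -> nilm x).
  have s : (br L J <= J)%VS by exact: br_sub.
  split=> // x xb; have [c cn] := locnil x (subvP s _ xb).
  suff c0 : (c%:M : 'M[F]_n.+1) = 0 by move: cn; rewrite c0 subr0.
  apply: tr_scalar0; have := nilm_tr cn.
  by rewrite linearB /= (tr_br xb) sub0r => /eqP; rewrite oppr_eq0 => /eqP.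
have hJ2 : lie (br L J).
  by move=> x y xb yb; rewrite JJ0 ?mem0v // (subvP J2J).
have iJ2 : ideal_of L (br L J) by apply: ideal_br => // x y; exact: hL.
have [m J2m] := engel hJ2 J2t.
have stT x : x \in L -> stab (ra fullv (br L J)) x.
  move=> xL v vr.
  have cl : lclosed (fun v : 'rV[F]_n.+1 => v *m x \in ra fullv (br L J)).
    by split=> [|a u w]; rewrite ?mul0mx ?mem0v // mulmxDl -scalemxAl; exact: memvPa.
  apply/(vspP cl); apply: (subvP _ _ vr); apply: ra_sub => u y _ yb; apply/(vspP cl).
  have -> : u *m y *m x = u *m x *m y - u *m lb x y by rewrite /lb mulmxBr !mulmxA subKr.
  by rewrite memvB // mem_ra ?memvf //; exact: iJ2.
have LJ0 x y : x \in L -> y \in J -> lb x y = 0.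
  case: (irr _ stT) => T0.
    move=> xL yJ; apply: row_mem0 => v; apply/eqP; rewrite -memv0 -T0.
    by apply: mem_ra; [exact: memvf|exact: mem_br].
  have : rpow (br L J) m = fullv by elim: (m) => //= i; rewrite /rpow /= => ->.
  rewrite J2m => /(congr1 (fun S => \dim S)); rewrite dimv0 dimvf /dim /= mul1n //.
move=> x xJ; have [c [v [v0 vx]]] := eig x; exists c.
have cl : lclosed (fun v : 'rV[F]_n.+1 => v *m (x - c%:M) = 0).
  by split=> [|a u w Hu Hw]; rewrite ?mul0mx // mulmxDl -scalemxAl Hu Hw scaler0 addr0.
apply/eqP; rewrite -subr_eq0; apply/eqP/row_mem0 => u; apply/(vspP cl).
suff -> : vsp (fun v : 'rV[F]_n.+1 => v *m (x - c%:M) = 0) = fullv by exact: memvf.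
apply: (full _ _ v v0).
  move=> y yL w /(vspP cl) wx; apply/(vspP cl).
  have -> : w *m y *m (x - c%:M) = w *m (x - c%:M) *m y + w *m lb y x.
    rewrite -!mulmxA -mulmxDr; congr (w *m _).
    by rewrite mulmxBr mulmxBl /lb -(scalar_mxC c y) [RHS]addrC addrA subrK.
  by rewrite wx mul0mx LJ0 // mulmx0 addr0.
by apply/(vspP cl); rewrite mulmxBr vx mul_mx_scalar subrr.
Qed.

Lemma nilm_sq n d (A B : {vspace 'rV[F]_n}) (K : 'M[F]_(n, d)) (J : 'M[F]_(d, n)) x :
  J *m K = 1%:M -> (forall c, c *m J \in A) -> (forall v, v \in A -> (v *m K = 0 <-> v \in B)) ->
  (B <= A)%VS -> stab A x -> stab B x -> nilm x -> nilm (sq K J x).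
Proof.
move=> JK JA KP BA Ax Bx [k xk]; exists k.
suff -> : sq K J x ^+ k = J *m x ^+ k *m K by rewrite xk mulmx0 mul0mx.
elim: k {xk} => [|k IH]; first by rewrite !expr0 mulmx1 JK.
rewrite exprSr IH [in RHS]exprSr -!mulmxE -(subrep_mul JK JA KP BA) //.
by elim: k {IH} => [|k IH] v vA; rewrite ?expr0 ?mulmx1 // exprSr -mulmxE mulmxA; apply: Ax; apply: IH.
Qed.

Definition simple_step n (L : {vspace 'M[F]_n}) (B A : {vspace 'rV[F]_n}) :=
  forall S, (B <= S)%VS -> (S <= A)%VS -> (forall x, x \in L -> stab S x) -> S = B \/ S = A.

(* Lie's theorem on a simple subquotient *)
Lemma solvable_ideal_simple n (L J : {vspace 'M[F]_n}) (A B : {vspace 'rV[F]_n}) k :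
  lie L -> (B <= A)%VS -> (forall x, x \in L -> stab A x) -> (forall x, x \in L -> stab B x) ->
  simple_step L B A -> (J <= L)%VS -> ideal_of L J -> der J k = 0%VS ->
  forall x, x \in J -> nilm x \/ x \in br L L -> forall v, v \in A -> v *m x \in B.
Proof.
move=> hL BA LA LB simp JL iJ dJ x xJ xn v vA.
have [d [K [I [_ IK IA KP]]]] := subrep BA.
pose phi := sq K I.
have phiM x' y : x' \in L -> y \in L -> phi (lb x' y) = lb (phi x') (phi y).
  by move=> xL yL; apply: (subrep_lb IK IA KP BA); auto.
have act w y : w \in A -> y \in L -> w *m y *m K = w *m K *m phi y.
  by move=> vE xL; apply: (subrep_act IK IA KP BA); auto.
have hL' : lie (linimg phi L) by apply: lie_img.
have hJ : lie J by move=> y z yJ zJ; apply: iJ => //; exact: (subvP JL).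
have xL := subvP JL _ xJ.
have irr (S : {vspace 'rV[F]_d}) : (forall y, y \in linimg phi L -> stab S y) -> S = 0%VS \/ S = fullv.
  move=> st.
  have cl : lclosed (fun w : 'rV[F]_n => w \in A /\ w *m K \in S).
    apply: lclosed_and; first exact: lclosed_vs.
    by split=> [|a u w]; rewrite ?mul0mx ?mem0v // mulmxDl -scalemxAl; exact: memvPa.
  case: (simp (vsp (fun w : 'rV[F]_n => w \in A /\ w *m K \in S))).
  - apply/subvP => w wB; have wA := subvP BA _ wB; apply/(vspP cl); split=> //.
    by rewrite (KP _ wA).2 ?mem0v.
  - by apply/subvP => w /(vspP cl) [].
  - move=> y yL w /(vspP cl) [wA wS]; apply/(vspP cl); split; first exact: LA.
    by rewrite act //; apply: st => //; exact: mem_linimg.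
  - move=> E; left; apply/eqP; rewrite -subv0; apply/subvP => c cS; rewrite memv0.
    have : c *m I \in B by rewrite -E; apply/(vspP cl); rewrite -mulmxA IK mulmx1.
    by move=> /(KP _ (IA c)); rewrite -mulmxA IK mulmx1 => ->.
  - move=> E; right; apply/eqP; rewrite eqEsubv subvf /=; apply/subvP => c _.
    have : c *m I \in A by []. 
    by rewrite -E => /(vspP cl) [_]; rewrite -mulmxA IK mulmx1.
have iJ' : ideal_of (linimg phi L) (linimg phi J).
  move=> _ _ /linimgP [y yL ->] /linimgP [z zJ ->]; have zL := subvP JL _ zJ.
  by rewrite -phiM //; apply: mem_linimg; exact: iJ.
have JL' : (linimg phi J <= linimg phi L)%VS.
  by apply/subvP => _ /linimgP [y /(subvP JL) yL ->]; exact: mem_linimg.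
have dJ' : der (linimg phi J) k = 0%VS.
  apply/eqP; rewrite -subv0; apply: subv_trans (der_img k phiM JL hJ) _.
  apply/subvP => z /linimgP [y yd ->]; have /eqP -> : y == 0 by rewrite -memv0 -dJ.
  by rewrite linear0 mem0v.
have [c phix] : exists c, phi x = c%:M.
  exact: (irr_solvable_scalar hL' irr JL' iJ' dJ' (mem_linimg phi xJ)).
have phi0 : phi x = 0.
  rewrite phix; apply: tr_scalar0; rewrite -phix; case: xn => [xn|xb].
    by apply: nilm_tr; apply: (nilm_sq IK IA KP BA); auto.
  apply: (br_ind (P := fun y => \tr (phi y) = 0)) xb.
    by split=> [|a u w]; rewrite /phi ?linear0 ?mxtrace0 // linearP mxtraceD mxtraceZ => -> ->; rewrite mulr0 addr0.
  by move=> y z yL zL; rewrite phiM //; apply: (@tr_br _ fullv fullv); rewrite mem_br ?memvf.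
by apply/KP; [exact: LA | rewrite act // phi0 mulmx0].
Qed.

(** A proper term is followed by a minimal stable subspace strictly above it, so the dimension grows
    by at least 1 and term n is everything; from then on the flag is constant. *)
Lemma composition_flag n (L : {vspace 'M[F]_n}) : exists Fl : nat -> {vspace 'rV[F]_n},
  [/\ Fl 0%N = 0%VS, Fl n = fullv, forall a, (Fl a <= Fl a.+1)%VS,
     forall a x, x \in L -> stab (Fl a) x & forall a, simple_step L (Fl a) (Fl a.+1)].
Proof.
pose st (S : {vspace 'rV[F]_n}) := forall x, x \in L -> stab S x.
have stf : st fullv by move=> x _ v _; exact: memvf.
have ex (S : {vspace 'rV[F]_n}) : exists T, st S ->
    [/\ (S <= T)%VS, st T, simple_step L S T & S != fullv -> (\dim S < \dim T)%N].
  have [->|Sf] := eqVneq S fullv.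
    exists fullv => _; split=> //; rewrite ?subvv ?eqxx // => T T1 _ _; left.
    by apply/eqP; rewrite eqEsubv subvf.
  have [|T [[ST stT nST] mn]] := @vs_min _ _ (fun T => [/\ (S <= T)%VS, st T & T != S]).
    by exists fullv; split; rewrite ?subvf // eq_sym.
  exists T => stS; split=> //.
    move=> T' ST' T'T stT'; have [->|nT'] := eqVneq T' S; first by left.
    by right; apply: dim_eq_sub => //; apply: mn.
  move=> _; rewrite ltn_neqAle dimvS // andbT; apply/negP => /eqP e.
  by case/eqP: nST; apply/esym/dim_eq_sub; rewrite ?e.
have [nx hnx] := choice ex.
pose Fl a := iter a nx (0%VS : {vspace 'rV[F]_n}).
have stF a : st (Fl a).
  elim: a => [|a IH]; last by have [] := hnx _ IH.
  by move=> x _ v; rewrite memv0 => /eqP ->; rewrite mul0mx mem0v.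
exists Fl; split=> // [|a|a]; try by have [] := hnx _ (stF a).
suff d a : Fl a = fullv \/ (a <= \dim (Fl a))%N.
  case: (d n) => // dn; apply: dim_eq_sub; rewrite ?subvf // dimvf /dim /= mul1n.
  exact: dn.
elim: a => [|a [E|IH]]; first by right.
  by left; apply/eqP; rewrite eqEsubv subvf /= -{1}E; have [] := hnx _ (stF a).
have [E|nE] := eqVneq (Fl a) fullv.
  by left; apply/eqP; rewrite eqEsubv subvf /= -{1}E; have [] := hnx _ (stF a).
by right; have [_ _ _ /(_ nE)] := hnx _ (stF a); apply: leq_ltn_trans.
Qed.

Definition strict n (Fl : nat -> {vspace 'rV[F]_n}) x :=
  forall a v, v \in Fl a.+1 -> v *m x \in Fl a.

Lemma strict_nilm n (Fl : nat -> {vspace 'rV[F]_n}) q x :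
  Fl 0%N = 0%VS -> Fl q = fullv -> strict Fl x -> nilm x.
Proof.
move=> F0 Fq sx; exists q; apply: row_mem0 => v.
have h i : (i <= q)%N -> v *m x ^+ i \in Fl (q - i)%N.
  elim: i => [|i IH] iq; first by rewrite subn0 Fq memvf.
  by rewrite exprSr -mulmxE mulmxA; apply: sx; rewrite -subSn // subSS; apply: IH; exact: ltnW.
by apply/eqP; rewrite -memv0 -F0; have := h q (leqnn q); rewrite subnn.
Qed.

(** By Lie's theorem x strictly lowers a composition flag, which y preserves; so x y is
    nilpotent. *)
Lemma solvable_trace n (L J : {vspace 'M[F]_n}) k :
  lie L -> (J <= br L L)%VS -> ideal_of L J -> der J k = 0%VS ->
  forall x y, x \in J -> y \in L -> \tr (x *m y) = 0.
Proof.
move=> hL JL iJ dJ x y xJ yL.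
have [Fl [F0 Fn Fle Fst Fs]] := composition_flag L.
apply/nilm_tr/(@strict_nilm _ Fl n) => // a v va; rewrite mulmxA; apply: (Fst a y yL).
have JL' := subv_trans JL (br_lie hL).
apply: (solvable_ideal_simple hL (Fle a) (Fst a.+1) (Fst a) (Fs a) JL' iJ dJ xJ) => //.
by right; exact: (subvP JL).
Qed.

(** The smallest derived algebra is perfect, and the trace form vanishes on it. *)
Lemma cartan_solvable n (J : {vspace 'M[F]_n}) : lie J ->
  (forall x y, x \in J -> y \in J -> \tr (x *m y) = 0) -> exists k, der J k = 0%VS.
Proof.
move=> hJ tJ.
have [|S [[k ->] mn]] := @vs_min _ _ (fun S => exists k, S = der J k); first by exists J, 0%N.
exists k; have hk : lie (der J k).
  by elim: k {mn} => //= k; exact: lie_br.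
apply: (trace_form_perfect0 HF hk) => [|x y /(subvP (der_sub k hJ)) xJ /(subvP (der_sub k hJ)) yJ].
  have := mn (der J k.+1) (ex_intro _ k.+1 erefl).
  by move=> /(dim_eq_sub (br_lie hk)) E; rewrite -{1}E subvv.
exact: tJ.
Qed.
End Solvable.

(** * The Levi-Mostow decomposition *)
Section LeviMostow.
Variables (F : closedFieldType) (HF : [pchar F] =i pred0).

Lemma lclosed_tr n (z : 'M[F]_n) : lclosed (fun x : 'M[F]_n => \tr (x *m z) = 0).
Proof.
by split=> [|a u v Hu Hv]; rewrite ?mul0mx ?mxtrace0 // mulmxDl -scalemxAl mxtraceD mxtraceZ Hu Hv mulr0 addr0.
Qed.

Lemma lclosed_perp n (D : {vspace 'M[F]_n}) :
  lclosed (fun x : 'M[F]_n => forall y, y \in D -> \tr (x *m y) = 0).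
Proof. by apply: lclosed_all => y; apply: lclosed_imp; exact: lclosed_tr. Qed.

(** The functional tr(x .) on [D] vanishes on the radical of the form, so it lies in the row space
    of the Gram matrix. *)
Lemma form_repr n (D : {vspace 'M[F]_n}) (x : 'M[F]_n) :
  (forall z, z \in D -> (forall y, y \in D -> \tr (z *m y) = 0) -> \tr (x *m z) = 0) ->
  exists2 y, y \in D & forall z, z \in D -> \tr (x *m z) = \tr (y *m z).
Proof.
move=> h; pose X := vbasis D; pose k := \dim D.
have Xm (i : 'I_k) : X`_i \in D by apply/vbasis_mem/mem_nth; rewrite size_tuple.
pose G : 'M[F]_k := \matrix_(i, j) \tr (X`_i *m X`_j).
pose b : 'rV[F]_k := \row_j \tr (x *m X`_j).
have tr_sum (u : 'M[F]_n) (c : 'I_k -> F) : \tr (u *m \sum_i c i *: X`_i) = \sum_i c i * \tr (u *m X`_i).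
  by rewrite mulmx_sumr linear_sum; apply: eq_bigr => i _; rewrite -scalemxAr linearZ.
have /submxP [c cG] : (b <= G)%MS.
  rewrite submxE; apply/eqP/rowP => j; rewrite mxE [RHS]mxE.
  pose z := \sum_i cokermx G i j *: X`_i.
  transitivity (\tr (x *m z)); last first.
    apply: h => [|y yD]; first by apply: memv_suml => i _; exact: memvZ.
    have [cl] : lclosed (fun y : 'M[F]_n => \tr (y *m z) = 0) by exact: lclosed_tr.
    move=> clD; rewrite mxtrace_mulC (coord_vbasis yD).
    have zi (i : 'I_k) : \tr (X`_i *m z) = 0.
      rewrite tr_sum; have := mulmx_coker G; move/matrixP => /(_ i j); rewrite !mxE => e.
      by rewrite -[RHS]e; apply: eq_bigr => l _; rewrite ?mxE mulrC.
    rewrite mulmx_suml linear_sum big1 // => i _.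
    by rewrite -scalemxAl linearZ /= zi mulr0.
  by rewrite tr_sum; apply: eq_bigr => i _; rewrite ?mxE mulrC.
exists (\sum_i c 0 i *: X`_i) => [|z zD].
  by apply: memv_suml => i _; exact: memvZ.
rewrite (coord_vbasis zD) !tr_sum; apply: eq_bigr => j _; congr (_ * _).
have := congr1 (fun B : 'rV_k => B 0 j) cG; rewrite !mxE => ->.
rewrite mulmx_suml linear_sum; apply: eq_bigr => i _.
by rewrite -scalemxAl linearZ mxE.
Qed.

(* Bourbaki's argument: the projections f of l onto a, viewed as endomorphisms
   modulo those with values in [a,a], form an affine space on which l acts; a
   point fixed modulo ad(a) has a complement of a (modulo [a,a]) as stabilizer. *)
Lemma bourbaki_levi n (l a : {vspace 'M[F]_n}) : lie l -> (l <= br l l)%VS -> (a <= l)%VS ->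
  ideal_of l a -> psemi l a ->
  (forall l', lie l' -> (l' <= l)%VS -> (l <= l' + a)%VS -> (l <= l')%VS) ->
  (a <= br a a)%VS.
Proof.
move=> hl pl al ia sl mn; set b := br a a.
have ha : lie a by move=> x y xa; apply: ia; exact: (subvP al).
have ba : (b <= a)%VS := br_lie ha.
have ib : ideal_of l b by exact: ideal_br.
have ib' x y : x \in l -> y \in b -> lb y x \in b by move=> xl yb; rewrite lbN memvN ib.
have ia' x y : x \in l -> y \in a -> lb y x \in a by move=> xl yb; rewrite lbN memvN ia.
have appE (Phi Psi : 'M[F]_(n * n)) Y : app (Phi + Psi) Y = app Phi Y + app Psi Y.
  by rewrite -[Phi]scale1r appP !scale1r.
have appAd z Y : app (Ad z) Y = lb Y z by rewrite /app AdE mxvecK.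
have appN (Phi : 'M[F]_(n * n)) Y : app (- Phi) Y = - app Phi Y.
  by rewrite /app mulmxN linearN.
(* [inM] holds the maps of l into a that act on a as a scalar modulo [b] (the scalar is 1 for
   projections), [inP] those that agree with some ad z, z in a, modulo [b]. On the quotient a acts
   as 0, so Weyl's theorem is available from [psemi l a]. *)
pose inM (Phi : 'M[F]_(n * n)) := (forall y, y \in l -> app Phi y \in a) /\
  exists c, forall y, y \in a -> app Phi y - c *: y \in b.
pose inMb (Phi : 'M[F]_(n * n)) := forall y, y \in l -> app Phi y \in b.
pose inP (Phi : 'M[F]_(n * n)) := exists2 z, z \in a & inMb (Phi - Ad z).
have cMb : lclosed inMb.
  apply: lclosed_all => y; apply: lclosed_imp.
  by split=> [|c u v]; rewrite ?app0 ?mem0v // appP; exact: memvPa.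
have cM : lclosed inM.
  split.
    by split=> [y _|]; [|exists 0 => y _]; rewrite app0 ?scale0r ?subr0 ?mem0v.
  move=> c u v [u1 [cu u2]] [v1 [cv v2]]; split=> [y yl|].
    by rewrite appP memvPa ?u1 ?v1.
  exists (c * cu + cv) => y ya.
  have -> : app (c *: u + v) y - (c * cu + cv) *: y = c *: (app u y - cu *: y) + (app v y - cv *: y).
    by rewrite appP scalerDl -scalerA scalerBr opprD addrACA.
  by rewrite memvPa ?u2 ?v2.
have cP : lclosed inP.
  split; first by exists 0; rewrite ?mem0v // linear0 subr0; case: cMb.
  move=> c u v [z za hz] [w wa hw]; exists (c *: z + w); first exact: memvPa.
  have -> : c *: u + v - Ad (c *: z + w) = c *: (u - Ad z) + (v - Ad w).
    by rewrite linearP scalerBr opprD addrACA.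
  by case: cMb => _; apply.
have PM Phi : inP Phi -> inM Phi.
  move=> [z za hz]; split=> [y yl|].
    rewrite -[Phi](subrK (Ad z)) appE appAd memvD //; last by apply: ia.
    by apply: (subvP ba); exact: hz.
  exists 0 => y ya; rewrite scale0r subr0 -[Phi](subrK (Ad z)) appE appAd memvD //.
    by apply: hz; exact: (subvP al).
  exact: mem_br.
have bM x Phi : x \in l -> inM Phi ->
    (forall y, y \in l -> app (lb Phi (Ad x)) y \in a) /\
    (forall y, y \in a -> app (lb Phi (Ad x)) y \in b).
  move=> xl [h1 [c h2]]; split=> y ya; rewrite app_lb.
    by rewrite memvB ?ia' ?h1 //; exact: hl.
  have -> : lb (app Phi y) x - app Phi (lb y x) =
    lb (app Phi y - c *: y) x - (app Phi (lb y x) - c *: lb y x).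
    by rewrite lbBl lbZl opprB addrA subrK.
  by rewrite memvB ?ib' ?h2 ?ia'.
have stMb x Phi : x \in l -> inMb Phi -> inMb (lb Phi (Ad x)).
  by move=> xl h y yl; rewrite app_lb memvB ?ib' ?h //; exact: hl.
have stM x Phi : x \in l -> inM Phi -> inM (lb Phi (Ad x)).
  move=> xl hM; have [h1 h2] := bM x Phi xl hM; split=> //.
  by exists 0 => y ya; rewrite scale0r subr0 h2.
have stP x Phi : x \in l -> inP Phi -> inP (lb Phi (Ad x)).
  move=> xl [z za hz]; exists (lb z x); first exact: ia'.
  by rewrite Ad_lb -lbBl; exact: stMb.
have aMP x Phi : x \in a -> inM Phi -> exists2 c, (forall y, y \in a -> app Phi y - c *: y \in b) &
    inMb (lb Phi (Ad x) + c *: Ad x).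
  move=> xa [h1 [c h2]]; exists c => // y yl; rewrite [lb _ _ + _]addrC appP appAd app_lb.
  have -> : c *: lb y x + (lb (app Phi y) x - app Phi (lb y x)) =
            lb (app Phi y) x - (app Phi (lb y x) - c *: lb y x).
    by rewrite opprB addrCA.
  by rewrite memvB ?h2 ?mem_br ?h1 //; apply: ia.
have AdM x y : x \in l -> y \in l -> Ad (lb x y) = lb (Ad x) (Ad y) by move=> _ _; exact: Ad_lb.
have sPM : (vsp inP <= vsp inM)%VS.
  by apply/subvP => Phi /(vspP cP) h; apply/(vspP cM); exact: PM.
have [|||W1 _] := weyl_ad HF (lie_img AdM hl) (psemi_img AdM hl sl) sPM.
- by move=> _ Phi /linimgP [x xl ->] /(vspP cM) h; apply/(vspP cM); exact: stM.
- by move=> _ Phi /linimgP [x xl ->] /(vspP cP) h; apply/(vspP cP); exact: stP.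
- move=> _ Phi /linimgP [x xa ->] /(vspP cM) h; apply/(vspP cP).
  have [c _ hc] := aMP x Phi xa h; exists (- (c *: x)); first by rewrite memvN memvZ.
  by rewrite linearN linearZ /= opprK.
pose Phi := lin1_mx (mxvec \o projv a \o vec_mx).
have PhiE Y : app Phi Y = projv a Y by rewrite /app mul_rV_lin1 /= !mxvecK.
have PhiM : Phi \in vsp inM.
  apply/(vspP cM); split=> [y _|]; first by rewrite PhiE memv_proj.
  by exists 1 => y ya; rewrite PhiE projv_id // scale1r subrr mem0v.
have [Phi0 [Phi1 [e /(vspP cM) M0 inv0 d1]]] := W1 _ PhiM.
have M1a y : y \in a -> app Phi1 y \in b.
  pose Q Psi := forall y, y \in a -> app Psi y \in b.
  have cQ : lclosed Q.
    apply: lclosed_all => z; apply: lclosed_imp.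
    by split=> [|c u v]; rewrite ?app0 ?mem0v // appP; exact: memvPa.
  move: y; apply/(vspP cQ); apply: (subvP _ _ d1); rewrite subv_add; apply/andP; split.
    apply: br_sub => u _ /(vspP cM) uM /linimgP [x xl ->]; apply/(vspP cQ).
    by have [] := bM x u xl uM.
  apply/subvP => u /(vspP cP) [z za hz]; apply/(vspP cQ) => y ya.
  rewrite -[u](subrK (Ad z)) appE appAd memvD ?mem_br //.
  by apply: hz; exact: (subvP al).
have M0a y : y \in a -> app Phi0 y - y \in b.
  move=> ya; have -> : app Phi0 y - y = - app Phi1 y; last by rewrite memvN M1a.
  have yE : y = app Phi0 y + app Phi1 y by rewrite -appE -e PhiE projv_id.
  by rewrite {2}yE opprD addrA subrr add0r.
(* The stabilizer of Phi0 modulo [b]. Every x of l enters it after adding an element of a, because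
   [Phi0, Ad z] is - Ad z modulo [b] for z in a; minimality of l then makes it all of l. *)
pose l' := vsp (fun x => x \in l /\ inMb (lb Phi0 (Ad x))).
have cl' : lclosed (fun x => x \in l /\ inMb (lb Phi0 (Ad x))).
  apply: lclosed_and; first exact: lclosed_vs.
  split; first by rewrite linear0 lb0r; case: cMb.
  by move=> c u v hu hv; rewrite linearP lbPr; case: cMb => _; apply.
have : (l <= l')%VS.
  apply: mn.
  - move=> x y /(vspP cl') [xl hx] /(vspP cl') [yl hy]; apply/(vspP cl'); split; first exact: hl.
    have -> : lb Phi0 (Ad (lb x y)) = lb (lb Phi0 (Ad x)) (Ad y) - lb (lb Phi0 (Ad y)) (Ad x).
      by rewrite Ad_lb (lb_jac Phi0 (Ad x)) addrAC subrr add0r.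
    rewrite -scaleN1r addrC; case: cMb => _; apply; exact: stMb.
  - by apply/subvP => x /(vspP cl') [].
  - apply/subvP => x xl; have /(vspP cP) [z za hz] := inv0 _ (mem_linimg (@Ad F n) xl).
    rewrite -[x](addrK z) memvB //; last first.
      by apply: (subvP (addvSr _ _)).
    apply: (subvP (addvSl _ _)); apply/(vspP cl'); split; first by rewrite memvD // (subvP al).
    have -> : lb Phi0 (Ad (x + z)) = (lb Phi0 (Ad x) - Ad z) + (lb Phi0 (Ad z) + Ad z).
      by rewrite linearD lbDr [RHS]addrACA addNr addr0.
    rewrite -[_ - Ad z]scale1r; case: cMb => _; apply => // y yl.
    rewrite appE app_lb appAd.
    have -> : lb (app Phi0 y) z - app Phi0 (lb y z) + lb y z =
              lb (app Phi0 y) z - (app Phi0 (lb y z) - lb y z) by mxnc.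
    by rewrite memvB ?M0a ?mem_br //; [case: M0 => h _; exact: h | exact: ia].
move=> /subvP ll'.
(* As a stabilizes Phi0, the same congruence gives [l, a] inside [b]. Elements of a are thus
   invariant in l / b and lie in l = [l, l], so uniqueness in Weyl's theorem puts them in [b]. *)
have la_b y z : y \in l -> z \in a -> lb y z \in b.
  move=> yl za; have /ll' /(vspP cl') [_ /(_ y yl)] : z \in l by exact: (subvP al).
  rewrite app_lb => h.
  have -> : lb y z = (lb (app Phi0 y) z - (app Phi0 (lb y z) - lb y z)) - (lb (app Phi0 y) z - app Phi0 (lb y z)).
    by mxnc.
  rewrite memvB // memvB ?M0a ?mem_br //; last exact: ia.
  by case: M0 => h' _; exact: h'.
have bl : (b <= l)%VS := subv_trans ba al.
have [|||_ W2] := weyl_ad HF hl sl bl.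
- by move=> x y xl yl; exact: hl.
- by move=> x y; exact: ib'.
- by move=> x y xa yl; exact: la_b.
apply/subvP => z za; have zl := subvP al _ za; apply: W2 => //.
  by apply: (subvP (addvSl _ _)); exact: (subvP pl).
by move=> x xl; rewrite lbN memvN; exact: la_b.
Qed.
End LeviMostow.

(** * Levi subalgebra and torus of a splittable ideal *)

Section Mostow.
Variables (F : closedFieldType) (HF : [pchar F] =i pred0) (N : nat).
Variables (H k : {vspace 'M[F]_N.+1}) (G : nat -> {vspace 'rV[F]_N.+1}) (q : nat).

Definition splits n (k : {vspace 'M[F]_n.+1}) := forall x, x \in k -> exists p : {poly F},
  [/\ p.[0] = 0, horner_mx x p \in k, dg (horner_mx x p) & nilm (x - horner_mx x p)].

Hypotheses (hH : lie H) (kH : (k <= H)%VS) (ik : ideal_of H k) (spk : splits k).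
Hypotheses (G0 : G 0%N = 0%VS) (Gq : G q = fullv) (Gle : forall a, (G a <= G a.+1)%VS).
Hypothesis stG : forall a x, x \in H -> stab (G a) x.
Hypothesis stepG : forall a, (forall x v, x \in k -> v \in G a.+1 -> v *m x \in G a) \/
  simple_step H (G a) (G a.+1).

(** The candidate nilradical of [k]. The flag [G] has to be simple only at the steps where [k] acts
    nontrivially, which suits the refined flags met later. *)
Definition strict_part := vsp (fun x => x \in k /\ strict G x).
Notation nn := strict_part.

Lemma lclosed_strict_part : lclosed (fun x => x \in k /\ strict G x).
Proof.
apply: lclosed_and; first exact: lclosed_vs.
apply: lclosed_all => a; apply: lclosed_all => v; apply: lclosed_imp.
by split=> [|c u w]; rewrite ?mulmx0 ?mem0v // mulmxDr -scalemxAr; exact: memvPa.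
Qed.

Lemma strict_partP x : x \in nn <-> x \in k /\ strict G x.
Proof. exact: vspP lclosed_strict_part x. Qed.

Let nk : (nn <= k)%VS. Proof. by apply/subvP => x /strict_partP []. Qed.
Let hk : lie k. Proof. by move=> x y xk; apply: ik; exact: (subvP kH). Qed.

Let nH : ideal_of H nn.
Proof.
move=> x y xH /strict_partP [yk ys]; apply/strict_partP; split; first exact: ik.
move=> a v va; rewrite /lb mulmxBr !mulmxA memvB //; first by apply: ys; exact: stG.
by apply: stG => //; exact: ys.
Qed.

Let ni x y : x \in k -> y \in nn -> lb x y \in nn.
Proof. by move=> xk; apply: nH; exact: (subvP kH). Qed.
Let ni' x y : x \in k -> y \in nn -> lb y x \in nn.
Proof. by move=> xk yn; rewrite lbN memvN ni. Qed.

Let tr_nk x y : x \in nn -> y \in k -> \tr (x *m y) = 0.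
Proof.
move=> /strict_partP [_ xs] yk; apply/nilm_tr/(strict_nilm G0 Gq) => a v va.
by rewrite mulmxA; apply: stG; [exact: (subvP kH)|exact: xs].
Qed.
Let tr_kn x y : x \in k -> y \in nn -> \tr (x *m y) = 0.
Proof. by move=> xk yn; rewrite mxtrace_mulC tr_nk. Qed.

Let nn_nilm x : x \in nn -> nilm x.
Proof. by move=> /strict_partP [_]; exact: (strict_nilm G0 Gq). Qed.

Let D := br k k.
Let Dk : (D <= k)%VS := br_lie hk.
Let iD : ideal_of H D. Proof. exact: ideal_br. Qed.

(** Lie's theorem at the simple steps of [G]; the other steps are lowered by all of [k]. *)
Let solv_in J m : (J <= k)%VS -> ideal_of H J -> der J m = 0%VS ->
  forall x, x \in J -> nilm x \/ x \in D -> x \in nn.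
Proof.
move=> Jk iJ dJ x xJ xn; apply/strict_partP; split; first exact: (subvP Jk).
move=> a v va; case: (stepG a) => [h|simp]; first by apply: h => //; exact: (subvP Jk).
apply: (solvable_ideal_simple HF hH (Gle a) (stG (a := a.+1)) (stG (a := a)) simp _ iJ dJ xJ) => //.
  exact: subv_trans Jk kH.
by case: xn => [|xD]; [left|right; exact: (subvP (brS kH kH))].
Qed.

Let PR x := x \in k /\ forall y, y \in D -> \tr (x *m y) = 0.
Let cR : lclosed PR.
Proof. by apply: lclosed_and; [exact: lclosed_vs|exact: lclosed_perp]. Qed.
(** The orthogonal of D = [k, k] for the trace form stands in for the solvable radical of [k]. *)
Let R := vsp PR.
Let Rk : (R <= k)%VS. Proof. by apply/subvP => x /(vspP cR) []. Qed.

Let iR : ideal_of H R.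
Proof.
move=> x y xH /(vspP cR) [yk hy]; apply/(vspP cR); split; first exact: ik.
by move=> z zD; rewrite lbN mulNmx linearN /= tr_lb hy ?oppr0 //; exact: iD.
Qed.

(** The trace form vanishes on the ideal R :&: D, which is solvable by Cartan's criterion. *)
Let RDn x : x \in R -> x \in D -> x \in nn.
Proof.
move=> xR xD.
have iJ : ideal_of H (R :&: D)%VS.
  by move=> u v uH; rewrite !memv_cap => /andP [vR vD]; rewrite iR ?iD.
have [||m dJ] := @cartan_solvable _ HF _ (R :&: D)%VS.
- by move=> u v uJ; apply: iJ; apply: (subvP kH); apply: (subvP Rk); move: uJ; rewrite memv_cap => /andP [].
- by move=> u v; rewrite !memv_cap => /andP [/(vspP cR) [_ h] _] /andP [_ vD]; exact: h.
apply: (solv_in (J := (R :&: D)%VS) (m := m)) => //; last by right.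
  by apply: subv_trans Rk; exact: capvSl.
by rewrite memv_cap xR.
Qed.

(** The form on D degenerates only along R :&: D, which lies in [nn] and is orthogonal to all of
    [k]; so x has an orthogonal projection to D. *)
Let kDR x : x \in k -> exists d r, [/\ d \in D, r \in R & x = d + r].
Proof.
move=> xk; have [z zD hz|d dD hd] := @form_repr _ _ D x.
  apply: tr_kn => //; apply: RDn => //; apply/(vspP cR); split=> //; exact: (subvP Dk).
exists d, (x - d); split; rewrite ?subrKC //; apply/(vspP cR); split.
  by rewrite memvB // (subvP Dk).
by move=> y yD; rewrite mulmxBl linearB /= hd // subrr.
Qed.

Let Rkn x y : x \in R -> y \in k -> lb x y \in nn.
Proof.
move=> xR yk; apply: RDn; last by apply: mem_br => //; exact: (subvP Rk).
by rewrite lbN memvN iR // (subvP kH).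
Qed.
Let Rkn' x y : x \in R -> y \in k -> lb y x \in nn.
Proof. by move=> xR yk; rewrite lbN memvN Rkn. Qed.

Let DDn : (D <= br D D + nn)%VS.
Proof.
apply: br_sub => x y /kDR [d [r [dD rR ->]]] yk.
rewrite lbDl memvD //; last by apply: (subvP (addvSr _ _)); exact: Rkn.
have [e [s [eD sR ->]]] := kDR yk; rewrite lbDr memvD //.
  by apply: (subvP (addvSl _ _)); exact: mem_br.
by apply: (subvP (addvSr _ _)); apply: Rkn' => //; exact: (subvP Dk).
Qed.

Let solvR : exists m, der R m = 0%VS.
Proof.
have brRn : (br R R <= nn)%VS.
  by apply: br_sub => x y xR yR; apply: Rkn => //; exact: (subvP Rk).
have [||m dm] := @cartan_solvable _ HF _ (br R R).
- by apply: lie_br => x y xR yR; apply: iR => //; apply: (subvP kH); exact: (subvP Rk).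
- by move=> x y /(subvP brRn) xn /(subvP brRn) /(subvP nk); exact: tr_nk.
by exists m.+1; rewrite /der iterSr.
Qed.

(** tr(x [u, v]) = tr([x, u] v) = 0 puts x in the solvable ideal R, where nilpotent elements are
    strict. *)
Let central_nil x : x \in k -> nilm x -> (forall y, y \in k -> lb x y \in nn) -> x \in nn.
Proof.
move=> xk xn xc; have [m dm] := solvR.
apply: (solv_in Rk iR dm) => //; last by left.
apply/(vspP cR); split=> // y yD.
pose P (z : 'M[F]_N.+1) := \tr (x *m z) = 0.
apply: (br_ind (P := P)) yD; rewrite /P.
  by split=> [|c u v hu hv]; rewrite ?mulmx0 ?mxtrace0 // mulmxDr -scalemxAr mxtraceD mxtraceZ hu hv mulr0 addr0.
by move=> u v uk vk; rewrite -tr_lb tr_nk // xc.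
Qed.

(** Subalgebras covering D modulo [nn]; one of least dimension turns out to be a Levi subalgebra. *)
Let Ql l := [/\ lie l, (l <= k)%VS & (D <= l + nn)%VS].

Section Levi.
Variables (l : {vspace 'M[F]_N.+1}).
Hypotheses (QL : Ql l) (mnl : forall l', Ql l' -> (\dim l <= \dim l')%N).
Let hl : lie l. Proof. by case: QL. Qed.
Let lk : (l <= k)%VS. Proof. by case: QL. Qed.
Let Dln : (D <= l + nn)%VS. Proof. by case: QL. Qed.

Let perf : br l l = l.
Proof.
apply: dim_eq_sub (br_lie hl) _; apply: mnl; split.
- exact: lie_br.
- exact: subv_trans (br_lie hl) lk.
apply: subv_trans DDn _; rewrite subv_add addvSr andbT.
apply: br_sub => x y /(subvP Dln) /memv_addP [u ul [v vn ->]] /(subvP Dln) /memv_addP [w wl [z zn ->]].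
rewrite lbDl memvD //; last first.
  apply: (subvP (addvSr _ _)); apply: ni' => //.
  by apply: memvD; [exact: (subvP lk)|exact: (subvP nk)].
rewrite lbDr memvD //; first by apply: (subvP (addvSl _ _)); exact: mem_br.
by apply: (subvP (addvSr _ _)); apply: ni => //; exact: (subvP lk).
Qed.

Let lD : (l <= D)%VS. Proof. by rewrite -perf; exact: brS. Qed.
Let a := (l :&: nn)%VS.
Let al : (a <= l)%VS. Proof. exact: capvSl. Qed.
Let an : (a <= nn)%VS. Proof. exact: capvSr. Qed.

Let ia : ideal_of l a.
Proof.
move=> x y xl; rewrite !memv_cap => /andP [yl yn]; rewrite hl //=.
by apply: ni => //; exact: (subvP lk).
Qed.

(** For an ideal I of l, J = (I + nn) :&: D is an ideal of k. The form on J degenerates only along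
    [nn], so D = J + E with E the orthogonal of J in D, and [J, E] lies in [nn]. Hence D is
    contained in [J, J] + E + nn, and for an element of I the E-part is again in [nn]. *)
Let psemi_l : psemi l a.
Proof.
move=> I Il iI.
have ID := subv_trans Il lD.
pose J := ((I + nn) :&: D)%VS.
have IJ : (I <= J)%VS by rewrite subv_cap addvSl ID.
have Jk : (J <= k)%VS by apply: subv_trans (capvSr _ _) Dk.
have JD : (J <= D)%VS by exact: capvSr.
have iJ x y : x \in k -> y \in J -> lb x y \in J.
  move=> xk; rewrite /J !memv_cap => /andP [yI yD].
  apply/andP; split; last by apply: iD => //; exact: (subvP kH).
  have yk := subvP Dk _ yD.
  have [d [r [dD rR ->]]] := kDR xk; rewrite lbDl memvD //; last first.
    by apply: (subvP (addvSr _ _)); exact: Rkn.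
  have dk := subvP Dk _ dD.
  have /memv_addP [i iI' [v vn yE]] := yI.
  rewrite yE lbDr memvD //; last by apply: (subvP (addvSr _ _)); exact: ni.
  have ik' : i \in k by apply: (subvP lk); exact: (subvP Il).
  have /memv_addP [u ul [w wn ->]] := subvP Dln _ dD.
  rewrite lbDl memvD //; first by apply: (subvP (addvSl _ _)); exact: iI.
  by apply: (subvP (addvSr _ _)); exact: ni'.
pose P0 x := x \in J /\ forall y, y \in J -> \tr (x *m y) = 0.
have c0 : lclosed P0 by apply: lclosed_and; [exact: lclosed_vs|exact: lclosed_perp].
have J0n x : x \in J -> (forall y, y \in J -> \tr (x *m y) = 0) -> x \in nn.
  move=> xJ hx.
  have i0 : ideal_of k (vsp P0).
    move=> u v uk /(vspP c0) [vJ hv]; apply/(vspP c0); split; first exact: iJ.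
    by move=> z zJ; rewrite lbN mulNmx linearN /= tr_lb hv ?oppr0 //; exact: iJ.
  have J0J : (vsp P0 <= J)%VS by apply/subvP => u /(vspP c0) [].
  have [||m dm] := @cartan_solvable _ HF _ (vsp P0).
  - by move=> u v u0; apply: i0; apply: (subvP Jk); exact: (subvP J0J).
  - by move=> u v /(vspP c0) [_ h] /(subvP J0J); exact: h.
  have J0D : (vsp P0 <= br k k)%VS := subv_trans J0J JD.
  have x0 : x \in vsp P0 by apply/(vspP c0).
  apply: RDn; last exact: (subvP JD).
  apply/(vspP cR); split; first exact: (subvP Jk).
  by move=> y yD; apply: (solvable_trace HF hk J0D i0 dm x0); exact: (subvP Dk).
pose P1 x := x \in D /\ forall y, y \in J -> \tr (x *m y) = 0.
have c1 : lclosed P1 by apply: lclosed_and; [exact: lclosed_vs|exact: lclosed_perp].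
pose E := vsp P1.
have iE x y : x \in k -> y \in E -> lb x y \in E.
  move=> xk /(vspP c1) [yD hy]; apply/(vspP c1); split.
    by apply: iD => //; exact: (subvP kH).
  by move=> z zJ; rewrite lbN mulNmx linearN /= tr_lb hy ?oppr0 //; exact: iJ.
have ED : (E <= D)%VS by apply/subvP => u /(vspP c1) [].
have DJE x : x \in D -> exists u v, [/\ u \in J, v \in E & x = u + v].
  move=> xD; have [z zJ hz|u uJ hu] := @form_repr _ _ J x.
    by apply: tr_kn; [exact: (subvP Dk)|exact: J0n].
  exists u, (x - u); split; rewrite ?subrKC //; apply/(vspP c1); split.
    by rewrite memvB // (subvP JD).
  by move=> y yJ; rewrite mulmxBl linearB /= hu // subrr.
have JEn u v : u \in J -> v \in E -> lb u v \in nn.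
  move=> uJ vE; have uk := subvP Jk _ uJ.
  have /(vspP c1) [_ h] : lb u v \in E by exact: iE.
  apply: J0n => //; rewrite lbN memvN; apply: iJ => //.
  by apply: (subvP Dk); exact: (subvP ED).
have split3 x : x \in D -> x \in (br J J + (E + nn))%VS.
  have nB : (nn <= br J J + (E + nn))%VS by apply: subv_trans (addvSr _ _) (addvSr _ _).
  move=> /(subvP DDn); apply: subvP; rewrite subv_add nB andbT.
  apply: br_sub => u v /DJE [u1 [u2 [u1J u2E ->]]] /DJE [v1 [v2 [v1J v2E ->]]].
  rewrite lbDl lbDr [lb u2 _]lbDr; apply: memvD; apply: memvD.
  - by apply: (subvP (addvSl _ _)); exact: mem_br.
  - by apply: (subvP nB); exact: JEn.
  - by apply: (subvP nB); rewrite lbN memvN; exact: JEn.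
  - apply: (subvP (addvSr _ _)); apply: (subvP (addvSl _ _)); apply: iE => //.
    by apply: (subvP Dk); exact: (subvP ED).
apply/subvP => x xI.
have /memv_addP [p pJ [ev /memv_addP [e eE [v vn ->]] xE]] := split3 x (subvP ID _ xI).
have brJ : (br J J <= J)%VS by apply: br_sub => u w uJ wJ; apply: iJ => //; exact: (subvP Jk).
have pJJ := subvP brJ _ pJ.
have en : e \in nn.
  have iJ' : x - p \in J by rewrite memvB // (subvP IJ).
  have eE' : e = (x - p) - v by rewrite xE; mxnc.
  have := eE => /(vspP c1) [_ he].
  have : x - p \in nn.
    apply: J0n => // z zJ; have -> : x - p = e + v by rewrite eE' subrK.
    by rewrite mulmxDl linearD /= he // tr_nk ?addr0 //; exact: (subvP Jk).
  by rewrite eE' => h; rewrite memvB.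
have brIn : (br J J <= br I I + nn)%VS.
  apply: br_sub => u w uJ wJ.
  have uk := subvP Jk _ uJ; have wk := subvP Jk _ wJ.
  move: uJ wJ; rewrite /J !memv_cap => /andP [/memv_addP [i iI1 [m mn uE]] _].
  move=> /andP [/memv_addP [j jI [o on wE]] _].
  have ik' : i \in k by apply: (subvP lk); exact: (subvP Il).
  rewrite uE lbDl memvD //; last by apply: (subvP (addvSr _ _)); exact: ni'.
  rewrite wE lbDr memvD //; last by apply: (subvP (addvSr _ _)); exact: ni.
  by apply: (subvP (addvSl _ _)); exact: mem_br.
have /memv_addP [b bI [m mn pE]] := subvP brIn _ pJ.
have brIl : (br I I <= l)%VS.
  by apply: br_sub => u w uI wI; apply: hl; exact: (subvP Il).
rewrite -[x](subrKC b) memv_add // memv_cap; apply/andP; split.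
  by apply: memvB; [exact: (subvP Il)|exact: (subvP brIl)].
have -> : x - b = m + (e + v) by rewrite xE pE; mxnc.
by rewrite !memvD.
Qed.

(** Minimality of [l] feeds [bourbaki_levi], so a is perfect; consisting of strict elements it is
    trace-isotropic, hence 0. *)
Let a0 : a = 0%VS.
Proof.
have ha : lie a by move=> x y xa; apply: ia; exact: (subvP al).
apply: (trace_form_perfect0 HF ha).
  apply: (bourbaki_levi HF hl _ al ia psemi_l); first by rewrite perf subvv.
  move=> l' hl' l'l ll'.
  suff -> : l' = l by exact: subvv.
  apply: (dim_eq_sub l'l); apply: mnl; split=> //; first exact: subv_trans l'l lk.
  apply: subv_trans Dln _; rewrite subv_add addvSr andbT.
  by apply: subv_trans ll' _; rewrite subv_add addvSl; apply: subv_trans an (addvSr _ _).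
by move=> x y /(subvP an) xn /(subvP an) /(subvP nk); exact: tr_nk.
Qed.

Let lnn0 x : x \in l -> x \in nn -> x = 0.
Proof. by move=> xl xn; apply/eqP; rewrite -memv0 -a0 memv_cap xl. Qed.

Let sl : semis l. Proof. by rewrite /semis -a0; exact: psemi_l. Qed.

Let lcen x : x \in l -> (forall y, y \in l -> lb y x = 0) -> x = 0.
Proof.
pose P x := x \in l /\ forall y, y \in l -> lb y x = 0.
have cP : lclosed P.
  apply: lclosed_and; first exact: lclosed_vs.
  apply: lclosed_all => y; apply: lclosed_imp.
  by split=> [|c u v hu hv]; rewrite ?lb0r // lbPr hu hv scaler0 addr0.
move=> xl hx; apply/eqP; rewrite -memv0.
have Zl : (vsp P <= l)%VS by apply/subvP => z /(vspP cP) [].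
have : (vsp P <= br (vsp P) (vsp P))%VS.
  apply: (semisP sl Zl) => u v ul /(vspP cP) [vl hv].
  by rewrite hv ?mem0v.
move=> Zb; have /(subvP Zb) : x \in vsp P by apply/(vspP cP).
apply: subvP; apply: br_sub => u v /(subvP Zl) ul /(vspP cP) [_ hv].
by rewrite hv ?mem0v.
Qed.

Let PC c := c \in k /\ forall y, y \in l -> lb y c = 0.
Let cC : lclosed PC.
Proof.
apply: lclosed_and; first exact: lclosed_vs.
apply: lclosed_all => y; apply: lclosed_imp.
by split=> [|c u v hu hv]; rewrite ?lb0r // lbPr hu hv scaler0 addr0.
Qed.
Let C := vsp PC.
Let Ck : (C <= k)%VS. Proof. by apply/subvP => x /(vspP cC) []. Qed.
Let hC : lie C.
Proof.
move=> x y /(vspP cC) [xk hx] /(vspP cC) [yk hy]; apply/(vspP cC); split; first exact: hk.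
move=> z zl; have := lb_jac z x y.
by rewrite (hx z zl) (hy z zl) !lb0l add0r => <-.
Qed.

(** Weyl's theorem for ad l on k: invariants form C, and moved elements lie in D, inside l + nn. *)
Let kCl x : x \in k -> exists c y, [/\ c \in C, y \in (l + nn)%VS & x = c + y].
Proof.
move=> xk; have [||||W1 _] := @weyl_ad _ HF _ l 0 k 0 hl sl.
- exact: sub0v.
- by move=> u v ul vk; apply: hk => //; exact: (subvP lk).
- by move=> u v _; rewrite !memv0 => /eqP ->; rewrite lb0l.
- by move=> u v; rewrite memv0 => /eqP -> _; rewrite lb0r mem0v.
have [c [y [e ck hc yb]]] := W1 x xk; exists c, y; split=> //.
  apply/(vspP cC); split=> // z zl; rewrite lbN.
  by have := hc z zl; rewrite memv0 => /eqP ->; rewrite oppr0.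
move: yb; rewrite addv0 => yb; apply: (subvP Dln).
by apply: (subvP _ _ yb); apply: brS; rewrite ?subvv.
Qed.

(** [x, y] centralizes l and lies in D, inside l + nn; its l-component is then central in l, hence
    0. *)
Let CCn x y : x \in C -> y \in C -> lb x y \in nn.
Proof.
move=> xC yC; have /(vspP cC) [_ h] := hC xC yC.
have xyD : lb x y \in D by apply: mem_br; exact: (subvP Ck).
have /memv_addP [u ul [v vn e]] := subvP Dln _ xyD.
suff u0 : u = 0 by rewrite e u0 add0r.
apply: lcen => // z zl; apply: lnn0; first exact: hl.
have := h z zl; rewrite e lbDr => /eqP; rewrite addr_eq0 => /eqP ->.
by rewrite memvN; apply: ni => //; exact: (subvP lk).
Qed.

Let Qt t := [/\ (t <= C)%VS, forall x y, x \in t -> y \in t -> lb x y = 0 & forall x, x \in t -> dg x].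

Section Torus.
Variables (t : {vspace 'M[F]_N.+1}).
Hypotheses (QT : Qt t) (mxt : forall t', Qt t' -> (\dim t' <= \dim t)%N).
Let tC : (t <= C)%VS. Proof. by case: QT. Qed.
Let tt x y : x \in t -> y \in t -> lb x y = 0. Proof. by case: QT => _ h _; exact: h. Qed.
Let tdg x : x \in t -> dg x. Proof. by case: QT => _ _ h; exact: h. Qed.

(** For x in t, [Ad x] is diagonalizable and maps C into [nn]; removing from c its components on
    nonzero eigenvalues changes it by an element of [nn] only. *)
Let centralize (s : seq 'M[F]_N.+1) : {subset s <= t} -> forall c, c \in C ->
  exists c0, [/\ c0 \in C, forall x, x \in s -> lb c0 x = 0 & c - c0 \in nn].
Proof.
elim: s => [_ c cC'|x s IH xst c cC'].
  by exists c; split=> //; rewrite subrr mem0v.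
have [|c0 [c0C c0s cc0]] := IH _ c cC'; first by move=> y ys; apply: xst; rewrite inE ys orbT.
have xt : x \in t by apply: xst; exact: mem_head.
have xC := subvP tC _ xt.
have [B [cB AE stB]] := dg_regular (dg_Ad (tdg xt)).
set A := Ad x in cB AE stB.
have AB : A *m B = B *m A by apply: cB.
pose P c := c \in C /\ forall y, y \in s -> lb c y = 0.
have cP : lclosed P.
  apply: lclosed_and; first exact: lclosed_vs.
  apply: lclosed_all => y; apply: lclosed_imp.
  by split=> [|e u v hu hv]; rewrite ?lb0l // lbPl hu hv scaler0 addr0.
have stP v : v \in rowsp (vsp P) -> v *m A \in rowsp (vsp P).
  move=> /rowspP /(vspP cP) [h1 h2]; apply/rowspP/(vspP cP); rewrite vec_Ad; split; first exact: hC.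
  move=> y ys; have yt : y \in t by apply: xst; rewrite inE ys orbT.
  by rewrite lb_jac (h2 _ ys) lb0l add0r (tt xt yt) lb0r.
have c0P : mxvec c0 \in rowsp (vsp P) by apply/rowspP; rewrite mxvecK; apply/(vspP cP).
have /rowspP /(vspP cP) [bC _] := stB _ stP _ c0P.
pose w := mxvec c0 *m A *m B.
have wE : vec_mx w = lb (vec_mx (mxvec c0 *m B)) x by rewrite -vec_Ad -/A /w -!mulmxA AB.
have wn : vec_mx w \in nn by rewrite wE; exact: CCn.
have /rowspP /(vspP cP) [wC ws] : w \in rowsp (vsp P) by apply: stB => //; exact: stP.
exists (c0 - vec_mx w); split.
- by rewrite memvB.
- move=> y; rewrite inE => /predU1P [->|ys]; last by rewrite lbBl c0s // ws // subr0.
  apply/(can_inj mxvecK); rewrite linear0 -AdE -/A.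
  have -> : mxvec (c0 - vec_mx w) = mxvec c0 - w by rewrite linearB /= vec_mxK.
  rewrite mulmxBl.
  have -> : w *m A = mxvec c0 *m (A *m A *m B) by rewrite /w -!mulmxA -AB.
  by rewrite -AE subrr.
- by rewrite opprB addrCA addrC memvD // addrC.
Qed.

(** After correction c0 centralizes l and t, and so does its semisimple part, which maximality of t
    puts in t. The nilpotent part is central modulo [nn], hence in [nn]. *)
Let k_ltn : (k <= (l + t) + nn)%VS.
Proof.
apply/subvP => x /kCl [c [y [cC' yln ->]]].
rewrite memvD //; last first.
  by apply: (subvP _ _ yln); rewrite subv_add addvSr andbT; apply: subv_trans (addvSl l t) (addvSl _ _).
have [c0 [c0C c0t cc0]] := centralize (fun u => @vbasis_mem _ _ u t) cC'.
have {}c0t u : u \in t -> lb c0 u = 0.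
  move=> /coord_vbasis ->; rewrite /lb mulmx_sumr mulmx_suml -sumrB big1 // => i _.
  rewrite -[X in X = _]/(lb c0 (_ *: _)) lbZr c0t ?scaler0 //.
  by apply: mem_nth; rewrite size_tuple.
have c0k := subvP Ck _ c0C.
have [p [_ sk sdg snil]] := spk c0k; set s := horner_mx c0 p in sk sdg snil.
have scomm u : lb u c0 = 0 -> lb u s = 0.
  move=> /eqP; rewrite subr_eq0 => /eqP e; apply/eqP; rewrite subr_eq0; apply/eqP.
  exact: comm_mx_horner.
have sC : s \in C.
  apply/(vspP cC); split=> // u ul; apply: scomm.
  by have /(vspP cC) [_ h] := c0C; exact: h.
have st : s \in t.
  have ts u : u \in t -> lb u s = 0 by move=> ut; apply: scomm; rewrite lbN c0t // oppr0.
  have /(dim_eq_sub (addvSl t <[s]>)) -> : (\dim (t + <[s]>) <= \dim t)%N; last first.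
    by apply: (subvP (addvSr _ _)); exact: memv_line.
  apply: mxt; split.
  - by rewrite subv_add tC -memvE.
  - move=> u v /memv_addP [u1 u1t [u2 /vlineP [e ->] ->]] /memv_addP [v1 v1t [v2 /vlineP [f ->] ->]].
    by rewrite !(lbDl, lbDr, lbZl, lbZr) tt // ts // [lb s v1]lbN ts // lbxx oppr0 !scaler0 !addr0.
  - move=> u /memv_addP [u1 u1t [u2 /vlineP [e ->] ->]].
    apply: dg_add; [|exact: tdg|exact: dg_scale].
    by have /eqP := ts _ u1t; rewrite subr_eq0 -scalemxAr -scalemxAl => /eqP ->.
have nun : c0 - s \in nn.
  apply: central_nil => //; first by rewrite memvB.
  have nuC : c0 - s \in C by rewrite memvB.
  move=> y' /kCl [c' [y'' [c'C /memv_addP [m ml [v vn ->]] ->]]].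
  rewrite !lbDr memvD ?CCn // memvD //.
    have /(vspP cC) [_ h] := nuC; by rewrite lbN h // oppr0 mem0v.
  by apply: ni => //; rewrite memvB.
have -> : c = s + ((c0 - s) + (c - c0)) by rewrite addrA subrKC subrKC.
by apply: memv_add; [exact: (subvP (addvSr _ _))|exact: memvD].
Qed.

Lemma levi_torus : [/\ Red l t, (l <= k)%VS, (t <= k)%VS, (k <= (l + t) + nn)%VS &
  forall x, x \in (l + t)%VS -> x \in nn -> x = 0].
Proof.
have lt x y : x \in l -> y \in t -> lb x y = 0.
  by move=> xl /(subvP tC) /(vspP cC) [_ h]; exact: h.
split=> //; first exact: subv_trans tC Ck.
move=> x /memv_addP [y yl [w wt ->]] xn.
have y0 : y = 0.
  apply: lcen => // z zl; apply: lnn0; first exact: hl.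
  have := ni (subvP lk _ zl) xn; by rewrite lbDr (lt z w) // addr0.
by move: xn; rewrite y0 add0r => /nn_nilm wn; apply: nilm_dg => //; exact: tdg.
Qed.
End Torus.

Lemma levi_part : exists t, [/\ Red l t, (l <= k)%VS, (t <= k)%VS, (k <= (l + t) + nn)%VS &
  forall x, x \in (l + t)%VS -> x \in nn -> x = 0].
Proof.
have [|t [QT mx]] := @vs_max _ _ Qt.
  exists 0%VS; split; first exact: sub0v.
    by move=> x y; rewrite memv0 => /eqP -> _; rewrite lb0l.
  by move=> x; rewrite memv0 => /eqP ->; exact: dg0.
by exists t; exact: levi_torus.
Qed.
End Levi.

Lemma levi_mostow : exists l t, [/\ Red l t, (l <= k)%VS, (t <= k)%VS, (k <= (l + t) + nn)%VS &
  forall x, x \in (l + t)%VS -> x \in nn -> x = 0].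
Proof.
have [|l [QL mn]] := @vs_min _ _ Ql.
  by exists k; split; rewrite ?subvv //; apply: subv_trans Dk (addvSl _ _).
by have [t h] := levi_part QL mn; exists l, t.
Qed.
End Mostow.

(** * Exponentials and conjugation *)
Section Exponential.
Variables (F : closedFieldType) (HF : [pchar F] =i pred0).

Definition ex n N (x : 'M[F]_n) : 'M[F]_n := \sum_(0 <= i < N) (i`!%:R^-1 : F) *: x ^+ i.

Lemma expr_up n (x : 'M[F]_n) i j : (i <= j)%N -> x ^+ i = 0 -> x ^+ j = 0.
Proof. by move=> /subnK <- xi; rewrite exprD xi mulr0. Qed.

(** Truncation at K + K is exact: a^i b^j vanishes as soon as i + j reaches it. *)
Lemma ex_add n (a b : 'M[F]_n) K : a *m b = b *m a -> a ^+ K = 0 -> b ^+ K = 0 ->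
  ex (K + K) (a + b) = ex (K + K) a *m ex (K + K) b.
Proof.
move=> ab aK bK; set N := (K + K)%N.
pose f i j : 'M[F]_n := ((i`!%:R)^-1 * (j`!%:R)^-1 : F) *: (a ^+ i *m b ^+ j).
have f0 i j : (N <= i + j)%N -> f i j = 0.
  move=> h; rewrite /f; have [iK|jK] : (K <= i)%N \/ (K <= j)%N.
  - case: (leqP K i) => iK; [by left | right].
    by rewrite -(leq_add2l K); apply: leq_trans h _; rewrite leq_add2r ltnW.
  - by rewrite (expr_up iK aK) mul0mx scaler0.
  - by rewrite (expr_up jK bK) mulmx0 scaler0.
transitivity (\sum_(0 <= s < N) \sum_(0 <= j < N | (j <= s)%N) f (s - j)%N j).
  apply: eq_big_nat => s /andP [_ sN]; rewrite exprDn_comm // scaler_sumr.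
  rewrite -(big_mkord xpredT (fun j => (s`!%:R^-1 : F) *: ((a ^+ (s - j) * b ^+ j) *+ 'C(s, j)))).
  rewrite (big_nat_widen 0 s.+1 N) //.
  apply: eq_big => [j|j]; first by rewrite ltnS.
  rewrite ltnS => js; rewrite /f -mulmxE -scaler_nat scalerA; congr (_ *: _).
  have e : (s`!%:R : F) = 'C(s, j)%:R * (j`!%:R * (s - j)`!%:R).
    by rewrite -!natrM bin_fact.
  have C0 : 'C(s, j)%:R != 0 :> F by rewrite natr0 // -lt0n bin_gt0.
  by rewrite e !invfM mulrC !mulrA divff // mul1r mulrC.
rewrite (exchange_big_dep_nat xpredT) //=.
rewrite /ex mulmx_sumr; apply: eq_big_nat => j /andP [_ jN].
rewrite -(big_nat_widenl j 0 N xpredT) // -{1}[j]add0n big_addn mulmx_suml.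
rewrite [RHS](@big_cat_nat _ _ _ (N - j)) ?leq_subr //=.
rewrite [X in _ = _ + X]big_nat [X in _ = _ + X]big1 => [|i /andP [iN _]].
  by rewrite addr0; apply: eq_bigr => i _; rewrite addnK /f -scalemxAl -scalemxAr scalerA.
by rewrite -scalemxAl -scalemxAr scalerA -/(f i j) f0 // -(subnK (ltnW jN)) leq_add2r.
Qed.

Lemma mxvec_expl n (z Y : 'M[F]_n) k : mxvec Y *m lin_mulmx z ^+ k = mxvec (z ^+ k *m Y).
Proof.
elim: k => [|k IH]; first by rewrite !expr0 mulmx1 mul1mx.
by rewrite exprSr exprS -!mulmxE !mulmxA IH mul_vec_lin /= !mulmxA.
Qed.

Lemma mxvec_expr n (z Y : 'M[F]_n) k : mxvec Y *m lin_mulmxr z ^+ k = mxvec (Y *m z ^+ k).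
Proof.
elim: k => [|k IH]; first by rewrite !expr0 !mulmx1.
by rewrite !exprSr -!mulmxE !mulmxA IH mul_vec_lin.
Qed.

Lemma ex_vecl n (z Y : 'M[F]_n) N : mxvec Y *m ex N (lin_mulmx z) = mxvec (ex N z *m Y).
Proof.
rewrite mulmx_sumr mulmx_suml linear_sum; apply: eq_bigr => i _.
by rewrite -scalemxAr mxvec_expl -scalemxAl linearZ.
Qed.

Lemma ex_vecr n (z Y : 'M[F]_n) N : mxvec Y *m ex N (lin_mulmxr z) = mxvec (Y *m ex N z).
Proof.
rewrite !mulmx_sumr linear_sum; apply: eq_bigr => i _.
by rewrite -!scalemxAr mxvec_expr linearZ.
Qed.

Lemma ex0 n N : (0 < N)%N -> ex N (0 : 'M[F]_n) = 1%:M.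
Proof.
case: N => // N _; rewrite /ex big_nat_recl // expr0 fact0 invr1 scale1r big1 ?addr0 // => i _.
by rewrite expr0n /= scaler0.
Qed.

(** Truncation of (exp x - 1 - x) / x^2. *)
Definition ex2 n N (x : 'M[F]_n) : 'M[F]_n := \sum_(0 <= i < N) (i.+2`!%:R^-1 : F) *: x ^+ i.

Lemma exE n N (x : 'M[F]_n) : ex N.+2 x = 1%:M + x + x *m x *m ex2 N x.
Proof.
rewrite /ex !big_nat_recl // expr0 expr1 !invr1 !scale1r addrA; congr (_ + _).
rewrite mulmx_sumr; apply: eq_bigr => i _.
by rewrite -scalemxAr exprS exprS -!mulmxE mulmxA.
Qed.

Lemma ex1E n N (x : 'M[F]_n) :
  ex N.+1 x = 1%:M + \sum_(0 <= i < N) (i.+1`!%:R^-1 : F) *: x ^+ i.+1.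
Proof. by rewrite /ex big_nat_recl // expr0 invr1 scale1r. Qed.

Lemma exp_conj n (z : 'M[F]_n) : nilm z -> exists E E' u u', [/\ E *m E' = 1%:M,
  E = 1%:M + z + z *m z *m u, E' = 1%:M - z + z *m z *m u',
  forall A : {vspace 'M[F]_n}, 1%:M \in A -> (forall x, x \in A -> z *m x \in A) ->
    u \in A /\ u' \in A &
  forall (S : {vspace 'M[F]_n}) Y, (forall W, W \in S -> lb z W \in S) -> lb z Y \in S ->
    E *m Y *m E' - Y \in S /\ E' *m Y *m E - Y \in S].
Proof.
move=> zn; have [K0 zK0] := zn; have [K1 aK1] := nilm_Ad zn.
have [K2 aK2] : nilm (Ad (- z)).
  apply: nilm_Ad; exists K0; by rewrite exprNn zK0 mulr0.
(* The successor ensures that N is at least 2, as [exE] requires. *)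
pose K := (maxn K0 (maxn K1 K2)).+1.
have K0K : (K0 <= K)%N by apply: leqW; exact: leq_maxl.
have K1K : (K1 <= K)%N by apply: leqW; rewrite !leq_max leqnn orbT.
have K2K : (K2 <= K)%N by apply: leqW; rewrite !leq_max leqnn !orbT.
have zK := expr_up K0K zK0.
have nzK : (- z) ^+ K = 0 by rewrite exprNn zK mulr0.
pose N := (K + K)%N; pose N2 := (K.-1 + K.-1)%N.
have NE : N = N2.+2 by rewrite /N /N2 /K /= addSn addnS.
have EE' : ex N z *m ex N (- z) = 1%:M.
  by rewrite -ex_add ?subrr ?ex0 ?NE //; rewrite mulmxN mulNmx.
exists (ex N z), (ex N (- z)), (ex2 N2 z), (ex2 N2 (- z)); split=> //.
- by rewrite NE exE.
- have zz : (- z) *m (- z) = z *m z by rewrite mulmxN mulNmx opprK.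
  by rewrite NE exE zz.
- move=> A A1 zA.
  have zi i : z ^+ i \in A.
    elim: i => [|i IH]; first by rewrite expr0.
    by rewrite exprS -mulmxE; exact: zA.
  split; apply: memv_suml => i _; apply: memvZ => //.
  rewrite exprNn -signr_odd; case: odd; last by rewrite expr0 mul1r.
  by rewrite expr1 mulN1r memvN.
suff h w (S : {vspace 'M[F]_n}) Y : w ^+ K = 0 -> Ad (- w) ^+ K = 0 ->
  (forall W, W \in S -> lb w W \in S) -> lb w Y \in S -> ex N w *m ex N (- w) = 1%:M ->
  ex N w *m Y *m ex N (- w) - Y \in S.
  move=> S Y zS zY; split; first by apply: h => //; exact: expr_up K2K aK2.
  have -> : ex N z = ex N (- (- z)) by rewrite opprK.
  apply: h; rewrite ?opprK //; try exact: (mulmx1C EE').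
  - exact: expr_up K1K aK1.
  - by move=> W WS; rewrite lbNl memvN zS.
  - by rewrite lbNl memvN.
move=> wK awK wS wY wEE.
(* Left multiplication by w is the sum of the commuting operators ad w and right multiplication, so
   exp(w) Y = W exp(w) with W the exponential of ad w applied to Y. *)
pose W := vec_mx (mxvec Y *m ex N (Ad (- w))).
have Ew : ex N w *m Y = W *m ex N w.
  apply: (can_inj mxvecK); rewrite -ex_vecl.
  have -> : lin_mulmx w = Ad (- w) + lin_mulmxr w :> 'M[F]_(n * n).
    by rewrite /Ad !linearN /= opprK addrC addrA subrr add0r.
  rewrite ex_add //.
  - by rewrite mulmxA -[mxvec Y *m _]vec_mxK ex_vecr.
  - apply: mx_ext => V; rewrite !mulmxA AdE !mul_vec_lin /= AdE; congr mxvec.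
    by rewrite /lb mulmxN mulNmx; mxnc.
  - by apply: mx_ext => V; rewrite mxvec_expr wK !mulmx0 linear0.
rewrite Ew -mulmxA wEE mulmx1.
have -> : W - Y = vec_mx (\sum_(0 <= i < N2.+1) (i.+1`!%:R^-1 : F) *: (mxvec Y *m Ad (- w) ^+ i.+1)).
  apply: (can_inj mxvecK); rewrite vec_mxK linearB /= vec_mxK NE ex1E.
  rewrite [X in X - _]mulmxDr mulmx1 addrAC subrr add0r mulmx_sumr.
  by apply: eq_bigr => i _; rewrite -scalemxAr.
rewrite linear_sum; apply: memv_suml => i _; rewrite linearZ memvZ //=.
elim: i => [|i IH].
  by rewrite expr1 AdE mxvecK lbN lbNl opprK.
by rewrite exprSr -mulmxE mulmxA vec_Ad lbN lbNl opprK; exact: wS.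
Qed.
End Exponential.

Section Conjugation.
Variables (F : closedFieldType) (HF : [pchar F] =i pred0) (n : nat).
Variables (l t nn : {vspace 'M[F]_n}) (Fil : nat -> {vspace 'M[F]_n}) (m : nat).
Hypotheses (R : Red l t) (F1 : 1%:M \in Fil 0%N) (FS : forall i, (Fil i.+1 <= Fil i)%VS).
Hypothesis FM : forall i j x y, x \in Fil i -> y \in Fil j -> x *m y \in Fil (i + j)%N.
Hypotheses (rF : (l + t <= Fil 0%N)%VS) (nF : (nn <= Fil 1%N)%VS).
Hypothesis rn : forall x y, x \in (l + t)%VS -> y \in nn -> lb x y \in nn.
Hypothesis nnl : forall x y, x \in nn -> y \in nn -> lb x y \in nn.
Hypothesis nnil : forall x, x \in nn -> nilm x.

Lemma Fil_le i j : (i <= j)%N -> (Fil j <= Fil i)%VS.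
Proof.
move=> /subnK <-; elim: (j - i)%N => [|k IH]; first exact: subvv.
by rewrite addSn; exact: subv_trans (FS _) IH.
Qed.

Lemma FilM i j k x y : (k <= i + j)%N -> x \in Fil i -> y \in Fil j -> x *m y \in Fil k.
Proof. by move=> kij xi yj; apply: (subvP (Fil_le kij)); exact: FM. Qed.

Lemma Fil_lb i j k x y : (k <= i + j)%N -> x \in Fil i -> y \in Fil j -> lb x y \in Fil k.
Proof.
move=> kij xi yj; apply: memvB; first exact: (FilM kij).
by apply: (@FilM j i) => //; rewrite addnC.
Qed.

(* If u conjugates h into l + t modulo Fil m, then so does an element of
   exp(nn): at each stage the failure of h to lie in l + t is, modulo the next
   term, the bracket with u - 1, and the equivariant projection of u - 1
   to nn produces the element to exponentiate. *)
Lemma conj_into (h : 'M[F]_n -> 'M[F]_n -> Prop) (u : 'M[F]_n) :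
  u - 1%:M \in Fil 1%N ->
  (forall X rho, h X rho -> [/\ rho \in (l + t)%VS, X - rho \in nn & u *m X - rho *m u \in Fil m]) ->
  exists g g', [/\ g *m g' = 1%:M, g \in Fil 0%N, g' \in Fil 0%N,
    forall Y, Y \in (l + t + nn)%VS -> g' *m Y *m g - Y \in nn &
    forall X rho, h X rho -> X - g' *m rho *m g \in Fil m].
Proof.
move=> u1 hh; have Frn : (l + t + nn <= Fil 0%N)%VS.
  by rewrite subv_add rF; exact: subv_trans nF (FS 0%N).
have nrn x y : x \in nn -> y \in (l + t + nn)%VS -> lb x y \in nn.
  move=> xn /memv_addP [a ar [b bn ->]]; rewrite lbDr.
  by apply: memvD; [rewrite lbN memvN rn|exact: nnl].
(* Induction along the filtration: X is conjugated to rho up to [Fil i], by an element moving l + t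
   + nn only within nn. *)
pose Inv i := exists g g', [/\ g *m g' = 1%:M, g - 1%:M \in Fil 1%N, g' - 1%:M \in Fil 1%N,
    forall Y, Y \in (l + t + nn)%VS -> g *m Y *m g' - Y \in nn /\ g' *m Y *m g - Y \in nn &
    forall X rho, h X rho -> g *m X *m g' - rho \in Fil i].
have F0 x : x - 1%:M \in Fil 1%N -> x \in Fil 0%N.
  by move=> x1; rewrite -[x](subrK 1%:M) memvD // (subvP (FS 0%N)).
have fin i : (i <= m)%N -> Inv i -> i = m -> exists g g', [/\ g *m g' = 1%:M, g \in Fil 0%N, g' \in Fil 0%N,
    forall Y, Y \in (l + t + nn)%VS -> g' *m Y *m g - Y \in nn &
    forall X rho, h X rho -> X - g' *m rho *m g \in Fil m].
  move=> _ [g [g' [gg g1 g'1 gY gX]]] <-; exists g, g'; split=> //; rewrite ?F0 //.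
    by move=> Y /gY [].
  move=> X rho hX; have -> : X - g' *m rho *m g = g' *m (g *m X *m g' - rho) *m g.
    by rewrite mulmxBr mulmxBl !mulmxA (mulmx1C gg) mul1mx -(mulmxA X g' g) (mulmx1C gg) mulmx1.
  by apply: (@FilM i 0); rewrite ?addn0 ?F0 //; apply: (@FilM 0 i); rewrite ?F0 ?gX.
suff : forall i, (i < m)%N -> Inv i.+1.
  case: m fin => [|m'] fin' H; last by apply: (fin' m'.+1) => //; exact: H.
  apply: (fin' 0%N) => //; exists 1%:M, 1%:M; rewrite mul1mx subrr mem0v.
  split=> // [Y _|X rho hX]; rewrite !(mul1mx, mulmx1) ?subrr ?mem0v //.
  have [_ Xn _] := hh X rho hX; apply: (subvP (FS 0%N)); exact: (subvP nF).
elim=> [|i IH] im.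
  exists 1%:M, 1%:M; rewrite mul1mx subrr mem0v.
  split=> // [Y _|X rho hX]; rewrite !(mul1mx, mulmx1) ?subrr ?mem0v //.
  by have [_ Xn _] := hh X rho hX; exact: (subvP nF).
have [g [g' [gg g1 g'1 gY gX]]] := IH (ltnW im).
have g'g := mulmx1C gg; have gF := F0 _ g1; have g'F := F0 _ g'1.
pose T := u *m g' - 1%:M.
have T1 : T \in Fil 1%N.
  have -> : T = (u - 1%:M) *m g' + (g' - 1%:M) by rewrite /T mulmxBl mul1mx addrA subrK.
  by rewrite memvD // (@FilM 1 0).
(* With T = u g' - 1, the relation between u X and rho u turns the remaining error y into [rho, T],
   modulo the next term. *)
have eqn X rho : h X rho -> [/\ rho \in (l + t)%VS, g *m X *m g' - rho \in nn,
    g *m X *m g' - rho \in Fil i.+1 &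
    lb rho T - (g *m X *m g' - rho) \in Fil i.+2].
  move=> hX; have [rr Xn uX] := hh X rho hX; have y1 := gX X rho hX.
  have Xr : X \in (l + t + nn)%VS by rewrite -[X](subrKC rho) memv_add.
  split=> //.
    rewrite -[_ - rho](subrK X) -addrA [- _ + X]addrC addrA.
    have -> : g *m X *m g' - rho + X = (g *m X *m g' - X) + (X - rho) + X by rewrite addrA subrK.
    by rewrite addrK memvD //; case: (gY X Xr).
  set y := g *m X *m g' - rho in y1 *.
  have e : u *m g' *m (rho + y) - rho *m (u *m g') \in Fil m.
    have -> : u *m g' *m (rho + y) - rho *m (u *m g') = (u *m X - rho *m u) *m g'.
      by rewrite /y subrKC mulmxBl !mulmxA -(mulmxA u g' g) g'g mulmx1.
    by apply: (@FilM m 0); rewrite ?addn0.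
  have -> : lb rho T - y = T *m y - (u *m g' *m (rho + y) - rho *m (u *m g')).
    have -> : u *m g' = 1%:M + T by rewrite subrKC.
    by rewrite /lb; mxnc.
  rewrite memvB //; last exact: (subvP (Fil_le im)).
  exact: (@FilM 1 i.+1).
(* Errors lie in nn and in [Fil i.+1]; adding [Fil i.+2] puts [rho, T] itself in S. An equivariant
   projection of T to S has the same brackets with rho, and its nn-part z is what gets
   exponentiated. *)
pose S := (nn :&: Fil i.+1 + Fil i.+2)%VS.
have Sst x y : x \in (l + t)%VS -> y \in S -> lb y x \in S.
  move=> xr /memv_addP [a]; rewrite memv_cap => /andP [an ai] [b bi ->].
  have xF := subvP rF _ xr; rewrite lbDl memv_add //.
    rewrite memv_cap; apply/andP; split; first by rewrite lbN memvN rn.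
    by apply: (@Fil_lb i.+1 0) => //; rewrite addn0.
  by apply: (@Fil_lb i.+2 0) => //; rewrite addn0.
have [||p [p1 p2 p3]] := @equivariant_proj _ HF _ l t S R.
- by move=> x y xl; apply: Sst; apply: (subvP (addvSl _ _)).
- by move=> x y xl; apply: Sst; apply: (subvP (addvSr _ _)).
have /memv_addP [z] := p1 T; rewrite memv_cap => /andP [zn zi] [w wi pT].
have [E [E' [v [v' [EE Ez E'z vA Econj]]]]] := exp_conj HF (nnil zn).
have z0 : z \in Fil 0%N by apply: (subvP (Fil_le (leq0n i.+1))).
have z1 : z \in Fil 1%N by apply: (subvP (Fil_le (ltn0Sn i))).
have [v0 v'0] : v \in Fil 0%N /\ v' \in Fil 0%N.
  by apply: vA => // x x0; exact: (@FilM 0 0).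
have zzi : z *m z \in Fil i.+2 by apply: (@FilM 1 i.+1).
have al : z *m z *m v \in Fil i.+2 by apply: (@FilM i.+2 0); rewrite ?addn0.
have al' : z *m z *m v' \in Fil i.+2 by apply: (@FilM i.+2 0); rewrite ?addn0.
have i21 : (Fil i.+2 <= Fil 1%N)%VS by exact: Fil_le.
have E1 : E - 1%:M \in Fil 1%N.
  by rewrite Ez addrC -!addrA addKr; rewrite memvD // (subvP i21).
have E'1 : E' - 1%:M \in Fil 1%N.
  have -> : E' - 1%:M = z *m z *m v' - z by rewrite E'z; mxnc.
  by rewrite memvB // (subvP i21).
have EY Y : Y \in (l + t + nn)%VS -> E *m Y *m E' - Y \in nn /\ E' *m Y *m E - Y \in nn.
  by move=> Yr; apply: Econj; [move=> W Wn; exact: nnl | exact: nrn].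
have nr Y Z : Y \in (l + t + nn)%VS -> Z - Y \in nn -> Z \in (l + t + nn)%VS.
  by move=> Yr ZY; rewrite -[Z](subrKC Y) memvD //; apply: (subvP (addvSr _ _)).
exists (E *m g), (g' *m E'); split.
- by rewrite mulmxA -(mulmxA E) gg mulmx1.
- have -> : E *m g - 1%:M = (E - 1%:M) *m g + (g - 1%:M) by rewrite mulmxBl mul1mx addrA subrK.
  by rewrite memvD // (@FilM 1 0).
- have -> : g' *m E' - 1%:M = g' *m (E' - 1%:M) + (g' - 1%:M) by rewrite mulmxBr mulmx1 addrA subrK.
  by rewrite memvD // (@FilM 0 1).
- move=> Y Yr; have [gY1 gY2] := gY Y Yr; have [EY1 EY2] := EY Y Yr; split.
    have [h1 _] := EY _ (nr _ _ Yr gY1).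
    have -> : E *m g *m Y *m (g' *m E') - Y = (E *m (g *m Y *m g') *m E' - g *m Y *m g') + (g *m Y *m g' - Y).
      by rewrite addrA subrK !mulmxA.
    exact: memvD.
  have [_ h1] := gY _ (subvP (addvSr (l + t) nn) _ EY2).
  have -> : g' *m E' *m Y *m (E *m g) - Y =
      (g' *m (E' *m Y *m E - Y) *m g - (E' *m Y *m E - Y)) + (E' *m Y *m E - Y) + (g' *m Y *m g - Y).
    by rewrite subrK mulmxBr mulmxBl addrA subrK !mulmxA.
  by apply: memvD => //; exact: memvD.
move=> X rho hX; have [rr yn yi lT] := eqn X rho hX.
set X' := g *m X *m g' in yn yi lT *; set y := X' - rho in yn yi lT *.
have rF' := subvP rF _ rr.
have X'F : X' \in Fil 0%N.
  rewrite -[X'](subrKC rho) memvD //; apply: (subvP (FS 0%N)); exact: (subvP nF).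
have lTS : lb rho T \in S.
  rewrite -[lb rho T](subrKC y) memv_add ?memv_cap ?yn //.
have pl : lb rho z + lb rho w = lb rho T.
  by rewrite -lbDr -pT lbN -p3 // lbN linearN /= p2 ?opprK.
have -> : E *m g *m X *m (g' *m E') - rho = E *m X' *m E' - rho by rewrite /X' !mulmxA.
(* To first order, conjugation by E adds [z, rho], which cancels y; all other terms are of the next
   order. *)
have -> : E *m X' *m E' - rho = (E *m X' *m E' - X' - lb z X') + (lb rho w - (lb rho T - y) + lb z y).
  have -> : lb rho T = lb rho z + lb rho w by [].
  by rewrite /y /lb; mxnc.
apply: memvD; last first.
  apply: memvD; last by apply: (@Fil_lb 1 i.+1).
  by apply: memvB => //; apply: (@Fil_lb 0 i.+2).
have -> : E *m X' *m E' - X' - lb z X' =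
   (z *m z *m v) *m (X' *m E') + (X' + z *m X') *m (z *m z *m v') - z *m X' *m z.
  by rewrite Ez E'z /lb; mxnc.
have E'F := F0 _ E'1.
apply: memvB; first apply: memvD.
- by apply: (@FilM i.+2 0); rewrite ?addn0 //; exact: (@FilM 0 0).
- by apply: (@FilM 0 i.+2) => //; apply: memvD => //; exact: (@FilM 0 0).
- by apply: (@FilM i.+1 1); rewrite ?addn1 //; apply: (@FilM i.+1 0); rewrite ?addn0.
Qed.
End Conjugation.

(** * Conjugating subalgebras into a reductive complement *)
Section ConjRed.
Variables (F : closedFieldType) (HF : [pchar F] =i pred0) (n : nat).
Variables (g g' : 'M[F]_n).

Definition cj (x : 'M[F]_n) : 'M[F]_n := g' *m x *m g.
Fact cj_linear : linear cj.
Proof. by move=> a x y; rewrite /cj mulmxDr mulmxDl -scalemxAr -scalemxAl. Qed.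
HB.instance Definition _ := GRing.isLinear.Build F _ _ _ cj cj_linear.

Hypothesis gg : g *m g' = 1%:M.

Lemma cj_lb x y : cj (lb x y) = lb (cj x) (cj y).
Proof.
rewrite /cj /lb mulmxBr mulmxBl !mulmxA.
by rewrite -(mulmxA (g' *m x) g g') -(mulmxA (g' *m y) g g') gg !mulmx1.
Qed.

Lemma Red_img m (f : {linear 'M[F]_n -> 'M[F]_m}) (l t : {vspace 'M[F]_n}) :
  (forall x y, x \in (l + t)%VS -> y \in (l + t)%VS -> f (lb x y) = lb (f x) (f y)) ->
  (forall x, x \in t -> dg (f x)) -> Red l t -> Red (linimg f l) (linimg f t).
Proof.
move=> fM fdg [hl sl lt tt tdg].
have ls x : x \in l -> x \in (l + t)%VS by apply: subvP; exact: addvSl.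
have ts x : x \in t -> x \in (l + t)%VS by apply: subvP; exact: addvSr.
have fMl x y : x \in l -> y \in l -> f (lb x y) = lb (f x) (f y) by auto.
split.
- exact: lie_img.
- by apply: (semis_img fMl _ hl sl) => x; rewrite memv0 => /eqP ->; exact: linear0.
- by move=> _ _ /linimgP [x xl ->] /linimgP [y yt ->]; rewrite -fM ?lt ?linear0 //; auto.
- by move=> _ _ /linimgP [x xl ->] /linimgP [y yt ->]; rewrite -fM ?tt ?linear0 //; auto.
- by move=> _ /linimgP [x xt ->]; exact: fdg.
Qed.

Lemma Red_cj (l t : {vspace 'M[F]_n}) : Red l t -> Red (linimg cj l) (linimg cj t).
Proof.
move=> R; apply: Red_img => // [x y _ _|x xt]; first exact: cj_lb.
by apply: dg_conj; [exact: mulmx1C|case: R => _ _ _ _; apply].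
Qed.

Lemma Red_lie (l t : {vspace 'M[F]_n}) x y : Red l t ->
  x \in (l + t)%VS -> y \in (l + t)%VS -> lb x y \in l.
Proof.
move=> [hl _ lt tt _] /memv_addP [a al [b bt ->]] /memv_addP [c cl [d dt ->]].
rewrite !(lbDl, lbDr) (lt a d) // (tt b d) // [lb b c]lbN (lt c b) // oppr0 !addr0.
exact: hl.
Qed.
End ConjRed.

(** * Covering one level by a reductive subalgebra of a higher one *)

Lemma lclosed_mul (F : fieldType) n (v : 'rV[F]_n) (S : {vspace 'rV[F]_n}) :
  lclosed (fun x : 'M[F]_n => v *m x \in S).
Proof. by split=> [|c u w]; rewrite ?mulmx0 ?mem0v // mulmxDr -scalemxAr; exact: memvPa. Qed.

Section Cover.
Variables (F : closedFieldType) (HF : [pchar F] =i pred0) (N : nat).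
Variables (H hs : {vspace 'M[F]_N.+1}) (U Wp : {vspace 'rV[F]_N.+1}).
Variables (A : nat -> {vspace 'rV[F]_N.+1}) (p : nat).
Hypotheses (hH : lie H) (spH : splits H) (hsH : (hs <= H)%VS).
Hypotheses (hsU : forall X v, X \in hs -> v *m X \in U).
Hypothesis (hsW : forall X v, X \in hs -> v \in Wp -> v *m X = 0).
Hypotheses (A0 : A 0%N = 0%VS) (Ap : A p = fullv) (Ale : forall j, (A j <= A j.+1)%VS).
Hypothesis stA : forall j x, x \in H -> stab (A j) x.

(** U holds the vectors that [hs] can reach and Wp vectors that it kills. [low] says that nothing
    visible to [hs] is gained from A j to S, [upp] that nothing visible is gained from S to A
    j.+1. *)
Definition low j (S : {vspace 'rV[F]_N.+1}) := (S :&: U <= A j)%VS /\ (S <= A j + Wp)%VS.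
Definition upp j (S : {vspace 'rV[F]_N.+1}) :=
  (A j.+1 :&: U <= S)%VS /\ (A j.+1 <= S + Wp)%VS.

Hypothesis lowupp : forall j S, (A j <= S)%VS -> (S <= A j.+1)%VS ->
  (forall x, x \in H -> stab S x) -> low j S \/ upp j S.

(* Between A j and A (j+1) there is a simple H-subquotient V j / M j which
   carries the whole jump seen by hs. *)
Lemma jump_step j : exists MV : {vspace 'rV[F]_N.+1} * {vspace 'rV[F]_N.+1},
  [/\ [/\ (A j <= MV.1)%VS, (MV.1 <= MV.2)%VS & (MV.2 <= A j.+1)%VS],
      forall x, x \in H -> stab MV.1 x /\ stab MV.2 x, low j MV.1, upp j MV.2
    & simple_step H MV.1 MV.2].
Proof.
have [|M [[AM MA stM lM] mxM]] := @vs_max _ _ (fun S => [/\ (A j <= S)%VS, (S <= A j.+1)%VS,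
    forall x, x \in H -> stab S x & low j S]).
  by exists (A j); split; rewrite ?subvv //; [exact: stA | split; rewrite ?capvSl ?addvSl].
have [|V [[MV VA stV uV] mnV]] := @vs_min _ _ (fun S => [/\ (M <= S)%VS, (S <= A j.+1)%VS,
    forall x, x \in H -> stab S x & upp j S]).
  by exists (A j.+1); split; rewrite ?subvv //; [exact: stA | split; rewrite ?capvSl ?addvSl].
exists (M, V); split=> // [x xH|S /= MS SV stS].
  by split; [exact: stM|exact: stV].
have AS := subv_trans AM MS; have SA := subv_trans SV VA.
case: (lowupp AS SA stS) => h; [left|right].
  by apply/esym/dim_eq_sub => //; apply: mxM.
by apply/dim_eq_sub => //; apply: mnV.
Qed.

Section WithSteps.
Variables (M V : nat -> {vspace 'rV[F]_N.+1}).
Hypotheses (AM : forall j, (A j <= M j)%VS) (MV : forall j, (M j <= V j)%VS).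
Hypothesis (VA : forall j, (V j <= A j.+1)%VS).
Hypotheses (stM : forall j x, x \in H -> stab (M j) x) (stV : forall j x, x \in H -> stab (V j) x).
Hypotheses (lM : forall j, low j (M j)) (uV : forall j, upp j (V j)).
Hypothesis smp : forall j, simple_step H (M j) (V j).

(** Each interval of the chain is cut into three pieces, of which only the middle one is simple;
    [fl] lists the pieces with a single index, so that 3 p steps reach the top. *)
Definition lev j r := match r with 0 => A j | 1 => M j | 2 => V j | _ => A j.+1 end%N.
Definition nxt (s : nat * nat) := match s.2 with 0 => (s.1, 1) | 1 => (s.1, 2) | _ => (s.1.+1, 0) end%N.
Definition pos a := iter a nxt (0, 0)%N.
Definition fl a := lev (pos a).1 (pos a).2.

Lemma pos3 j : pos (3 * j) = (j, 0)%N /\ pos (3 * j).+1 = (j, 1)%N /\ pos (3 * j).+2 = (j, 2)%N.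
Proof.
elim: j => [|j [e0 [e1 e2]]] //.
have posS a : pos a.+1 = nxt (pos a) by [].
have e : pos (3 * j.+1) = (j.+1, 0)%N by rewrite mulnS addnC addn3 posS e2.
by rewrite (posS (3 * j.+1).+1)%N (posS (3 * j.+1)%N) e.
Qed.

Lemma fl_step a : exists j r, [/\ (r < 3)%N, fl a = lev j r & fl a.+1 = lev j r.+1].
Proof.
have r3 : ((pos a).2 < 3)%N.
  elim: a => // a; rewrite {2}/pos iterS -/(pos a); case: (pos a) => j [|[|[|r]]] //=.
exists (pos a).1, (pos a).2; split=> //; rewrite /fl /pos iterS -/(pos a).
by case: (pos a) r3 => j [|[|[|r]]].
Qed.

Lemma lev_le j r : (lev j r <= lev j r.+1)%VS.
Proof. by case: r => [|[|[|r]]] /=; rewrite ?subvv. Qed.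

Lemma lev_mono j r s : (r <= s)%N -> (lev j r <= lev j s)%VS.
Proof.
move=> /subnK <-; elim: (s - r)%N => [|i IH]; first exact: subvv.
by rewrite addSn; exact: subv_trans IH (lev_le _ _).
Qed.

Lemma lev_top j r : (lev j r <= A j.+1)%VS.
Proof. by rewrite -[A j.+1]/(lev j (r.+3)); apply: lev_mono; rewrite -addn3 leq_addr. Qed.

Lemma st_lev j r x : x \in H -> stab (lev j r) x.
Proof. by case: r => [|[|[|r]]] /=; auto. Qed.

(** Acting as 0 on the two outer pieces of each interval. By [low] and [upp] all of [hs] has this
    property, and for such elements the flag [fl] satisfies the hypotheses of [levi_mostow]. *)
Definition Pk x := x \in H /\ forall j v, (v \in A j.+1 -> v *m x \in V j) /\ (v \in M j -> v *m x \in A j).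

Lemma lclosed_Pk : lclosed Pk.
Proof.
apply: lclosed_and; first exact: lclosed_vs.
apply: lclosed_all => j; apply: lclosed_all => v.
by apply: lclosed_and; apply: lclosed_imp; exact: lclosed_mul.
Qed.

Definition k1 := vsp Pk.
Lemma k1P x : x \in k1 <-> Pk x. Proof. exact: vspP lclosed_Pk x. Qed.
Lemma k1H : (k1 <= H)%VS. Proof. by apply/subvP => x /k1P []. Qed.

Lemma k1_ideal : ideal_of H k1.
Proof.
move=> x y xH /k1P [yH hy]; apply/k1P; split; first exact: hH.
move=> j v; split=> vj; rewrite /lb mulmxBr !mulmxA memvB //.
- by apply (hy j _).1; exact: stA.
- by apply: stV => //; apply (hy j _).1.
- by apply (hy j _).2; exact: stM.
- by apply: stA => //; apply (hy j _).2.
Qed.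

Lemma k1_splits : splits k1.
Proof.
move=> x /k1P [xH hx]; have [q [q0 qH qd qn]] := spH xH; exists q; split=> //.
have [g gE] : exists g, horner_mx x q = horner_mx x g *m x.
  have : root q 0 by apply/rootP.
  rewrite root_factor_theorem subr0 => /dvdpP [g ->]; exists g.
  by rewrite rmorphM /= horner_mx_X.
apply/k1P; split=> // j v; rewrite gE mulmxA; split=> vj.
  by apply (hx j _).1; apply: stab_horner => // w; exact: stA.
by apply (hx j _).2; apply: stab_horner => // w; exact: stM.
Qed.

Lemma hs_k1 : (hs <= k1)%VS.
Proof.
apply/subvP => X Xh; have XH := subvP hsH _ Xh; apply/k1P; split=> // j v; split=> vj.
  by case: (uV j) => /subvP h _; apply: h; rewrite memv_cap hsU // andbT; exact: stA.
by case: (lM j) => /subvP h _; apply: h; rewrite memv_cap hsU // andbT; exact: stM.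
Qed.

Lemma fl_end : fl (3 * p) = fullv.
Proof. by rewrite /fl (pos3 p).1 /= Ap. Qed.

Lemma fl_le a : (fl a <= fl a.+1)%VS.
Proof. by have [j [r [_ -> ->]]] := fl_step a; exact: lev_le. Qed.

Lemma fl_stab a x : x \in H -> stab (fl a) x.
Proof. by have [j [r [_ -> _]]] := fl_step a; exact: st_lev. Qed.

Lemma fl_simple a : (forall x v, x \in k1 -> v \in fl a.+1 -> v *m x \in fl a) \/
  simple_step H (fl a) (fl a.+1).
Proof.
have [j [[|[|[|r]]] [r3 -> ->]]] := fl_step a => //=.
- by left=> x v /k1P [_ h] vM; apply (h j v).2.
- by right.
- by left=> x v /k1P [_ h] vM; apply (h j v).1.
Qed.

Definition nn := strict_part k1 fl.

Lemma nn_lev x j r : x \in nn -> (r < 3)%N -> forall v, v \in lev j r.+1 -> v *m x \in lev j r.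
Proof.
move=> /strict_partP [_ sx] r3 v vj; have [e0 [e1 e2]] := pos3 j.
have [e3 _] := pos3 j.+1; have e3' : (3 * j.+1 = (3 * j).+3)%N by rewrite mulnS addnC addn3.
case: r r3 vj => [|[|[|r]]] // _ vj.
- by have := sx (3 * j)%N v; rewrite /fl e0 e1; apply.
- by have := sx (3 * j).+1%N v; rewrite /fl e1 e2; apply.
- by have := sx (3 * j).+2%N v; rewrite /fl e2 -e3' e3; apply.
Qed.

(** [f] acts as a projection onto the middle piece. The last two clauses say that it is invisible to
    [hs]: modulo A j it fixes U, which contains the images, and up to Wp, which is killed, it fixes
    A j.+1. *)
Definition fcond j (f : 'M[F]_N.+1) := [/\ forall v, v \in A j.+1 -> v *m f \in V j,
  forall v, v \in M j -> v *m f \in A j, forall v, v \in V j -> v - v *m f \in M j,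
  forall v, v \in A j.+1 -> v \in U -> v - v *m f \in A j
  & forall v, v \in A j.+1 -> v - v *m f \in (A j + Wp)%VS].

Lemma A_le i j : (i <= j)%N -> (A i <= A j)%VS.
Proof.
move=> /subnK <-; elim: (j - i)%N => [|k IH]; first exact: subvv.
by rewrite addSn; exact: subv_trans IH (Ale _).
Qed.

(** The projection onto a complement Q of M j in V j along M j + C. Q is chosen to contain a
    complement taken inside U, and C, a complement of V j in A j.+1, is chosen inside Wp; [low] and
    [upp] permit both. *)
Lemma fcond_local j : exists P : 'M[F]_N.+1, [/\ forall v, v *m P \in V j,
  forall v, v \in M j -> v *m P = 0, forall v, v \in V j -> v - v *m P \in M j,
  forall v, v \in A j.+1 -> v \in U -> v - v *m P \in A j
  & forall v, v \in A j.+1 -> v - v *m P \in (A j + Wp)%VS].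
Proof.
have [lM1 lM2] := lM j; have [uV1 uV2] := uV j.
pose UA := (A j.+1 :&: U)%VS; pose C := ((Wp :&: A j.+1) :\: V j)%VS.
pose Q := ((UA :\: M j) + (V j :\: (M j + UA)))%VS.
have UAV : (UA <= V j)%VS by exact: uV1.
have UMV : (M j + UA <= V j)%VS by rewrite subv_add MV.
have QM : (Q + M j)%VS = V j.
  rewrite /Q -addvA [(_ + M j)%VS]addvC addvA addv_diff addvC [(UA + _)%VS]addvC addv_diff; exact/addv_idPl.
have QM0 : (Q :&: M j)%VS = 0%VS.
  apply/eqP; rewrite -subv0; apply/subvP => x; rewrite memv_cap => /andP [/memv_addP [u uU [c cV ->]] m].
  have uUA : u \in UA by apply: (subvP _ _ uU); exact: diffvSl.
  have c0 : c = 0.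
    apply/eqP; rewrite -memv0 -(capv_diff (V j) (M j + UA)) memv_cap cV /=.
    by rewrite -[c](addKr u) addrC memv_add // memvN.
  rewrite c0 addr0 in m *; by rewrite -(capv_diff UA (M j)) memv_cap uU.
have CW : (C <= Wp)%VS by apply: subv_trans (diffvSl _ _) (capvSl _ _).
have CA : (C <= A j.+1)%VS by apply: subv_trans (diffvSl _ _) (capvSr _ _).
have CV0 : (C :&: V j)%VS = 0%VS by exact: capv_diff.
have CVA : (C + V j)%VS = A j.+1.
  rewrite /C addv_diff; apply/eqP; rewrite eqEsubv subv_add capvSr VA /=.
  apply/subvP => x xA; have /memv_addP [v vV [w wW xE]] := subvP uV2 _ xA.
  rewrite xE addrC memv_add // memv_cap wW /=.
  by rewrite -[w](addKr v) -xE addrC memvB // (subvP (VA j)).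
have QV : (Q <= V j)%VS by rewrite -QM addvSl.
have QMC0 : (Q :&: (M j + C))%VS = 0%VS.
  apply/eqP; rewrite -subv0; apply/subvP => x; rewrite memv_cap => /andP [xQ /memv_addP [m mM [c cC xE]]].
  have c0 : c = 0.
    apply/eqP; rewrite -memv0 -CV0 memv_cap cC /= -[c](addKr m) -xE addrC memvB //.
      exact: (subvP QV).
    exact: (subvP (MV j)).
  by rewrite -QM0 memv_cap xQ /= xE c0 addr0.
have QMCA : (Q + (M j + C))%VS = A j.+1 by rewrite addvA QM addvC.
pose P := lin1_mx (daddv_pi Q (M j + C)).
have PE v : v *m P = daddv_pi Q (M j + C) v by rewrite mul_rV_lin1.
have dec v : v \in A j.+1 -> v - v *m P \in (M j + C)%VS.
  move=> vA; rewrite PE -{1}(daddv_pi_add QMC0 (_ : v \in (Q + (M j + C))%VS)) ?QMCA //.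
  by rewrite addrAC subrr add0r; exact: memv_pi.
have PQ v : v *m P \in Q by rewrite PE memv_pi.
have PM v : v \in M j -> v *m P = 0.
  move=> vM; have vA := subvP (VA j) _ (subvP (MV j) _ vM).
  apply/eqP; rewrite -memv0 -QMC0 memv_cap PQ /=.
  rewrite -[v *m P](subKr v) memvB ?dec //.
  by apply: (subvP (addvSl _ _)).
have PV v : v \in V j -> v - v *m P \in M j.
  move=> vV; rewrite -QM in vV; have /memv_addP [q qQ [m mM ->]] := vV.
  by rewrite mulmxDl (PM m) // addr0 PE daddv_pi_id // addrAC subrr add0r.
exists P; split=> //.
- by move=> v; apply: (subvP QV).
- move=> u uA uU; have uUA : u \in UA by rewrite memv_cap uA.
  have : u \in ((UA :\: M j) + M j)%VS by rewrite addv_diff; apply: (subvP (addvSl _ _)).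
  move=> /memv_addP [q qQ [m mM uE]].
  have qQ' : q \in Q by apply: (subvP (addvSl _ _)).
  have -> : u - u *m P = m.
    by rewrite uE mulmxDl (PM m) // addr0 PE daddv_pi_id // addrAC subrr add0r.
  apply: (subvP lM1); rewrite memv_cap mM /=.
  have qU : q \in U.
    by have := subvP (diffvSl UA (M j)) _ qQ; rewrite memv_cap => /andP [].
  by rewrite -[m](addKr q) -uE addrC memvB.
- move=> v vA; have /subvP := dec v vA => h; apply: (subvP _ _ (dec v vA)).
  by rewrite subv_add lM2; apply: subv_trans CW (addvSr _ _).
Qed.

(** The local projections are glued from below, using the previous [f] on A j and [P] on a
    complement. *)
Lemma fcond_ex : exists f, forall j, fcond j f.
Proof.
suff h j : exists f, forall i, (i < j)%N -> fcond i f.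
  have [f hf] := h p; exists f => j; case: (ltnP j p) => jp; first exact: hf.
  have Aj : A j = fullv.
    by apply/eqP; rewrite eqEsubv subvf -Ap A_le.
  have Mf : M j = fullv by apply/eqP; rewrite eqEsubv subvf -Aj AM.
  have Vf : V j = fullv by apply/eqP; rewrite eqEsubv subvf -Mf MV.
  rewrite /fcond Mf Vf Aj; split; try by move=> *; exact: memvf.
  by move=> v _; apply: (subvP (addvSl _ _)); exact: memvf.
elim: j => [|j [f IH]]; first by exists 0.
have [P [P1 P2 P3 P4 P5]] := fcond_local j.
pose pr := lin1_mx (projv (A j)).
have prE v : v *m pr = projv (A j) v by rewrite mul_rV_lin1.
have prA v : v *m pr \in A j by rewrite prE memv_proj.
exists (pr *m f + (1%:M - pr) *m P) => i; rewrite ltnS leq_eqVlt => /predU1P [->|ij]; last first.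
  have E v : v \in A i.+1 -> v *m (pr *m f + (1%:M - pr) *m P) = v *m f.
    move=> vA; have vj : v *m pr = v by rewrite prE projv_id // (subvP (A_le ij)).
    by rewrite mulmxDr !mulmxA mulmxBr mulmx1 vj subrr mul0mx addr0.
  have [f1 f2 f3 f4 f5] := IH i ij.
  have MA v : v \in M i -> v \in A i.+1 by move=> vM; apply: (subvP (VA i)); exact: (subvP (MV i)).
  split=> v vi; [| | | move=> vU |].
  - by rewrite E ?f1.
  - by rewrite E ?f2 // MA.
  - by rewrite E ?f3 // (subvP (VA i)).
  - by rewrite E ?f4.
  - by rewrite E ?f5.
have fA v : v \in A j -> v *m f \in A j.
  case: (j) IH => [_|j' IH' vj]; first by rewrite A0 memv0 => /eqP ->; rewrite mul0mx mem0v.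
  by have [f1 _ _ _ _] := IH' j' (ltnSn j'); apply: (subvP (VA j')); exact: f1.
pose f' := pr *m f + (1%:M - pr) *m P.
have E v : v *m P - v *m f' \in A j.
  have -> : v *m P - v *m f' = v *m pr *m P - v *m pr *m f.
    by rewrite /f' mulmxDr !mulmxA mulmxBr mulmx1 mulmxBl opprD opprB addrCA subrKC addrC.
  rewrite memvB ?fA //; rewrite P2 ?mem0v //; exact: (subvP (AM j)).
have E2 v : v *m f' = v *m P - (v *m P - v *m f') by rewrite subKr.
have E3 v : v - v *m f' = (v - v *m P) + (v *m P - v *m f') by rewrite addrA subrK.
have AV : (A j <= V j)%VS by apply: subv_trans (AM j) (MV j).
rewrite -/f'; split=> v vj; [| | | move=> vU |].
- by rewrite E2 memvB // (subvP AV).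
- by rewrite E2 P2 // memvB ?mem0v // -[X in X - _](P2 v vj).
- by rewrite E3 memvD ?P3 // (subvP (AM j)).
- by rewrite E3 memvD ?P4.
- by rewrite E3 memvD ?P5 // (subvP (addvSl _ _)).
Qed.

Let nn_ideal x y : x \in H -> y \in nn -> lb x y \in nn.
Proof.
move=> xH /strict_partP [yk ys]; apply/strict_partP; split; first exact: k1_ideal.
move=> a v va; rewrite /lb mulmxBr !mulmxA memvB //; first by apply: ys; exact: fl_stab.
by apply: fl_stab => //; exact: ys.
Qed.

Let nn_nilm x : x \in nn -> nilm x.
Proof. by move=> /strict_partP [_]; apply: strict_nilm fl_end; rewrite /fl /= A0. Qed.

(** The room in which [f] is corrected: an H-stable space, modulo which [f] commutes with [k1] by
    [fcond_lb]. *)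
Definition Pdef (T : 'M[F]_N.+1) := forall j v, [/\ v \in A j.+1 -> v *m T \in V j,
  v \in M j -> v *m T \in A j & v \in V j -> v *m T \in M j].

Lemma lclosed_Pdef : lclosed Pdef.
Proof.
split=> [j v|c x y hx hy j v]; first by rewrite mulmx0 !mem0v.
have [x1 x2 x3] := hx j v; have [y1 y2 y3] := hy j v; rewrite mulmxDr -scalemxAr.
by split=> h; apply: memvPa; auto.
Qed.

Lemma Pdef_stable T x : x \in H -> Pdef T -> Pdef (lb T x).
Proof.
move=> xH hT j v; rewrite /lb mulmxBr !mulmxA.
split=> vj; apply: memvB.
- by apply: stV => //; have [h _ _] := hT j v; exact: h.
- by have [h _ _] := hT j (v *m x); apply: h; exact: stA.
- by apply: stA => //; have [_ h _] := hT j v; exact: h.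
- by have [_ h _] := hT j (v *m x); apply: h; exact: stM.
- by apply: stM => //; have [_ _ h] := hT j v; exact: h.
- by have [_ _ h] := hT j (v *m x); apply: h; exact: stV.
Qed.

Lemma fcond_lb f x : (forall j, fcond j f) -> x \in k1 -> Pdef (lb f x).
Proof.
move=> hf xk j v; have xH := subvP k1H _ xk; have /k1P [_ hx] := xk; have [hxj1 hxj2] := (fun v => (hx j v).1, fun v => (hx j v).2).
have [f1 f2 f3 _ _] := hf j; rewrite /lb mulmxBr !mulmxA.
split=> vj.
- by apply: memvB; [apply: stV => //; exact: f1|apply: f1; exact: stA].
- by apply: memvB; [apply: stA => //; exact: f2|apply: f2; exact: stM].
have -> : v *m f *m x - v *m x *m f = (v *m x - v *m x *m f) - (v - v *m f) *m x.
  by rewrite mulmxBl opprB [RHS]addrC addrA subrK.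
by apply: memvB; [apply: f3; exact: stV|apply: stM => //; exact: f3].
Qed.

(** Lowering by i pieces inside each interval; truncated subtraction stops at A j, so i = 3 means
    mapping A j.+1 into A j. *)
Definition PFil i (T : 'M[F]_N.+1) :=
  forall j r v, (r <= 3)%N -> v \in lev j r -> v *m T \in lev j (r - i)%N.

Lemma lclosed_PFil i : lclosed (PFil i).
Proof.
split=> [j r v _ _|c x y hx hy j r v r3 vj]; first by rewrite mulmx0 mem0v.
by rewrite mulmxDr -scalemxAr; apply: memvPa; [exact: hx|exact: hy].
Qed.

Definition Fl i := vsp (PFil i).
Lemma FlP i x : x \in Fl i <-> PFil i x. Proof. exact: vspP (lclosed_PFil i) x. Qed.

Lemma Fl_k1 x : x \in k1 -> x \in Fl 0%N.
Proof. by move=> xk; apply/FlP => j r v _ vj; rewrite subn0; apply: st_lev => //; exact: (subvP k1H). Qed.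

Lemma Fl_nn x : x \in nn -> x \in Fl 1%N.
Proof.
move=> xn; have /strict_partP [xk _] := xn; apply/FlP => j [|r] v r3 vj.
  by apply: st_lev => //; exact: (subvP k1H).
by rewrite subSS subn0; exact: nn_lev.
Qed.

(** The reductive part comes from [levi_mostow] for [k1]. It acts through an [e] commuting with it,
    [hs] acts through [f]; comparing the two gives the intertwiner handed to [conj_into]. *)
Lemma cover_steps : exists l t, [/\ Red l t, (l <= H)%VS, (t <= H)%VS &
  forall X, X \in hs -> exists rho, rho \in (l + t)%VS /\
    forall j v, v \in A j.+1 -> v *m (X - rho) \in A j].
Proof.
have Fl0 : fl 0 = 0%VS by rewrite /fl /= A0.
have [l [t [R lk tk kl _]]] := levi_mostow HF hH k1H k1_ideal k1_splits Fl0 fl_end fl_le fl_stab fl_simple.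
have ltk : (l + t <= k1)%VS by rewrite subv_add lk.
have ltH := subv_trans ltk k1H.
have nnH : (nn <= H)%VS by apply/subvP => x /strict_partP [xk _]; exact: (subvP k1H).
have [f hf] := fcond_ex.
have [|||e [/(vspP lclosed_Pdef) fe ce]] := @equivariant_fix _ HF _ l t (vsp Pdef) R _ _ f.
- by move=> x y xl /(vspP lclosed_Pdef) h; apply/(vspP lclosed_Pdef)/Pdef_stable => //; apply: (subvP ltH); exact: (subvP (addvSl _ _)).
- by move=> x y xl /(vspP lclosed_Pdef) h; apply/(vspP lclosed_Pdef)/Pdef_stable => //; apply: (subvP ltH); exact: (subvP (addvSr _ _)).
- by move=> x xl; apply/(vspP lclosed_Pdef)/fcond_lb => //; exact: (subvP ltk).
have eV j v : v \in A j.+1 -> v *m e \in V j.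
  move=> vA; have -> : v *m e = v *m f - v *m (f - e) by rewrite mulmxBr subKr.
  by have [f1 _ _ _ _] := hf j; have [h _ _] := fe j v; apply: memvB; auto.
have eM j v : v \in M j -> v *m e \in A j.
  move=> vA; have -> : v *m e = v *m f - v *m (f - e) by rewrite mulmxBr subKr.
  by have [_ f1 _ _ _] := hf j; have [_ h _] := fe j v; apply: memvB; auto.
have e1 j v : v \in V j -> v - v *m e \in M j.
  move=> vA; have -> : v - v *m e = (v - v *m f) + v *m (f - e) by rewrite mulmxBr addrA subrK.
  by have [_ _ f1 _ _] := hf j; have [_ _ h] := fe j v; apply: memvD; auto.
pose O x := forall j v, v \in A j.+1 -> v *m x \in A j.
have cO : lclosed (fun x => O (x *m (1%:M - e))).
  split=> [j v _|c x y hx hy j v vA]; first by rewrite mul0mx mulmx0 mem0v.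
  by rewrite mulmxDl -scalemxAl mulmxDr -scalemxAr; apply: memvPa; [exact: hx|exact: hy].
have ce' x : x \in (l + t)%VS -> e *m x = x *m e.
  by move=> /ce /eqP; rewrite subr_eq0 => /eqP.
(* x sends A j.+1 to V j, 1 - e sends V j to M j, and y sends M j to A j. *)
have O2 x y : x \in (l + t)%VS -> y \in (l + t)%VS -> O (x *m y *m (1%:M - e)).
  move=> xl yl j v vA; have -> : v *m (x *m y *m (1%:M - e)) = (v *m x - v *m x *m e) *m y.
    by rewrite mulmxBr mulmx1 -[x *m y *m e]mulmxA -ce' // mulmxBr mulmxBl !mulmxA.
  have /k1P [_ h] := subvP ltk _ yl; apply (h j _).2; apply: e1.
  by have /k1P [_ h'] := subvP ltk _ xl; apply (h' j v).1.
(* Products suffice: elements of l are sums of brackets, and a diagonalizable b equals b b G. *)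
have Or x : x \in (l + t)%VS -> O (x *m (1%:M - e)).
  have [hl sl _ _ tdg] := R.
  move=> /memv_addP [a al [b bt ->]]; rewrite -[a]scale1r; apply cO.2.
    have {al} : a \in br l l by apply: (subvP (semisP sl (subvv _) _)).
    apply: br_ind cO _ _ => x' y' xl yl; rewrite /lb mulmxBl => j v vA.
    have sl' := subvP (addvSl l t); rewrite mulmxBr.
    by apply: memvB; apply: O2 vA; exact: sl'.
  have [G [cG bG sG]] := dg_regular (tdg b bt).
  have bl : b \in (l + t)%VS by apply: (subvP (addvSr _ _)).
  have -> : b *m (1%:M - e) = b *m b *m (1%:M - e) *m G.
    have eG : (1%:M - e) *m G = G *m (1%:M - e).
      by rewrite mulmxBl mulmxBr mul1mx mulmx1 cG // ce'.
    by rewrite -mulmxA eG mulmxA -bG.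
  move=> j v vA; rewrite mulmxA; apply: sG; last exact: O2.
  by move=> w; apply: stA; exact: (subvP ltH).
have fA j v : v \in A j -> v *m f \in A j.
  case: j => [|j vj]; first by rewrite A0 memv0 => /eqP ->; rewrite mul0mx mem0v.
  by have [h _ _ _ _] := hf j; apply: (subvP (VA j)); exact: h.
have AV j : (A j <= V j)%VS by apply: subv_trans (AM j) (MV j).
have MA j : (M j <= A j.+1)%VS by apply: subv_trans (MV j) (VA j).
have eA j v : v \in A j.+1 -> v *m e \in A j.+1 by move=> /eV; apply: (subvP (VA j)).
(* The standard element conjugating one idempotent into a nearby one. *)
pose u := e *m f + (1%:M - e) *m (1%:M - f).
have u1E v : v *m (u - 1%:M) = - (v *m e - v *m e *m f) - (v - v *m e) *m f.
  have -> : u - 1%:M = - (e - e *m f) - (1%:M - e) *m f by rewrite /u; mxnc.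
  by rewrite mulmxBr mulmxN mulmxBr !mulmxA mulmxBr mulmx1.
have u1 : u - 1%:M \in Fl 1%N.
  apply/FlP => j [|[|[|[|r]]]] // v _ /= vj; rewrite ?subSS ?subn0 /=.
  - have h := eM j v (subvP (AM j) _ vj).
    rewrite u1E; apply: memvB; first by rewrite memvN memvB // fA.
    by apply: fA; exact: memvB.
  - rewrite u1E.
    have h := eM j v vj; have [_ h2 _ _ _] := hf j.
    apply: memvB; first by rewrite memvN memvB // fA.
    by apply: h2; apply: memvB => //; exact: (subvP (AM j)).
  - rewrite u1E.
    have [_ h2 h3 _ _] := hf j; have vA := subvP (VA j) _ vj.
    apply: memvB; first by rewrite memvN; apply: h3; exact: eV.
    by apply: (subvP (AM j)); apply: h2; exact: e1.
  rewrite u1E.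
  have [h1 _ h3 _ _] := hf j.
  apply: memvB; first by rewrite memvN; apply: (subvP (MV j)); apply: h3; exact: eV.
  by apply: h1; apply: memvB => //; exact: eA.
pose h X rho := [/\ X \in hs, rho \in (l + t)%VS & X - rho \in nn].
(* Into A j, replacing X by X f or f X on A j.+1 costs nothing, nor does replacing rho by rho e.
   What is left is e (X - rho) f, where X - rho lowers V j to M j and f lowers M j to A j. *)
have uX X rho : h X rho -> u *m X - rho *m u \in Fl 3%N.
  move=> [Xh rl Xn]; apply/FlP => j r v r3 vj.
  have -> : (r - 3 = 0)%N by apply/eqP; rewrite subn_eq0.
  have {vj} vj : v \in A j.+1 by apply: (subvP (lev_top j r)).
  have XA i w : w \in A i -> w *m X \in A i by apply: stA; exact: (subvP hsH).
  have fX w : w \in A j.+1 -> (w - w *m f) *m X \in A j.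
    move=> wA; have [_ _ _ _ h5] := hf j; have /memv_addP [a aA [b bW ->]] := h5 w wA.
    by rewrite mulmxDl (hsW Xh bW) addr0; exact: XA.
  have -> : v *m (u *m X - rho *m u) = ((v - v *m e) - (v - v *m e) *m f) *m X
     - (v *m e - v *m e *m f) *m X + (v *m e *m X - v *m e *m X *m f)
     + v *m e *m (X - rho) *m f - (v *m (rho *m (1%:M - e)) - v *m (rho *m (1%:M - e)) *m f)
     + v *m (lb e rho) *m f.
    have : u *m X - rho *m u = (1%:M - e) *m (1%:M - f) *m X - e *m (1%:M - f) *m X
       + e *m X *m (1%:M - f) + e *m (X - rho) *m f - rho *m (1%:M - e) *m (1%:M - f) + lb e rho *m f.
      by rewrite /u /lb; mxnc.
    by move=> ->; move: (lb e rho) => y; rewrite !(mulmxBr v, mulmxDr v) !mulmxA !mulmxBr !mulmx1.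
  rewrite ce // mulmx0 mul0mx addr0 /=; have ve := eA j v vj.
  have [_ h2 _ h4 _] := hf j.
  apply: memvB; last by apply: memvB; [|apply: fA]; exact: Or.
  apply: memvD; last by apply: h2; apply: (@nn_lev _ j 1) => //; exact: eV.
  apply: memvD; last by apply: h4; [exact: XA|exact: hsU].
  by apply: memvB; apply: fX => //; exact: memvB.
have ltFl : (l + t <= Fl 0%N)%VS by apply/subvP => x xl; apply: Fl_k1; exact: (subvP ltk).
have nFl : (nn <= Fl 1%N)%VS by apply/subvP => x; exact: Fl_nn.
have ln x y : x \in (l + t)%VS -> y \in nn -> lb x y \in nn.
  by move=> xl; apply: nn_ideal; exact: (subvP ltH).
have nnl x y : x \in nn -> y \in nn -> lb x y \in nn.
  by move=> xn; apply: nn_ideal; exact: (subvP nnH).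
have FS i : (Fl i.+1 <= Fl i)%VS.
  apply/subvP => x /FlP h'; apply/FlP => j r v r3 vj.
  by apply: (subvP (lev_mono j (leq_sub2l r (leqnSn i)))); exact: h'.
have FlM i j x y : x \in Fl i -> y \in Fl j -> x *m y \in Fl (i + j)%N.
  move=> /FlP hx /FlP hy; apply/FlP => k r v r3 vk; rewrite mulmxA subnDA.
  by apply: hy; [exact: leq_trans (leq_subr _ _) r3|exact: hx].
have F1 : 1%:M \in Fl 0%N by apply/FlP => j r v _ vj; rewrite subn0 mulmx1.
have [|g [g' [gg _ _ gY gX]]] := conj_into HF R F1 FS FlM ltFl nFl ln nnl nn_nilm u1 (h := h) (m := 3).
  by move=> X rho hX; case: (hX) => _ rl Xn; split=> //; exact: uX.
have cH (s : {vspace 'M[F]_N.+1}) : (s <= l + t)%VS -> (linimg (cj g g') s <= H)%VS.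
  move=> sl; apply/subvP => _ /linimgP [x xs ->]; have xl := subvP sl _ xs.
  rewrite -[X in X \in _](subrK x); apply: memvD; last exact: (subvP ltH).
  by apply: (subvP nnH); apply: gY; apply: (subvP (addvSl _ _)).
exists (linimg (cj g g') l), (linimg (cj g g') t); split.
- exact: Red_cj.
- by apply: cH; exact: addvSl.
- by apply: cH; exact: addvSr.
move=> X Xh; have /memv_addP [rho rl [z zn XE]] := subvP kl _ (subvP hs_k1 _ Xh).
exists (cj g g' rho); split.
  case/memv_addP: rl => a al [b bt ->]; rewrite linearD.
  by apply: memv_add; exact: mem_linimg.
have /FlP hx : X - g' *m rho *m g \in Fl 3%N.
  by apply: gX; split=> //; rewrite XE addrAC subrr add0r.
by move=> j v vj; exact: (hx j 3 v).
Qed.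
End WithSteps.

Lemma reductive_cover : exists l t, [/\ Red l t, (l <= H)%VS, (t <= H)%VS &
  forall X, X \in hs -> exists rho, rho \in (l + t)%VS /\
    forall j v, v \in A j.+1 -> v *m (X - rho) \in A j].
Proof.
have /boolp.choice [MV h] := jump_step.
apply: (@cover_steps (fun j => (MV j).1) (fun j => (MV j).2)) => j; have [[h1 h2 h3] h4 h5 h6 h7] := h j => //.
- by move=> x /h4 [].
- by move=> x /h4 [].
Qed.
End Cover.

(** * Nesting two reductive subalgebras *)

Lemma dg_block (F : closedFieldType) n (A B : 'M[F]_n) : dg A -> dg B -> dg (block_mx A 0 0 B).
Proof.
move=> [P [a [Pu PA]]] [Q [b [Qu QB]]].
exists (block_mx P 0 0 Q), (row_mx a b); split.
  by rewrite unitmxE det_ublock unitrM -!unitmxE Pu.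
by rewrite diag_mx_row !mulmx_block !(mulmx0, mul0mx, addr0, add0r) PA QB.
Qed.

Lemma lclosed_strict (F : closedFieldType) n (G : nat -> {vspace 'rV[F]_n}) :
  lclosed (fun x : 'M[F]_n => strict G x).
Proof.
by apply: lclosed_all => b; apply: lclosed_all => v; apply: lclosed_imp; exact: lclosed_mul.
Qed.

Lemma strict_lb (F : closedFieldType) n (G : nat -> {vspace 'rV[F]_n}) (x y : 'M[F]_n) : (forall b, stab (G b) x) -> strict G y -> strict G (lb x y).
Proof.
move=> xG sy b v vb; rewrite /lb mulmxBr !mulmxA memvB //; first by apply: sy; exact: xG.
by apply: xG; exact: sy.
Qed.

Section Nest.
Variables (F : closedFieldType) (HF : [pchar F] =i pred0) (N : nat).
Variables (l t l0 t0 a : {vspace 'M[F]_N.+1}) (G : nat -> {vspace 'rV[F]_N.+1}) (q : nat).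
Hypotheses (R : Red l t) (R0 : Red l0 t0) (G0 : G 0%N = 0%VS) (Gq : G q = fullv).
Hypotheses (Gle : forall b, (G b <= G b.+1)%VS).
Hypothesis stG : forall b x, x \in (l + t)%VS -> stab (G b) x.
Hypothesis sa : forall y, y \in a -> strict G y.
Hypothesis ra : forall x y, x \in (l + t)%VS -> y \in a -> lb x y \in a.
Hypothesis aa : forall x y, x \in a -> y \in a -> lb x y \in a.
Hypothesis r0 : (l0 + t0 <= l + t + a)%VS.

Let G_le i j : (i <= j)%N -> (G i <= G j)%VS.
Proof.
move=> /subnK <-; elim: (j - i)%N => [|k IH]; first exact: subvv.
by rewrite addSn; exact: subv_trans IH (Gle _).
Qed.

Let Gfull b : (q <= b)%N -> G b = fullv.
Proof. by move=> qb; apply/eqP; rewrite eqEsubv subvf -Gq G_le. Qed.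

(** [d] acts on the b-th step of the flag as the scalar b; in characteristic 0 this separates the
    steps. *)
Definition grading (d : 'M[F]_N.+1) := forall b v, v \in G b.+1 -> v *m d - b%:R *: v \in G b.

Lemma grading_ex : exists d, grading d.
Proof.
pose pr b := lin1_mx (projv (G b)).
have prG b v : v *m pr b \in G b by rewrite mul_rV_lin1 memv_proj.
have prI b v : v \in G b -> v *m pr b = v by move=> vb; rewrite mul_rV_lin1 /= projv_id.
exists (\sum_(b < q) (b%:R : F) *: (pr b.+1 - pr b)) => b v vb.
case: (leqP q b) => qb; first by rewrite (Gfull qb) memvf.
rewrite mulmx_sumr (bigD1 (Ordinal qb)) //= -scalemxAr mulmxBr (prI b.+1) // addrAC.
rewrite -scalerBr addrAC subrr sub0r memvD ?memvZ ?memvN //.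
apply: memv_suml => i ib; rewrite -scalemxAr mulmxBr memvZ //.
case: (ltngtP i b) => ib'.
- by apply: memvB; [apply: (subvP (G_le ib'))|apply: (subvP (G_le (ltnW ib')))].
- rewrite !prI ?subrr ?mem0v //; first by apply: (subvP (G_le ib')).
  by apply: (subvP (G_le _) _ vb); exact: leqW.
- by case/eqP: ib; apply: val_inj.
Qed.

(* T raises the degree by a positive amount for the grading defined by d, yet
   commutes with d *)
Lemma graded_zero d T : grading d -> d *m T = T *m d -> strict G T -> T = 0.
Proof.
move=> gd dT sT; apply: row_mem0 => v.
suff h k b w : (0 < k)%N -> w \in G (b + k)%N -> w *m T \in G b.
  have : v *m T \in G 0%N by apply: (h q.+1) => //; rewrite Gfull ?memvf.
  by rewrite G0 memv0 => /eqP.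
elim: k b w => // k IH b w _; case: k IH => [|k] IH wb.
  by move: wb; rewrite (addnC b) => wb; apply: sT.
have wT : w *m T \in G b.+1 by apply: IH => //; rewrite addSnnS.
have e : w *m T *m d = (b + k.+1)%:R *: (w *m T) + (w *m d - (b + k.+1)%:R *: w) *m T.
  by rewrite mulmxBl -scalemxAl subrKC -!mulmxA dT.
have h1 : (w *m d - (b + k.+1)%:R *: w) *m T \in G b.
  by apply: IH => //; apply: gd; move: wb; rewrite addnS.
have h2 := gd b _ wT.
have : (k.+1%:R : F) *: (w *m T) \in G b.
  have -> : (k.+1%:R : F) *: (w *m T) = (w *m T *m d - b%:R *: (w *m T))
      - (w *m d - (b + k.+1)%:R *: w) *m T.
    rewrite e; move: (_ *m T) => W1; move: (w *m T) => Z.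
    by rewrite natrD scalerDl addrAC addrK addrAC subrr add0r.
  exact: memvB.
by move=> /(memvZ k.+1%:R^-1); rewrite scalerA mulVf ?scale1r // natr0.
Qed.

(** Any grading commutes with l + t up to strict matrices, a stable space, so it can be corrected by
    [equivariant_fix]. *)
Lemma grading_comm : exists d, grading d /\ forall x, x \in (l + t)%VS -> d *m x = x *m d.
Proof.
have ll x : x \in l -> x \in (l + t)%VS by apply: (subvP (addvSl _ _)).
have tl x : x \in t -> x \in (l + t)%VS by apply: (subvP (addvSr _ _)).
have [d0 gd0] := grading_ex.
have cS := lclosed_strict G.
have Sst x y : x \in (l + t)%VS -> y \in vsp (fun x => strict G x) -> lb y x \in vsp (fun x => strict G x).
  move=> xl /(vspP cS) ys; apply/(vspP cS) => b v vb.
  by rewrite lbN mulmxN memvN; apply: (strict_lb (x := x) _ ys vb) => c; exact: stG.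
have [|||d [/(vspP cS) dd0 cd]] := @equivariant_fix _ HF _ l t (vsp (fun x => strict G x)) R _ _ d0.
- by move=> x y /ll; exact: Sst.
- by move=> x y /tl; exact: Sst.
- move=> x xl; apply/(vspP cS) => b v vb; rewrite /lb mulmxBr !mulmxA.
  have -> : v *m d0 *m x - v *m x *m d0 = (v *m d0 - b%:R *: v) *m x - (v *m x *m d0 - b%:R *: (v *m x)).
    by rewrite mulmxBl -scalemxAl opprB addrA subrK.
  by apply: memvB; [apply: (stG xl); exact: gd0|apply: gd0; exact: (stG xl)].
exists d; split; last by move=> x /cd /eqP; rewrite subr_eq0 => /eqP.
move=> b v vb; have -> : v *m d - b%:R *: v = (v *m d0 - b%:R *: v) - v *m (d0 - d).
  by rewrite mulmxBr opprB [RHS]addrC addrA subrK.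
by apply: memvB; [exact: gd0|exact: dd0].
Qed.

Lemma red_strict0 x : x \in (l + t)%VS -> strict G x -> x = 0.
Proof. by have [d [gd cd]] := grading_comm => xl; apply: (graded_zero gd); exact: cd. Qed.

(** The projection pi to l + t along a is a second representation of l0 + t0, equal to the inclusion
    up to strict matrices. Complete reducibility gives a unipotent intertwiner between the two,
    which [conj_into] turns into conjugation within a. *)
Lemma nest : exists g g', [/\ g *m g' = 1%:M,
  forall Y, Y \in (l + t + a)%VS -> g' *m Y *m g - Y \in a &
  forall X, X \in (l0 + t0)%VS -> exists2 rho, rho \in (l + t)%VS & X = g' *m rho *m g].
Proof.
have ll x : x \in l -> x \in (l + t)%VS by apply: (subvP (addvSl _ _)).
have tl x : x \in t -> x \in (l + t)%VS by apply: (subvP (addvSr _ _)).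
have rr x y : x \in (l + t)%VS -> y \in (l + t)%VS -> lb x y \in (l + t)%VS.
  by move=> xl yl; apply: ll; exact: Red_lie R xl yl.
have aS b x : x \in a -> stab (G b) x.
  move=> xa v vb; case: b vb => [|b] vb.
    by rewrite G0 memv0 in vb; rewrite (eqP vb) mul0mx mem0v.
  by apply: (subvP (Gle b)); exact: sa.
have cS := lclosed_strict G.
have [d [gd cd']] := grading_comm.
have rcap : ((l + t) :&: a)%VS = 0%VS.
  apply/eqP; rewrite -subv0; apply/subvP => x; rewrite memv_cap memv0 => /andP [xl xa].
  by apply/eqP/red_strict0 => //; exact: sa.
pose pi := daddv_pi (l + t)%VS a.
have pir x : pi x \in (l + t)%VS by exact: memv_pi.
have pia x : x \in (l + t + a)%VS -> x - pi x \in a.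
  by move=> xr; rewrite -{1}(daddv_pi_add rcap xr) addrAC subrr add0r memv_pi.
have piE x y : x \in (l + t)%VS -> y \in a -> pi (x + y) = x.
  move=> xl ya; apply/eqP; rewrite -subr_eq0; apply/eqP.
  have xr : x + y \in (l + t + a)%VS by exact: memv_add.
  apply: red_strict0; first exact: memvB.
  apply: sa; have -> : pi (x + y) - x = y - (x + y - pi (x + y)).
    by rewrite opprB opprD addrCA; congr (_ + _); rewrite addrCA subrr addr0.
  by apply: memvB => //; exact: pia.
have pilb x y : x \in (l + t + a)%VS -> y \in (l + t + a)%VS -> pi (lb x y) = lb (pi x) (pi y).
  move=> xr yr; have xa := pia x xr; have ya := pia y yr.
  rewrite -{1}(subrKC (pi x) x) -{1}(subrKC (pi y) y).
  move: (x - _) (y - _) (pir x) (pir y) xa ya => {xr yr} u w.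
  move: (pi x) (pi y) => x1 y1 xl yl ua wa.
  rewrite lbDl !lbDr -addrA piE ?rr //.
  by apply: memvD; [exact: ra|apply: memvD; [rewrite lbN memvN ra|exact: aa]].
have sX x : x \in (l + t + a)%VS -> forall b, stab (G b) x.
  move=> /memv_addP [u ul [w wa ->]] b v vb; rewrite mulmxDr.
  by apply: memvD; [exact: (stG ul)|exact: (aS _ _ wa)].
have hdiff x p : x \in (l + t + a)%VS -> strict G (horner_mx x p - horner_mx (pi x) p).
  move=> xr; elim/poly_ind: p => [|p c IH] b v vb; first by rewrite !rmorph0 subrr mulmx0 mem0v.
  rewrite !rmorphD !rmorphM /= !horner_mx_X !horner_mx_C opprD addrACA subrr addr0 -!mulmxE.
  have -> : v *m (horner_mx x p *m x - horner_mx (pi x) p *m pi x) =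
    v *m (horner_mx x p - horner_mx (pi x) p) *m x + v *m horner_mx (pi x) p *m (x - pi x).
    by rewrite !(mulmxBr, mulmxBl, mulmxA) addrA subrK.
  apply: memvD; first by apply: sX => //; exact: IH.
  by apply: (sa (pia x xr)); apply: stab_horner => // w; exact: stG.
(* A polynomial killing x is strict at pi x and commutes with the grading, so it kills pi x. *)
have pidg x : x \in (l + t + a)%VS -> dg x -> dg (pi x).
  move=> xr /dg_poly [s us hs]; apply/dg_poly; exists s => //.
  move: hs; set p := \prod_(c <- s) _ => hs.
  apply: (graded_zero gd); first by apply: comm_mx_horner; exact: cd'.
  by move=> b v vb; rewrite -memvN -mulmxN -[- _]add0r -hs; exact: hdiff.
have plin : linear (fun x => block_mx (pi x) 0 0 x : 'M[F]_(N.+1 + N.+1)).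
  by move=> c x y; rewrite linearP scale_block_mx add_block_mx !scaler0 !addr0.
have [phi phiE] := linear_ex plin.
have r0r x : x \in (l0 + t0)%VS -> x \in (l + t + a)%VS by apply: subvP.
have t0r x : x \in t0 -> x \in (l0 + t0)%VS by apply: (subvP (addvSr _ _)).
have Rphi : Red (linimg phi l0) (linimg phi t0).
  apply: (Red_img _ _ R0) => [x y x0 y0|x x0]; last first.
    rewrite phiE; apply: dg_block; last by case: R0 => _ _ _ _; apply.
    by apply: pidg; [exact/r0r/t0r|case: R0 => _ _ _ _; apply].
  by rewrite !phiE /lb !mulmx_block !(mulmx0, mul0mx, addr0, add0r) opp_block_mx add_block_mx !oppr0 !addr0 pilb ?r0r.
(* Intertwiners from one representation to the other are the off-diagonal blocks commuting with phi;
   the identity block commutes up to strict blocks, and correcting it gives u = 1 - B. *)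
pose ob (T : 'M[F]_N.+1) : 'M[F]_(N.+1 + N.+1) := block_mx 0 T 0 0.
pose Q (T : 'M[F]_(N.+1 + N.+1)) := exists2 B, strict G B & T = ob B.
have cQ : lclosed Q.
  split=> [|c x y [B sB ->] [C sC ->]].
    by exists 0; [exact: cS.1|rewrite /ob block_mx0].
  exists (c *: B + C); first exact: cS.2.
  by rewrite /ob scale_block_mx add_block_mx !scaler0 !addr0.
have obl B x : lb (ob B) (phi x) = ob (B *m x - pi x *m B).
  by rewrite phiE /lb /ob !mulmx_block !(mulmx0, mul0mx, addr0, add0r) opp_block_mx add_block_mx !oppr0 !addr0.
have Qst x T : x \in (l0 + t0)%VS -> T \in vsp Q -> lb T (phi x) \in vsp Q.
  move=> /r0r xr /(vspP cQ) [B sB ->]; apply/(vspP cQ); rewrite obl.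
  exists (B *m x - pi x *m B) => // b v vb; rewrite mulmxBr !mulmxA.
  by apply: memvB; [apply: sX => //; exact: sB|apply: sB; exact: (stG (pir x))].
have [|||e [/(vspP cQ) [B sB eB] ce]] := @equivariant_fix _ HF _ _ _ (vsp Q) Rphi _ _ (ob 1%:M).
- by move=> _ y /linimgP [x xl ->]; apply: Qst; apply: (subvP (addvSl _ _)).
- by move=> _ y /linimgP [x xl ->]; apply: Qst; apply: (subvP (addvSr _ _)).
- move=> _ /memv_addP [_ /linimgP [x xl ->] [_ /linimgP [y yl ->] ->]].
  rewrite -linearD /= obl mul1mx mulmx1; apply/(vspP cQ); eexists; last by [].
  apply: sa; apply: pia; apply: r0r; exact: memv_add.
have eE : e = ob (1%:M - B).
  rewrite -[e](subKr (ob 1%:M)) eB /ob opp_block_mx add_block_mx.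
  by rewrite !oppr0 !addr0.
pose u := 1%:M - B.
have uE x : x \in (l0 + t0)%VS -> u *m x - pi x *m u = 0.
  move=> /memv_addP [x1 x1l [x2 x2t ->]].
  have : lb e (phi (x1 + x2)) = 0.
    by apply: ce; rewrite linearD; apply: memv_add; exact: mem_linimg.
  by rewrite eE obl /ob => /(congr1 (@ursubmx _ _ _ _ _)); rewrite block_mxKur => ->; rewrite -(block_mx0 F N.+1 N.+1 N.+1 N.+1) block_mxKur.
pose PF i (T : 'M[F]_N.+1) := forall b v, v \in G b -> v *m T \in G (b - i)%N.
have cPF i : lclosed (PF i).
  split=> [b v _|c x y hx hy b v vb]; first by rewrite mulmx0 mem0v.
  by rewrite mulmxDr -scalemxAr; apply: memvPa; auto.
pose Fil i := vsp (PF i).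
have FilP i x : x \in Fil i <-> PF i x by exact: (vspP (cPF i)).
have sF x : strict G x -> x \in Fil 1%N.
  move=> sx; apply/FilP => [[|b]] v vb; last by rewrite subn1; exact: sx.
  by rewrite sub0n; move: vb; rewrite G0 memv0 => /eqP ->; rewrite mul0mx mem0v.
pose h X rho := X \in (l0 + t0)%VS /\ rho = pi X.
have [||||||||g [g' [gg _ _ gY gX]]] := @conj_into _ HF _ l t a Fil q R _ _ _ _ _ ra aa _ h u _ _.
- by apply/FilP => b v vb; rewrite mulmx1 subn0.
- by move=> i; apply/subvP => x /FilP hx; apply/FilP => b v /hx; apply: (subvP (G_le _)); exact: leq_sub2l.
- by move=> i j x y /FilP hx /FilP hy; apply/FilP => b v vb; rewrite mulmxA subnDA; apply: hy; exact: hx.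
- by apply/subvP => x xl; apply/FilP => b v vb; rewrite subn0; exact: (stG xl).
- by apply/subvP => x /sa; exact: sF.
- by move=> x /sa; exact: (strict_nilm G0 Gq).
- by rewrite /u addrAC subrr add0r memvN; exact: sF.
- by move=> X _ [X0 ->]; rewrite uE // mem0v; split=> //; exact/pia/r0r.
exists g, g'; split=> // X X0; exists (pi X) => //.
apply/eqP; rewrite -subr_eq0; apply/eqP/row_mem0 => v.
have /FilP hX := gX X (pi X) (conj X0 (erefl _)).
by have := hX q v; rewrite subnn Gq G0 memvf memv0 => /(_ isT) /eqP.
Qed.
End Nest.

(** * The linear nilradical of a matrix Lie algebra *)
Section Nilradical.
Variables (F : closedFieldType) (HF : [pchar F] =i pred0) (n : nat).

(** In the filtration given by Engel's theorem, the k-th derived algebra lowers by k + 1. *)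
Lemma nil_der (J : {vspace 'M[F]_n}) : lie J -> (forall x, x \in J -> nilm x) ->
  exists k, der J k = 0%VS.
Proof.
move=> hJ nJ; have [m Jm] := engel hJ nJ; exists m.
have h k x : x \in der J k -> forall a v, v \in rpow J a -> v *m x \in rpow J (a + k.+1).
  elim: k x => [|k IH] x /= xJ; first by move=> a v va; rewrite addn1; exact: rpow_step.
  move=> a v va; move: x xJ; apply: br_ind; first exact: lclosed_mul.
  have le : (a + k.+2 <= a + k.+1 + k.+1)%N by rewrite -addnA leq_add2l addSnnS leq_addl.
  move=> x y xD yD; rewrite /lb mulmxBr !mulmxA.
  by apply: memvB; apply: (subvP (rpow_le _ le)); [apply: (IH _ yD); exact: (IH _ xD)|apply: (IH _ xD); exact: (IH _ yD)].
apply/eqP; rewrite -subv0; apply/subvP => x xD; rewrite memv0; apply/eqP/row_mem0 => v.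
apply/eqP; rewrite -memv0 -Jm; apply: (subvP (rpow_le J (leqnSn m))).
by apply: (h m x xD 0%N); exact: memvf.
Qed.

Definition flag (H : {vspace 'M[F]_n}) := sval (cid (composition_flag H)).
Definition nrad (H : {vspace 'M[F]_n}) := vsp (fun x => x \in H /\ strict (flag H) x).

Variable H : {vspace 'M[F]_n}.
Hypothesis hH : lie H.

Lemma flagP : [/\ flag H 0%N = 0%VS, flag H n = fullv, forall a, (flag H a <= flag H a.+1)%VS,
     forall a x, x \in H -> stab (flag H a) x & forall a, simple_step H (flag H a) (flag H a.+1)].
Proof. by rewrite /flag; case: cid. Qed.

Lemma nradP x : x \in nrad H <-> x \in H /\ strict (flag H) x.
Proof.
apply: (vspP (P := fun x => x \in H /\ strict (flag H) x)).
by apply: lclosed_and; [exact: lclosed_vs|exact: lclosed_strict].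
Qed.

Lemma nrad_sub : (nrad H <= H)%VS. Proof. by apply/subvP => x /nradP []. Qed.

Lemma nrad_ideal : ideal_of H (nrad H).
Proof.
have [_ _ _ st _] := flagP; move=> x y xH /nradP [yH ys]; apply/nradP; split; first exact: hH.
by apply: strict_lb ys => b; exact: st.
Qed.

Lemma nrad_nilm x : x \in nrad H -> nilm x.
Proof. by have [F0 Fn _ _ _] := flagP => /nradP [_]; exact: (strict_nilm F0 Fn). Qed.

Lemma nrad_lie : lie (nrad H).
Proof. by move=> x y xn; apply: nrad_ideal; exact: (subvP nrad_sub). Qed.

(** Lie's theorem along the composition flag; with it the definition by a chosen flag captures the
    nilpotent elements of all solvable ideals. *)
Lemma nrad_max J k x : (J <= H)%VS -> ideal_of H J -> der J k = 0%VS -> x \in J -> nilm x ->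
  x \in nrad H.
Proof.
have [F0 Fn Fle st simp] := flagP => JH iJ dJ xJ xn; apply/nradP; split; first exact: (subvP JH).
move=> a v va; have LA := st a.+1; have LB := st a.
by apply: (solvable_ideal_simple HF hH (Fle a) LA LB (simp a) JH iJ dJ xJ) => //; left.
Qed.
End Nilradical.

(** * Matrices of finite rank endomorphisms *)
Section Levels.
Variables (F : closedFieldType) (V Vs : lmodType F) (pair : V -> Vs -> F).
Hypothesis Hbil : bilinear_pairing pair.
Variables (e : nat -> V) (f : nat -> Vs).
Hypothesis e_free : forall (n : nat) (c : nat -> F),
  \sum_(i < n) c i *: e i = 0 -> forall i, (i < n)%N -> c i = 0.
Hypothesis e_span : forall v : V, exists (n : nat) (c : nat -> F), v = \sum_(i < n) c i *: e i.
Hypothesis f_span : forall v : Vs, exists (n : nat) (c : nat -> F), v = \sum_(i < n) c i *: f i.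

Definition emb n (c : 'rV[F]_n) : V := \sum_(i < n) c 0 i *: e i.
Fact emb_linear n : linear (@emb n).
Proof.
move=> a x y; rewrite /emb scaler_sumr -big_split /=; apply: eq_bigr => i _.
by rewrite !mxE scalerDl scalerA.
Qed.
HB.instance Definition _ n := GRing.isLinear.Build F _ _ _ (@emb n) (@emb_linear n).

Lemma emb_inj0 n (c : 'rV[F]_n) : emb c = 0 -> c = 0.
Proof.
move=> h; apply/rowP => i; rewrite mxE.
pose c' k := if insub k is Some j then c 0 j else 0.
have := @e_free n c' _ i (ltn_ord i); rewrite /c' valK => -> //.
by rewrite -[RHS]h; apply: eq_bigr => j _; rewrite valK.
Qed.

Lemma emb_inj n : injective (@emb n).
Proof. by move=> c d /eqP; rewrite -subr_eq0 -linearB => /eqP /emb_inj0 /eqP; rewrite subr_eq0 => /eqP. Qed.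

Definition inc m n : 'M[F]_(m, n) := \matrix_(i, j) (i == j :> nat)%:R.

Lemma emb_inc m n (c : 'rV[F]_m) : (m <= n)%N -> emb (c *m inc m n) = emb c.
Proof.
move=> mn; rewrite /emb; under eq_bigr do rewrite mxE scaler_suml.
rewrite exchange_big; apply: eq_bigr => i _; pose i' := Ordinal (leq_trans (ltn_ord i) mn).
rewrite (bigD1 i') //= big1 ?addr0 => [|j ji]; first by rewrite mxE eqxx mulr1.
rewrite mxE; case: eqP => [ij|]; last by rewrite mulr0 scale0r.
by case/eqP: ji; apply: val_inj.
Qed.

Definition inU m v := exists c : 'rV[F]_m, v = emb c.

Lemma inU_le m n v : (m <= n)%N -> inU m v -> inU n v.
Proof. by move=> mn [c ->]; exists (c *m inc m n); rewrite emb_inc. Qed.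

Lemma inU_ex v : exists m, inU m v.
Proof.
have [m [c ->]] := e_span v; exists m, (\row_(i < m) c i).
by apply: eq_bigr => i _; rewrite mxE.
Qed.

Lemma inU_lin m a u v : inU m u -> inU m v -> inU m (a *: u + v).
Proof. by move=> [c ->] [d ->]; exists (a *: c + d); rewrite linearP. Qed.

Lemma inU0 m : inU m 0. Proof. by exists 0; rewrite linear0. Qed.

Definition evals m (v : V) : 'rV[F]_m := \row_i pair v (f i).
Fact evals_linear m : linear (@evals m).
Proof. by move=> a x y; apply/rowP => i; rewrite !mxE Hbil.1. Qed.
HB.instance Definition _ m := GRing.isLinear.Build F _ _ _ (@evals m) (@evals_linear m).

Lemma evals_le m n v : (m <= n)%N -> evals n v = 0 -> evals m v = 0.
Proof.
move=> mn h; apply/rowP => i; have /rowP/(_ (Ordinal (leq_trans (ltn_ord i) mn))) := h.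
by rewrite !mxE.
Qed.

(* Ensures that an endomorphism killing the kernel of evals m is determined by
   its restriction to the span of e_i, i < M. *)
Definition good m M := (m <= M)%N /\ forall v, exists c : 'rV[F]_M, evals m (v - emb c) = 0.

Lemma good_le m M M' : good m M -> (M <= M')%N -> good m M'.
Proof.
move=> [mM h] MM; split=> [|v]; first exact: leq_trans MM.
by have [c hc] := h v; exists (c *m inc M M'); rewrite emb_inc.
Qed.

Definition vsub (A : V -> Prop) := A 0 /\ forall a u v, A u -> A v -> A (a *: u + v).

Lemma vsubD A u v : vsub A -> A u -> A v -> A (u + v).
Proof. by move=> [_ h] Au Av; rewrite -[u]scale1r; exact: h. Qed.

(** The images under [evals m] of A intersected with growing spans increase inside F^m, hence
    stabilize. *)
Lemma good_sub m A : vsub A -> exists M0, forall M, (M0 <= M)%N -> forall v, A v ->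
  exists c : 'rV[F]_M, A (emb c) /\ evals m (v - emb c) = 0.
Proof.
move=> [A0 hA]; pose Q k (d : 'rV[F]_m) := exists c : 'rV[F]_k, A (emb c) /\ d = evals m (emb c).
pose W k := vsp (Q k).
have WP k d : d \in W k <-> Q k d.
  apply: (vspP (P := Q k)); split=> [|a x y [c [Ac ->]] [c' [Ac' ->]]].
    by exists 0; rewrite !linear0.
  by exists (a *: c + c'); rewrite !linearP; split=> //; exact: hA.
have [S [[k <-] mx]] : exists S, (exists k, W k = S) /\
    forall S', (exists k, W k = S') -> (\dim S' <= \dim S)%N.
  by apply: vs_max; exists (W 0%N), 0%N.
have W_le i j : (i <= j)%N -> (W i <= W j)%VS.
  by move=> ij; apply/subvP => d /WP [c hc]; apply/WP; exists (c *m inc i j); rewrite emb_inc.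
exists k => M kM v Av; have [n [c vE]] := inU_ex v.
have /WP [d [Ad hd]] : evals m v \in W k.
  have -> : W k = W (maxn k n) by apply: dim_eq_sub; [apply: W_le; exact: leq_maxl|apply: mx; exists (maxn k n)].
  by apply: (subvP (W_le _ _ (leq_maxr k n))); apply/WP; exists c; rewrite -vE.
by exists (d *m inc k M); rewrite emb_inc // linearB /= hd subrr.
Qed.

Lemma good_ex m : exists M, good m M.+1.
Proof.
have [|M0 h] := @good_sub m (fun _ => True); first by split.
exists (maxn M0 m); split=> [|v]; first by rewrite leqW ?leq_maxr.
by have [c [_ hc]] := h (maxn M0 m).+1 (leqW (leq_maxl _ _)) v I; exists c.
Qed.

Definition supported m (X : Endo V) := [/\ is_linear_map X, forall u, inU m (X u)
  & forall u, evals m u = 0 -> X u = 0].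

Lemma supported_le m n X : (m <= n)%N -> supported m X -> supported n X.
Proof. by move=> mn [h1 h2 h3]; split=> // [u|u /(evals_le mn)]; [apply: inU_le mn _|apply: h3]. Qed.

Lemma lin_comb (X : Endo V) : is_linear_map X -> exists Y : {linear V -> V}, X = Y.
Proof. by move=> /linear_ex [Y YX]; exists Y; apply/funext => u; rewrite YX. Qed.

Lemma supported_lin m X : supported m X -> is_linear_map X. Proof. by case. Qed.

Lemma pl0 m : supported m (@fzero F V).
Proof.
split=> // [a u v|u]; rewrite /fzero; first by rewrite scaler0 addr0.
exact: inU0.
Qed.

Lemma supported_comb m a X Y : supported m X -> supported m Y -> supported m (fadd (fscale a X) Y).
Proof.
rewrite /fadd /fscale; move=> [X1 X2 X3] [Y1 Y2 Y3]; split=> [b u v|u|u tu].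
- by rewrite X1 Y1 !scalerDr !scalerA [b * a]mulrC addrACA.
- exact: inU_lin.
- by rewrite X3 // Y3 // scaler0 addr0.
Qed.

Lemma supported_br m X Y : supported m X -> supported m Y -> supported m (fbr X Y).
Proof.
move=> [X1 X2 X3] [Y1 Y2 Y3].
rewrite /fbr; split=> [b u v|u|u tu].
- by rewrite Y1 !X1 Y1 opprD scalerDr scalerN addrACA.
- by rewrite addrC -scaleN1r; apply: inU_lin.
- by rewrite (X3 u tu) (Y3 u tu) X3 ?Y3 ?linear0 ?oppr0 ?addr0.
Qed.

Lemma supported_ex W : (exists (n : nat) (v : 'I_n -> V) (w : 'I_n -> Vs),
    W = fun u => \sum_(i < n) pair u (w i) *: v i) -> exists m, supported m W.
Proof.
move=> [n [v [w ->]]].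
have [m h] : exists m, forall i : 'I_n, inU m (v i) /\ forall u, evals m u = 0 -> pair u (w i) = 0.
  elim: n v w => [|n IH] v w; first by exists 0%N; case.
  have [m h] := IH (fun i => v (lift ord0 i)) (fun i => w (lift ord0 i)).
  have [m1 h1] := inU_ex (v ord0).
  have [m2 [c h2]] := f_span (w ord0).
  have pD u : pair u (w ord0) = \sum_(i < m2) c i * pair u (f i).
    have [g gE] : exists g : {linear Vs -> F^o}, g =1 pair u.
      by apply: (@linear_ex _ _ F^o (pair u)) => a x y; exact: Hbil.2.
    by rewrite -gE h2 linear_sum; apply: eq_bigr => i _; rewrite linearZ /= gE.
  exists (maxn m (maxn m1 m2)) => i; case: (unliftP ord0 i) => [j|] ->.
    have [a b] := h j; split; first by apply: inU_le a; exact: leq_maxl.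
    by move=> u; move/(evals_le (leq_maxl _ _)); exact: b.
  split; first by apply: inU_le h1; rewrite !leq_max leqnn orbT.
  move=> u /rowP hu; rewrite pD big1 // => k _.
  have km : (k < maxn m (maxn m1 m2))%N by apply: leq_trans (ltn_ord k) _; rewrite !leq_max leqnn !orbT.
  by have := hu (Ordinal km); rewrite !mxE /= => ->; rewrite mulr0.
exists m; split=> [a u u'|u|u tu].
- rewrite scaler_sumr -big_split; apply: eq_bigr => i _.
  by rewrite Hbil.1 scalerDl scalerA.
- elim/big_ind: _ => [|x y hx hy|i _]; first exact: inU0.
    by rewrite -[x]scale1r; exact: inU_lin.
  by rewrite -[X in inU _ X]addr0; apply: inU_lin; [exact: (h i).1|exact: inU0].
- by apply: big1 => i _; rewrite (h i).2 // scale0r.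
Qed.

(** * Endomorphisms as matrices in a finite window *)

Section Rep.
Variables (m K : nat).
Local Notation M := K.+1.
Hypothesis gd : good m M.

(** The window size [M] is kept apart from the level [m]: the span of the first m basis vectors need
    not detect maps factoring through [evals m], whereas a [good] window does. *)
Definition rep (X : Endo V) (x : 'M[F]_M) := supported m X /\ forall c, X (emb c) = emb (c *m x).

Lemma rep_ex X : supported m X -> exists x, rep X x.
Proof.
move=> pX; have [X1 X2 _] := pX; have [X' XE] := lin_comb X1.
have /choice [r hr] : forall i : 'I_M, exists c : 'rV[F]_M, X (e i) = emb c.
  by move=> i; exact: inU_le gd.1 (X2 _).
exists (\matrix_i r i); split=> // c.
rewrite {2}[c]row_sum_delta mulmx_suml linear_sum {1}/emb XE linear_sum.
by apply: eq_bigr => i _; rewrite -scalemxAl !linearZ /= -XE hr -rowE rowK.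
Qed.

Lemma rep_fun X x y : rep X x -> rep X y -> x = y.
Proof.
move=> [_ hx] [_ hy]; apply/row_matrixP => i; rewrite !rowE.
by apply: emb_inj; rewrite -hx hy.
Qed.

Lemma rep_inj X Y x : rep X x -> rep Y x -> X = Y.
Proof.
move=> [[X1 _ X3] hx] [[Y1 _ Y3] hy]; apply/funext => u.
have [X' XE] := lin_comb X1; have [Y' YE] := lin_comb Y1.
have [_ /(_ u) [c tc]] := gd.
have hX : X u = X (emb c) by apply/eqP; rewrite -subr_eq0 XE -linearB -XE X3.
have hY : Y u = Y (emb c) by apply/eqP; rewrite -subr_eq0 YE -linearB -YE Y3.
by rewrite hX hY hx hy.
Qed.

Lemma rep_kill X x c : rep X x -> evals m (emb c) = 0 -> c *m x = 0.
Proof. by move=> [[_ _ h] hx] tc; apply: emb_inj0; rewrite -hx h. Qed.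

Lemma rep_im X x c : rep X x -> inU m (emb (c *m x)).
Proof. by move=> [[_ h _] hx]; rewrite -hx. Qed.

Lemma rep_of (s : 'M[F]_M) : (forall c : 'rV_M, evals m (emb c) = 0 -> c *m s = 0) ->
  (forall c : 'rV_M, inU m (emb (c *m s))) -> exists S, rep S s.
Proof.
move=> s1 s2; have [_ /choice [r hr]] := gd; pose S u := emb (r u *m s).
have SE u c : evals m (u - emb c) = 0 -> S u = emb (c *m s).
  move=> tu; congr emb; apply/eqP; rewrite -subr_eq0 -mulmxBl; apply/eqP/s1.
  have -> : emb (r u - c) = (u - emb c) - (u - emb (r u)).
    by rewrite linearB opprB [RHS]addrC addrA subrK.
  by rewrite linearB /= tu hr subrr.
exists S; split=> [|c]; last by apply: SE; rewrite subrr linear0.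
split=> [a u v|u|u tu]; last by rewrite (SE u 0) ?(mul0mx, linear0, subr0).
  rewrite (SE _ (a *: r u + r v)); first by rewrite mulmxDl -scalemxAl linearP.
  have -> : a *: u + v - emb (a *: r u + r v) = a *: (u - emb (r u)) + (v - emb (r v)).
    by rewrite linearP opprD scalerBr addrACA.
  by rewrite linearP /= !hr scaler0 addr0.
exact: s2.
Qed.

Lemma rep0 : rep (@fzero F V) 0.
Proof. by split=> [|c]; [exact: pl0|rewrite mulmx0 linear0]. Qed.

Lemma rep_comb a X Y x y : rep X x -> rep Y y -> rep (fadd (fscale a X) Y) (a *: x + y).
Proof.
move=> [pX hx] [pY hy]; split=> [|c]; first exact: supported_comb.
by rewrite /fadd /fscale hx hy mulmxDr -scalemxAr linearP.
Qed.

(* The bracket is reversed because matrices act on row vectors on the right. *)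
Lemma rep_br X Y x y : rep X x -> rep Y y -> rep (fbr X Y) (lb y x).
Proof.
move=> [pX hx] [pY hy]; split=> [|c]; first exact: supported_br.
by rewrite /fbr hy hx hx hy -linearB /lb mulmxBr !mulmxA.
Qed.

Lemma rep_nilm X x : rep X x -> (nilpotent_end X <-> nilm x).
Proof.
move=> rX; have [[_ h _] hx] := rX.
have it k c : iter k X (emb c) = emb (c *m x ^+ k).
  elim: k => [|k IH]; first by rewrite expr0 mulmx1.
  by rewrite iterS IH hx exprSr -mulmxE mulmxA.
split=> [[n hn]|[k xk]].
  by exists n; apply: row_mem0 => c; apply: emb_inj0; rewrite -it.
exists k.+1 => u; have [c Xc] := inU_le gd.1 (h u).
by rewrite iterSr Xc it xk mulmx0 linear0.
Qed.

Lemma rep_semisimple X x : rep X x -> dg x -> semisimple_end X.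
Proof.
move=> rX [P [a [Pu PE]]] u; have [[X1 _ X3] hx] := rX.
have [_ /(_ u) [c tc]] := gd.
(* Index 0 carries u - emb c, which X kills; the others carry the eigenvectors in the window. *)
exists M.+1, (fun i => if unlift ord0 i is Some j then a 0 j else 0),
  (fun i => if unlift ord0 i is Some j then (c *m invmx P) 0 j *: emb (row j P) else u - emb c).
split=> [i|].
  case: (unlift ord0 i) => [j|]; last by rewrite scale0r X3.
  have [X' XE] := lin_comb X1; rewrite XE linearZ /= -XE hx -row_mul PE row_mul row_diag_mx -scalemxAl -rowE linearZ /=.
  by rewrite !scalerA mulrC.
rewrite big_ord_recl unlift_none; under eq_bigr do rewrite liftK.
have -> : \sum_(i < M) (c *m invmx P) 0 i *: emb (row i P) = emb (c *m invmx P *m P).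
  rewrite [in RHS]mulmx_sum_row linear_sum; apply: eq_bigr => i _.
  by rewrite linearZ.
by rewrite mulmxKV // subrK.
Qed.
End Rep.

Lemma subspace_comb (A : pset V) a X Y : subspace A -> A X -> A Y -> A (fadd (fscale a X) Y).
Proof. by move=> [_ [hD hZ]] AX AY; apply: hD => //; exact: hZ. Qed.

Lemma comb_subspace (A : pset V) : A (@fzero F V) ->
  (forall a X Y, A X -> A Y -> A (fadd (fscale a X) Y)) -> subspace A.
Proof.
move=> A0 h; split=> //; split=> [X Y AX AY|a X AX].
  have -> : fadd X Y = fadd (fscale 1 X) Y by apply/funext => u; rewrite /fadd /fscale scale1r.
  exact: h.
have -> : fscale a X = fadd (fscale a X) (@fzero F V) by apply/funext => u; rewrite /fadd /fzero addr0.
exact: h.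
Qed.

Section Mat.
Variables (m K : nat).
Local Notation M := K.+1.
Hypothesis gd : good m M.

Definition mat (A : pset V) : {vspace 'M[F]_M} := vsp (fun x => exists2 X, A X & rep m X x).
Definition of_mat (S : {vspace 'M[F]_M}) : pset V := fun X => exists2 x, x \in S & rep m X x.

Lemma matP A x : subspace A -> x \in mat A <-> exists2 X, A X & rep m X x.
Proof.
move=> sA; apply: (vspP (P := fun x => exists2 X, A X & rep m X x)).
split=> [|a y z [Y AY rY] [Z AZ rZ]]; first by exists (@fzero F V); [exact: sA.1|exact: rep0].
by exists (fadd (fscale a Y) Z); [exact: subspace_comb|exact: rep_comb].
Qed.

Lemma mem_mat A X x : subspace A -> A X -> rep m X x -> x \in mat A.
Proof. by move=> sA AX rX; apply/matP => //; exists X. Qed.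

Lemma mat_rep A X x : subspace A -> x \in mat A -> rep m X x -> A X.
Proof. by move=> sA /(matP _ sA) [Y AY rY] rX; rewrite (rep_inj gd rX rY). Qed.

Lemma matS (A B : pset V) : subspace A -> subspace B -> psubset A B -> (mat A <= mat B)%VS.
Proof.
move=> sA sB AB; apply/subvP => x /(matP _ sA) [X AX rX].
by apply/matP => //; exists X => //; exact: AB.
Qed.

Lemma of_mat_subspace S : subspace (of_mat S).
Proof.
apply: comb_subspace; first by exists 0; [exact: mem0v|exact: rep0].
by move=> a X Y [x xS rX] [y yS rY]; exists (a *: x + y); [exact: memvPa|exact: rep_comb].
Qed.

Lemma of_mat_lie S : lie S -> lie_subalg (of_mat S).
Proof.
move=> hS; split; first exact: of_mat_subspace.
by move=> X Y [x xS rX] [y yS rY]; exists (lb y x); [exact: hS|exact: rep_br].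
Qed.

Lemma lie_mat A : lie_subalg A -> lie (mat A).
Proof.
move=> [sA hA] x y /(matP _ sA) [X AX rX] /(matP _ sA) [Y AY rY].
by apply/(matP _ sA); exists (fbr Y X); [exact: hA|exact: rep_br].
Qed.
End Mat.

Variable g : pset V.
Hypotheses (Hg : lie_subalg g) (Hgl : psubset g (in_gl pair)) (Hsplit : splittable g).

Definition lvl m X := g X /\ supported m X.

Lemma lvl_lie m : lie_subalg (lvl m).
Proof.
have [sg hg] := Hg; split; last by move=> X Y [gX pX] [gY pY]; split; [exact: hg|exact: supported_br].
apply: comb_subspace; first by split; [exact: sg.1|exact: pl0].
by move=> a X Y [gX pX] [gY pY]; split; [exact: subspace_comb|exact: supported_comb].
Qed.

Lemma lvl_le m n X : (m <= n)%N -> lvl m X -> lvl n X.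
Proof. by move=> mn [gX pX]; split=> //; exact: supported_le mn pX. Qed.

Lemma lvl_ex X : g X -> exists m, lvl m X.
Proof. by move=> gX; have [m pX] := supported_ex (Hgl gX); exists m. Qed.

Definition lvl_mx m K := mat m K (lvl m).

Lemma lvl_mxP m K : good m K.+1 -> forall x, x \in lvl_mx m K <-> exists2 X, lvl m X & rep m X x.
Proof. by move=> gd x; apply: matP; exact: (lvl_lie m).1. Qed.

Lemma lvl_mx_lie m K : good m K.+1 -> lie (lvl_mx m K).
Proof. by move=> gd; apply: lie_mat => //; exact: lvl_lie. Qed.

(** As q(0) = 0, the semisimple part of the matrix has level m and represents an endomorphism S. It
    and X - S form a Jordan decomposition of X, so splittability of [g] puts S in [g]. *)
Lemma lvl_mx_splits m K : good m K.+1 -> splits (lvl_mx m K).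
Proof.
move=> gd x /(lvl_mxP gd) [X [gX pX] rX]; have [q [q0 qd qn]] := jordan x; exists q.
suff sH : horner_mx x q \in lvl_mx m K by [].
have [h hE] : exists h, horner_mx x q = horner_mx x h *m x.
  have : root q 0 by apply/rootP.
  rewrite root_factor_theorem subr0 => /dvdpP [h ->]; exists h.
  by rewrite rmorphM /= horner_mx_X.
have hx : horner_mx x h *m x = x *m horner_mx x h by apply: comm_horner_mx.
have [|c|S rS] := @rep_of m K gd (horner_mx x q).
- by move=> c tc; rewrite hE hx mulmxA (rep_kill rX tc) mul0mx.
- by rewrite hE mulmxA; exact: rep_im rX.
pose N := fadd (fscale (-1) S) X.
have rN : rep m N (x - horner_mx x q).
  by rewrite addrC -scaleN1r; exact: rep_comb.
have SN : fbr S N = @fzero F V.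
  apply: (rep_inj gd (rep_br rS rN)); have -> : lb (x - horner_mx x q) (horner_mx x q) = 0.
    by rewrite lbBl lbxx subr0 /lb (comm_horner_mx q (erefl (x *m x))) subrr.
  exact: rep0.
have [|gS _] := Hsplit (X := X) (S := S) (N := N) gX.
  split; first by case: rS => [[]].
  split; first by case: rN => [[]].
  split; first by apply/funext => u; rewrite /N /fadd /fscale scaleN1r addrA subrr add0r.
  split; first exact: (rep_semisimple gd rS qd).
  split; first by apply/(rep_nilm gd rN).
  by move=> u; have /(congr1 (fun Z => Z u))/eqP := SN; rewrite subr_eq0 => /eqP.
by apply/(lvl_mxP gd); exists S => //; split=> //; case: rS.
Qed.

Lemma span_sub (P B : pset V) : subspace B -> psubset P B -> psubset (Defs.span P) B.
Proof.
move=> sB PB X [n [c [x [xP ->]]]]; elim: n c x xP => [|n IH] c x xP.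
  by have -> : (fun u => \sum_(i < 0) c i *: x i u) = @fzero F V
    by [apply/funext => u; rewrite big_ord0]; exact: sB.1.
have -> : (fun u => \sum_(i < n.+1) c i *: x i u) =
   fadd (fscale (c ord0) (x ord0)) (fun u => \sum_(i < n) c (lift ord0 i) *: x (lift ord0 i) u).
  by apply/funext => u; rewrite big_ord_recl.
apply: subspace_comb => //; first exact: PB.
by apply: (IH (fun i => c (lift ord0 i)) (fun i => x (lift ord0 i))).
Qed.

Lemma span_subspace (P : pset V) : subspace (Defs.span P).
Proof.
apply: comb_subspace.
  exists 0%N, (fun _ => 0), (fun _ => @fzero F V); split; first by case.
  by apply/funext => u; rewrite big_ord0.
move=> a _ _ [n [c [x [xP ->]]]] [n' [c' [x' [x'P ->]]]].
exists (n + n')%N, (fun i => match split i with inl j => a * c j | inr j => c' j end),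
  (fun i => match split i with inl j => x j | inr j => x' j end); split.
  by move=> i; case: (split i).
apply/funext => u; rewrite /fadd /fscale big_split_ord scaler_sumr /=; congr (_ + _).
  by apply: eq_bigr => i _; rewrite (unsplitK (inl i)) scalerA.
by apply: eq_bigr => i _; rewrite (unsplitK (inr i)).
Qed.

Lemma span_mem (P : pset V) X : P X -> Defs.span P X.
Proof.
move=> PX; exists 1%N, (fun _ => 1), (fun _ => X); split=> //.
by apply/funext => u; rewrite big_ord1 scale1r.
Qed.

Lemma gen_lie (S : pset V) : lie_subalg (gen_subalg S).
Proof.
split=> [|X Y hX hY B lB SB]; last by apply: lB.2; [exact: hX|exact: hY].
apply: comb_subspace; first by move=> B lB _; exact: lB.1.1.
by move=> a X Y hX hY B lB SB; apply: subspace_comb; [exact: lB.1|exact: hX|exact: hY].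
Qed.

Section Solvable.
Variables (m K : nat).
Hypothesis gd : good m K.+1.

Lemma derived_en (A : pset V) (S : {vspace 'M[F]_K.+1}) k :
  psubset A (of_mat m S) -> psubset (derived A k) (of_mat m (der S k)).
Proof.
move=> AS; elim: k => [|k IH] //=; apply: span_sub; first exact: of_mat_subspace.
move=> _ [X [Y [/IH [x xS rX] [/IH [y yS rY] ->]]]].
by exists (lb y x); [exact: mem_br|exact: rep_br].
Qed.

Lemma der_derived (A : pset V) (S : {vspace 'M[F]_K.+1}) k :
  (forall x, x \in S -> exists2 X, A X & rep m X x) ->
  forall x, x \in der S k -> exists2 X, derived A k X & rep m X x.
Proof.
move=> AS; elim: k => [|k IH] //=; apply: br_ind.
  have sD := span_subspace (fun Z => exists X Y, derived A k X /\ derived A k Y /\ Z = fbr X Y).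
  split=> [|a x y [X AX rX] [Y AY rY]]; first by exists (@fzero F V); [exact: sD.1|exact: rep0].
  by exists (fadd (fscale a X) Y); [exact: subspace_comb|exact: rep_comb].
move=> x y /IH [X AX rX] /IH [Y AY rY]; exists (fbr Y X); last exact: rep_br.
by apply: span_mem; exists Y, X.
Qed.

(** A basis of the matrices lifts to finitely many elements of J, whose generated subalgebra is
    solvable. *)
Lemma locally_solvable_der (J A : pset V) : locally_solvable J -> subspace A -> psubset A J ->
  exists k, der (mat m K A) k = 0%VS.
Proof.
move=> sJ sA AJ; set S := mat m K A.
have /choice [X hX] : forall i : 'I_(\dim S), exists X, A X /\ rep m X (vbasis S)`_i.
  move=> i; have /(matP m _ sA) [X AX rX] : (vbasis S)`_i \in S.
    by apply: vbasis_mem; rewrite mem_nth // size_tuple.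
  by exists X.
have [k hk] := sJ _ X (fun i => AJ _ (hX i).1); exists k.
set B := gen_subalg _ in hk.
have SB : (S <= mat m K B)%VS.
  rewrite -(span_basis (vbasisP S)); apply/span_subvP => x /(nthP 0) [i].
  rewrite size_tuple => iS <-; apply: (mem_mat _ _ (hX (Ordinal iS)).2); first exact: (gen_lie _).1.
  by move=> C lC; apply; exists (Ordinal iS).
apply/eqP; rewrite -subv0; apply/subvP => x xD; rewrite memv0; apply/eqP.
have [|Y dY rY] := @der_derived B S k _ x xD.
  by move=> y /(subvP SB) /(matP m _ (gen_lie _).1).
by apply: (rep_fun rY); rewrite (hk Y dY); exact: rep0.
Qed.
End Solvable.

(** * The linear nilradical as a limit over levels *)

Hypothesis HF : [pchar F] =i pred0.

(** All good windows are required, so that any window at hand may be used; [lnrad_nil_ideal]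
    supplies them all at once. *)
Definition lnrad m X := forall K, good m K.+1 -> exists2 x, x \in nrad (lvl_mx m K) & rep m X x.

Lemma lnrad_lvl m X : lnrad m X -> lvl m X.
Proof.
have [K gd] := good_ex m => /(_ K gd) [x /(subvP (nrad_sub _))].
by move=> xH rX; apply: (mat_rep gd) xH rX; exact: (lvl_lie m).1.
Qed.

Lemma lnrad_nilp m X : lnrad m X -> nilpotent_end X.
Proof.
have [K gd] := good_ex m => /(_ K gd) [x xn rX]; apply/(rep_nilm gd rX).
by apply: nrad_nilm xn; exact: lvl_mx_lie.
Qed.

Lemma lnrad_subspace m : subspace (lnrad m).
Proof.
apply: comb_subspace => [K gd|a X Y nX nY K gd]; first by exists 0; [exact: mem0v|exact: rep0].
have [x xn rX] := nX K gd; have [y yn rY] := nY K gd.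
by exists (a *: x + y); [exact: memvPa|exact: rep_comb].
Qed.

Lemma lnrad_br m X Y : lvl m X -> lnrad m Y -> lnrad m (fbr X Y).
Proof.
move=> lX nY K gd; have [y yn rY] := nY K gd; have [x rX] := rep_ex gd lX.2.
exists (lb y x); last exact: rep_br.
rewrite lbN memvN nrad_ideal //; first exact: lvl_mx_lie.
by apply: (mem_mat _ _ rX) => //; exact: (lvl_lie m).1.
Qed.

(* By Engel's theorem nil ideals are solvable. *)
Lemma lnrad_nil_ideal m (J : pset V) : subspace J -> psubset J (lvl m) ->
  (forall X Y, lvl m X -> J Y -> J (fbr X Y)) -> (forall X, J X -> nilpotent_end X) ->
  psubset J (lnrad m).
Proof.
move=> sJ Jl iJ nJ X JX K gd; have [x rX] := rep_ex gd (Jl X JX).2; exists x => //.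
have hL := lvl_mx_lie gd; have JH : (mat m K J <= lvl_mx m K)%VS by apply: matS => //; exact: (lvl_lie m).1.
have iH : ideal_of (lvl_mx m K) (mat m K J).
  move=> y z /(lvl_mxP gd) [Y lY rY] /(matP m _ sJ) [Z JZ rZ].
  rewrite lbN memvN; apply: (mem_mat _ _ (rep_br rY rZ)) => //; exact: iJ.
have [|y /(matP m _ sJ) [Y JY rY]|k dk] := @nil_der F _ (mat m K J).
- by move=> y z /(subvP JH); exact: iH.
- by apply/(rep_nilm gd rY); exact: nJ.
apply: (nrad_max HF hL JH iH dk); first exact: (mem_mat sJ JX rX).
by apply/(rep_nilm gd rX); exact: nJ.
Qed.

(** What lnrad n leaves on level m is an ideal of that level consisting of nilpotent elements. *)
Lemma lnrad_down m n X : (m <= n)%N -> lvl m X -> lnrad n X -> lnrad m X.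
Proof.
move=> mn lX nX; apply: (@lnrad_nil_ideal m (fun Y => lvl m Y /\ lnrad n Y)) => //.
- have [s1 s2] := ((lvl_lie m).1, lnrad_subspace n).
  by apply: comb_subspace; [split; [exact: s1.1|exact: s2.1]|move=> a Y Z [? ?] [? ?]; split; [exact: (subspace_comb _ s1)|exact: (subspace_comb _ s2)]].
- by move=> Y [].
- move=> Y Z lY [lZ nZ]; split; first exact: (lvl_lie m).2.
  by apply: lnrad_br => //; exact: lvl_le mn lY.
- by move=> Y [_ /lnrad_nilp].
Qed.

(* For m <= n only the inclusion of lnrad n in lnrad m holds, on lvl m: the
   linear nilradical of g is the eventual part of this decreasing system. *)
Definition gnrad X := g X /\ exists m0, forall m, (m0 <= m)%N -> lnrad m X.

Lemma gnrad_lnrad m X : gnrad X -> lvl m X -> lnrad m X.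
Proof.
by move=> [_ [m0 h]] lX; apply: (@lnrad_down m (maxn m0 m)); rewrite ?leq_maxr //; apply: h; exact: leq_maxl.
Qed.

(** Level m0 has finite dimension, so its decreasing intersections with the later nilradicals become
    constant. *)
Lemma gnrad_stable m0 : exists m, (m0 <= m)%N /\ forall X, lvl m0 X -> lnrad m X -> gnrad X.
Proof.
have [K gd] := good_ex m0; pose A i X := lvl m0 X /\ lnrad i X.
have sA i : subspace (A i).
  have [s1 s2] := ((lvl_lie m0).1, lnrad_subspace i).
  by apply: comb_subspace; [split; [exact: s1.1|exact: s2.1]|move=> a Y Z [? ?] [? ?]; split; [exact: (subspace_comb _ s1)|exact: (subspace_comb _ s2)]].
have [|S [[m [mm <-]] mn]] := @vs_min _ _ (fun S => exists i, (m0 <= i)%N /\ mat m0 K (A i) = S).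
  by exists (mat m0 K (A m0)), m0.
exists m; split=> // X lX nX; split; first exact: lX.1.
exists m => i mi; have mi0 := leq_trans mm mi.
have E : mat m0 K (A i) = mat m0 K (A m).
  apply: dim_eq_sub; last by apply: mn; exists i.
  apply: matS => // Y [lY nY]; split=> //; apply: lnrad_down mi _ nY; exact: lvl_le mm lY.
have [x rX] := rep_ex gd lX.2.
have : x \in mat m0 K (A m) by apply: (mem_mat _ _ rX).
by rewrite -E => /(mat_rep gd (sA i))/(_ rX) [].
Qed.

Lemma gnrad_ideal : ideal g gnrad.
Proof.
split; last split; last 1 first.
- move=> X Y gX [gY [m0 h]]; split; first exact: Hg.2.
  have [m1 lX] := lvl_ex gX; exists (maxn m0 m1) => m; rewrite geq_max => /andP [m0m m1m].
  by apply: lnrad_br; [exact: lvl_le lX|exact: h].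
- apply: comb_subspace; first by split; [exact: Hg.1.1|exists 0%N => m _; exact: (lnrad_subspace m).1].
  move=> a X Y [gX [m0 hX]] [gY [m1 hY]]; split; first exact: (subspace_comb _ Hg.1).
  exists (maxn m0 m1) => m; rewrite geq_max => /andP [m0m m1m].
  by apply: (subspace_comb _ (lnrad_subspace m)); [exact: hX|exact: hY].
- by move=> X [].
Qed.

Lemma gnrad_solvable : locally_solvable gnrad.
Proof.
move=> n x hx.
have [m hm] : exists m, forall i, lnrad m (x i).
  elim: n x hx => [|n IH] x hx; first by exists 0%N; case.
  have [m hm] := IH (fun i => x (lift ord0 i)) (fun i => hx _).
  have [_ [m0 h0]] := hx ord0; exists (maxn m m0) => i.
  case: (unliftP ord0 i) => [j|] ->; last by apply: h0; exact: leq_maxr.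
  by apply: gnrad_lnrad => //; apply: lvl_le (lnrad_lvl (hm j)); exact: leq_maxl.
have [K gd] := good_ex m; have hL := lvl_mx_lie gd.
have [k dk] := nil_der (nrad_lie hL) (@nrad_nilm _ _ (lvl_mx m K)).
exists k => X dX; have [y] : of_mat m (der (nrad (lvl_mx m K)) k) X.
  apply: derived_en dX => Y hY; apply: hY => [|_ [i ->]]; first exact: (of_mat_lie m (nrad_lie hL)).
  exact: hm.
by rewrite dk memv0 => /eqP -> rX; apply: (rep_inj gd rX); exact: rep0.
Qed.

(** A locally solvable ideal meets each level in a solvable ideal, whose nilpotent elements lie in
    [nrad]. *)
Lemma lin_nilradE X : lin_nilrad g X <-> gnrad X.
Proof.
split=> [[[J [iJ [sJ JX]]] nX]|nX]; last first.
  split; last by have [_ [m h]] := nX; exact: lnrad_nilp (h m _).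
  by exists gnrad; split; [exact: gnrad_ideal|split; [exact: gnrad_solvable|]].
have [sJ' [Jg iJ']] := iJ; have gX := Jg _ JX; split=> //; have [m0 lX] := lvl_ex gX.
exists m0 => m m0m K gd; have lXm := lvl_le m0m lX; have [x rX] := rep_ex gd lXm.2; exists x => //.
pose A Y := J Y /\ lvl m Y.
have sA : subspace A.
  have s1 := (lvl_lie m).1.
  by apply: comb_subspace; [split; [exact: sJ'.1|exact: s1.1]|move=> a Y Z [? ?] [? ?]; split; [exact: (subspace_comb _ sJ')|exact: (subspace_comb _ s1)]].
have [k dk] := @locally_solvable_der m K J A sJ sA (fun Y => @proj1 _ _).
have AH : (mat m K A <= lvl_mx m K)%VS by apply: matS => //; [exact: (lvl_lie m).1|move=> Y []].
apply: (nrad_max HF (lvl_mx_lie gd) AH _ dk); first 1 last.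
- exact: (mem_mat sA (conj JX lXm) rX).
- by apply/(rep_nilm gd rX).
move=> y z /(lvl_mxP gd) [Y lY rY] /(matP m _ sA) [Z [JZ lZ] rZ].
rewrite lbN memvN; apply: (mem_mat _ _ (rep_br rY rZ)) => //.
by split; [apply: iJ' => //; exact: lY.1|exact: (lvl_lie m).2].
Qed.

(** The larger window adds vectors killed by the endomorphism, so 0 is put among the roots;
    polynomials divisible by X are then transported from x. *)
Lemma dg_transfer a b (P : 'M[F]_(b.+1, a.+1)) (J : 'M[F]_(a.+1, b.+1)) x :
  J *m P *m x = x -> dg x -> dg (P *m x *m J).
Proof.
move=> JPx /dg_poly [s us hs].
have [r [ur hr r0]] : exists r, [/\ uniq r, horner_mx x (\prod_(c <- r) ('X - c%:P)) = 0 & 0 \in r].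
  case: (boolP (0 \in s)) => s0; first by exists s.
  exists (0 :: s); split; rewrite ?mem_head //= ?s0 //.
  by rewrite big_cons rmorphM /= hs mulr0.
apply/dg_poly; exists r => //; have : root (\prod_(c <- r) ('X - c%:P)) 0 by rewrite root_prod_XsubC.
rewrite root_factor_theorem subr0 => /dvdpP [h hE]; rewrite hE in hr *.
have yE q : horner_mx (P *m x *m J) (q * 'X) = P *m horner_mx x (q * 'X) *m J.
  rewrite !rmorphM /= !horner_mx_X -!mulmxE.
  elim/poly_ind: q => [|q c IH]; first by rewrite !rmorph0 !mul0mx mulmx0 mul0mx.
  rewrite !rmorphD !rmorphM /= !horner_mx_X !horner_mx_C -!mulmxE !mulmxDl IH mulmxDr mulmxDl.
  congr (_ + _); last by rewrite !mul_scalar_mx -scalemxAr -scalemxAl.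
  by rewrite -!mulmxA (mulmxA J P) (mulmxA (J *m P) x J) JPx.
by rewrite yE hr mulmx0 mul0mx.
Qed.

(** * Changing the level and the window *)

Section Transport.
Variables (m n K L : nat).
Hypotheses (mn : (m <= n)%N) (KL : (K <= L)%N) (gm : good m K.+1).

Lemma transport_ex : exists phi : {linear 'M[F]_K.+1 -> 'M[F]_L.+1}, forall X x, rep m X x ->
  rep n X (phi x) /\ (dg x -> dg (phi x)).
Proof.
have /choice [r hr] : forall i : 'I_L.+1, exists c : 'rV[F]_K.+1, evals m (e i - emb c) = 0.
  by move=> i; exact: gm.2.
pose P := \matrix_i r i; pose J := inc K.+1 L.+1.
have PE c : evals m (emb c - emb (c *m P)) = 0.
  have -> : emb (c *m P) = \sum_i c 0 i *: emb (row i P).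
    by rewrite mulmx_sum_row linear_sum; apply: eq_bigr => i _; rewrite linearZ.
  rewrite {1}/emb -sumrB linear_sum big1 // => i _.
  by rewrite -scalerBr linearZ /= rowK hr scaler0.
have lin : linear (fun x => P *m x *m J).
  by move=> c x y; rewrite mulmxDr mulmxDl -scalemxAr -scalemxAl.
have [phi phiE] := linear_ex lin; exists phi => X x rX; rewrite phiE.
have [[X1 X2 X3] hx] := rX; have [X' XE] := lin_comb X1.
have XP c : X (emb c) = X (emb (c *m P)) by apply/eqP; rewrite -subr_eq0 XE -linearB -XE X3.
split.
  split=> [|c]; first exact: supported_le mn rX.1.
  by rewrite XP hx !mulmxA emb_inc.
apply: dg_transfer; apply/row_matrixP => i; rewrite !rowE; apply: emb_inj.
by rewrite !mulmxA -hx -XP emb_inc // hx.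
Qed.
End Transport.

(** Stated for sets of endomorphisms, so that one pair can be compared across levels and windows. *)
Definition RedAt m K (A B : pset V) := exists l t : {vspace 'M[F]_K.+1},
  [/\ Red l t, (l <= lvl_mx m K)%VS, (t <= lvl_mx m K)%VS, A = of_mat m l & B = of_mat m t].

Lemma lvl_mx_rep m K (S : {vspace 'M[F]_K.+1}) : good m K.+1 -> (S <= lvl_mx m K)%VS ->
  forall x, x \in S -> exists2 X, lvl m X & rep m X x.
Proof. by move=> gd SH x /(subvP SH) /(lvl_mxP gd). Qed.

Lemma RedAt_le m n K L A B : (m <= n)%N -> (K <= L)%N -> good m K.+1 -> good n L.+1 ->
  RedAt m K A B -> RedAt n L A B.
Proof.
move=> mn KL gm gn [l [t [R lH tH -> ->]]]; have [phi h] := transport_ex mn KL gm.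
have phi_en (S : {vspace 'M[F]_K.+1}) : (S <= lvl_mx m K)%VS ->
    (linimg phi S <= lvl_mx n L)%VS /\ of_mat m S = of_mat n (linimg phi S).
  move=> SH; split.
    apply/subvP => _ /linimgP [x xS ->]; have [X lX rX] := lvl_mx_rep gm SH xS.
    by apply/(lvl_mxP gn); exists X; [exact: lvl_le mn lX|exact: (h X x rX).1].
  apply/funext => X; apply/propext; split.
    by move=> [x xS rX]; exists (phi x); [exact: mem_linimg|exact: (h X x rX).1].
  move=> [_ /linimgP [x xS ->] rX]; have [Y _ rY] := lvl_mx_rep gm SH xS.
  by exists x => //; rewrite (rep_inj gn rX (h Y x rY).1).
have [lH' ->] := phi_en l lH; have [tH' ->] := phi_en t tH.
exists (linimg phi l), (linimg phi t); split=> //.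
have ltH : (l + t <= lvl_mx m K)%VS by rewrite subv_add lH.
apply: (Red_img _ _ R) => [x y xl yl|x xt].
  have [X _ rX] := lvl_mx_rep gm ltH xl; have [Y _ rY] := lvl_mx_rep gm ltH yl.
  have r1 := (h _ _ (rep_br rY rX)).1.
  exact: rep_fun r1 (rep_br (h _ _ rY).1 (h _ _ rX).1).
have [X _ rX] := lvl_mx_rep gm tH xt; apply: (h X x rX).2.
by case: R => _ _ _ _; apply.
Qed.

(** * Chains of invariant subspaces *)
Section Chains.
Variable m1 : nat.

Definition sub_part (A : V -> Prop) := vsp (fun c : 'rV[F]_m1 => A (emb c)).
Definition quo_part (A : V -> Prop) := vsp (fun d : 'rV[F]_m1 => exists2 a, A a & evals m1 a = d).
(* A step of a chain is visible from level m1 when it changes the intersection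
   with the span of e_i, i < m1, or the image under the first m1 functionals;
   wt detects this and is bounded, so visible chains have a maximal length. *)
Definition wt A := (\dim (sub_part A) + \dim (quo_part A))%N.

Lemma lclosed_emb A n : vsub A -> lclosed (fun c : 'rV[F]_n => A (emb c)).
Proof. by move=> [A0 h]; split=> [|a x y Ax Ay]; rewrite ?linear0 // linearP; exact: h. Qed.

Lemma sub_partP A c : vsub A -> c \in sub_part A <-> A (emb c).
Proof. by move=> /(@lclosed_emb A m1) h; exact: (vspP h). Qed.

Lemma quo_partP A d : vsub A -> d \in quo_part A <-> exists2 a, A a & evals m1 a = d.
Proof.
move=> [A0 h]; apply: (vspP (P := fun d => exists2 a, A a & evals m1 a = d)).
split=> [|a x y [u Au <-] [v Av <-]]; first by exists 0; rewrite ?linear0.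
by exists (a *: u + v); rewrite ?linearP //; exact: h.
Qed.

Lemma sub_part_le A B : vsub A -> vsub B -> (forall u, A u -> B u) -> (sub_part A <= sub_part B)%VS.
Proof. by move=> vA vB AB; apply/subvP => c /(sub_partP _ vA)/AB h; apply/sub_partP. Qed.

Lemma quo_part_le A B : vsub A -> vsub B -> (forall u, A u -> B u) -> (quo_part A <= quo_part B)%VS.
Proof. by move=> vA vB AB; apply/subvP => c /(quo_partP _ vA) [a /AB Ba h]; apply/quo_partP => //; exists a. Qed.

Lemma wt_le A B : vsub A -> vsub B -> (forall u, A u -> B u) -> (wt A <= wt B)%N.
Proof. by move=> vA vB AB; rewrite leq_add ?dimvS ?sub_part_le ?quo_part_le. Qed.

Lemma wt_eq A B : vsub A -> vsub B -> (forall u, A u -> B u) -> (wt B <= wt A)%N ->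
  (sub_part B <= sub_part A)%VS /\ (quo_part B <= quo_part A)%VS.
Proof.
move=> vA vB AB; have h1 := sub_part_le vA vB AB; have h2 := quo_part_le vA vB AB.
have d1 := dimvS h1; have d2 := dimvS h2 => w.
have e1 : (\dim (sub_part B) <= \dim (sub_part A))%N.
  by rewrite -(leq_add2r (\dim (quo_part A))); apply: leq_trans w; rewrite leq_add2l.
have e2 : (\dim (quo_part B) <= \dim (quo_part A))%N.
  by rewrite -(leq_add2l (\dim (sub_part A))); apply: leq_trans w; rewrite leq_add2r.
by rewrite (dim_eq_sub h1 e1) (dim_eq_sub h2 e2) !subvv.
Qed.

Lemma wt_bound A : (wt A <= m1 + m1)%N.
Proof. by rewrite leq_add // (leq_trans (dimvS (subvf _))) // dimvf /dim /= mul1n. Qed.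

Definition stable m (A : V -> Prop) := forall X u, lvl m X -> A u -> A (X u).

Definition chain m p (A : nat -> V -> Prop) := [/\ forall j, vsub (A j),
  forall j u, A j u -> A j.+1 u, forall j, stable m (A j)
  & forall j, (j < p)%N -> (wt (A j) < wt (A j.+1))%N].

Lemma chain_bound m p A : chain m p A -> (p <= m1 + m1)%N.
Proof.
move=> [_ _ _ h]; apply: leq_trans (wt_bound (A p)).
suff : forall j, (j <= p)%N -> (j <= wt (A j))%N by apply.
by elim=> // j IH jp; apply: leq_ltn_trans (IH (ltnW jp)) (h j jp).
Qed.

Lemma chain_le m n p A : (m <= n)%N -> chain n p A -> chain m p A.
Proof. by move=> mn [h1 h2 h3 h4]; split=> // j X u /(lvl_le mn); exact: h3. Qed.

Lemma vsub0 : vsub (fun u : V => u = 0).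
Proof. by split=> // a u v -> ->; rewrite scaler0 addr0. Qed.
Lemma vsubT : vsub (fun _ : V => True). Proof. by []. Qed.

Lemma stable0 m : stable m (fun u => u = 0).
Proof. by move=> X _ [_ [_ _ h]] ->; rewrite h ?linear0. Qed.

(** Lengths are at most m1 + m1, and length 1 occurs at every level through 0 and the whole space,
    as m1 is positive. So some p occurs at every level while p + 1 fails at one. *)
Lemma max_chain : (0 < m1)%N -> exists p, [/\ (0 < p)%N, forall m, exists A, chain m p A &
  exists m0, ~ exists A, chain m0 p.+1 A].
Proof.
move=> m1_gt0; apply: contrapT => H.
have h p : forall m, exists A, chain m p.+1 A.
  elim: p => [|p IH] m; last first.
    by apply: contrapT => nP; apply: H; exists p.+1; split=> //; exists m.
  exists (fun j u => if j is 0 then u = 0 else True); split.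
  - by case=> [|j]; [exact: vsub0|exact: vsubT].
  - by [].
  - by case=> [|j] //; exact: stable0.
  case=> // _; rewrite /wt; have -> : sub_part (fun u => u = 0) = 0%VS.
    by apply/eqP; rewrite -subv0; apply/subvP => c /(sub_partP _ vsub0) /emb_inj0 ->; exact: mem0v.
  have -> : quo_part (fun u => u = 0) = 0%VS.
    by apply/eqP; rewrite -subv0; apply/subvP => c /(quo_partP _ vsub0) [a -> <-]; rewrite linear0 mem0v.
  rewrite dimv0; apply: leq_trans (leq_addr _ _).
  have -> : sub_part (fun _ => True) = fullv.
    by apply/eqP; rewrite eqEsubv subvf; apply/subvP => c _; apply/(sub_partP _ vsubT).
  by rewrite dimvf /dim /= mul1n.
by have [A /chain_bound] := h (m1 + m1)%N 0%N; rewrite ltnn.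
Qed.

Lemma chain_ends m p A : (0 < p)%N -> chain m p A -> exists B, [/\ chain m p B,
  forall u, B 0%N u -> u = 0 & forall j u, (p <= j)%N -> B j u].
Proof.
move=> p0 [h1 h2 h3 h4].
pose B j u := if j == 0%N then u = 0 else if (p <= j)%N then True else A j u.
have AB j u : (0 < j)%N -> A j u -> B j u.
  by rewrite /B; case: j => // j _ /=; case: ifP.
have BA j u : (j < p)%N -> B j u -> A j u.
  rewrite /B; case: eqP => [-> _ ->|_]; first exact: (h1 0%N).1.
  by rewrite ltnNge => /negPf ->.
have vB j : vsub (B j).
  by rewrite /B; case: eqP => _; [exact: vsub0|case: (p <= j)%N; [exact: vsubT|exact: h1]].
exists B; split.
- split=> //.
  + move=> j u; case: (ltnP j p) => jp; first by move=> /(BA j u jp)/h2; exact: AB.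
    by rewrite /B /= (leqW jp).
  + move=> j; rewrite /B; case: eqP => _; first exact: stable0.
    by case: (p <= j)%N => //; exact: h3.
  + move=> j jp; apply: leq_ltn_trans (leq_trans (h4 j jp) _).
      by apply: wt_le => // u; exact: BA.
    by apply: wt_le => // u; exact: AB.
- by move=> u; rewrite /B eqxx.
- by move=> j u pj; rewrite /B pj; case: eqP => // j0; move: pj; rewrite j0 leqNgt p0.
Qed.

Lemma chain_refine m0 p A j S : (forall i, vsub (A i)) -> (forall i u, A i u -> A i.+1 u) ->
  (forall i, stable m0 (A i)) -> (forall i, (i < p)%N -> (wt (A i) < wt (A i.+1))%N) ->
  vsub S -> stable m0 S -> (forall u, A j u -> S u) -> (forall u, S u -> A j.+1 u) -> (j < p)%N ->
  (wt (A j) < wt S)%N -> (wt S < wt (A j.+1))%N -> exists B, chain m0 p.+1 B.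
Proof.
move=> h1 h2 h3 h4 vS sS AS SA jp w1 w2.
pose B i := if (i <= j)%N then A i else if i == j.+1 then S else A i.-1.
have B1 i : (i <= j)%N -> B i = A i by rewrite /B => ->.
have B2 : B j.+1 = S by rewrite /B ltnn eqxx.
have B3 i : (j < i)%N -> B i.+1 = A i.
  by move=> ji; rewrite /B leqNgt ltnS (ltnW ji) /= eqSS gtn_eqF.
exists B; split.
- by move=> i; rewrite /B; case: ifP => _ //; case: ifP.
- move=> i u; case: (ltngtP i j) => ij.
  + by rewrite !B1 ?(ltnW ij) //; exact: h2.
  + rewrite B3 //; move: ij; rewrite leq_eqVlt => /predU1P [<-|ij]; first by rewrite B2; exact: SA.
    by case: i ij => // i ij; rewrite B3 //; exact: h2.
  + by rewrite ij B2 B1 //; exact: AS.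
- by move=> i; rewrite /B; case: ifP => _ //; case: ifP.
- move=> i ip; case: (ltngtP i j) => ij.
  + by rewrite !B1 ?(ltnW ij) //; apply: h4; exact: ltn_trans ij jp.
  + rewrite B3 //; move: ij; rewrite leq_eqVlt => /predU1P [<-|ij]; first by rewrite B2.
    by case: i ij ip => // i ij ip; rewrite B3 //; apply: h4.
  + by rewrite ij B2 B1.
Qed.
End Chains.

Lemma good_down m n M : (m <= n)%N -> good n M -> good m M.
Proof.
move=> mn [nM h]; split=> [|v]; first exact: leq_trans nM.
by have [c hc] := h v; exists c; exact: evals_le mn hc.
Qed.

Lemma rep_le m n K X (x : 'M[F]_K.+1) : (m <= n)%N -> rep m X x -> rep n X x.
Proof. by move=> mn [pX hx]; split=> //; exact: supported_le mn pX. Qed.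

Lemma inU_vsub m : vsub (inU m).
Proof. by split; [exact: inU0|move=> a u v; exact: inU_lin]. Qed.

(* Between consecutive terms of a longest visible chain, no invariant subspace
   is visible on both sides, which is the hypothesis of reductive_cover. *)
Lemma cover_level m1 N0 K0 : (0 < m1)%N -> exists m K (l t : {vspace 'M[F]_K.+1}),
  [/\ (m1 <= m)%N /\ (N0 <= m)%N, (K0 <= K)%N, good m K.+1,
      [/\ Red l t, (l <= lvl_mx m K)%VS & (t <= lvl_mx m K)%VS]
    & forall X, lvl m1 X -> exists2 Y, of_mat m (l + t)%VS Y & gnrad (fadd (fscale (-1) Y) X)].
Proof.
move=> /max_chain [p [p0 Pp [m0' nP']]].
pose m0 := maxn m0' (maxn m1 N0).
have m10 : (m1 <= m0)%N by rewrite !leq_max leqnn orbT.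
have nP : ~ exists A, chain m1 m0 p.+1 A.
  by move=> [A /(@chain_le _ m0' _ _ _ (leq_maxl _ _)) hA]; apply: nP'; exists A.
(* Two levels interact. At m0 chains of length p + 1 are impossible, which gives [lowupp] for
   subspaces stable under level m0. The chain itself is stable under the larger m, where elements of
   [lnrad m] of level m0 already lie in the nilradical of [g]. *)
have [m [m0m stab_m]] := gnrad_stable m0; have m1m := leq_trans m10 m0m.
have [A' /(chain_ends p0) [A [[h1 h2 h3 h4] Az Aall]]] := Pp m.
have /choice [k hk] j := good_sub m (h1 j).
have [M0 gM0] := good_ex m.
pose K := maxn K0 (maxn M0 (\max_(j < p.+1) k j)).
have gm : good m K.+1 by apply: good_le gM0 _; rewrite ltnS !leq_max leqnn orbT.
have AK j v : A j v -> exists c : 'rV[F]_K.+1, A j (emb c) /\ evals m (v - emb c) = 0.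
  case: (ltnP j p.+1) => jp.
    apply: hk; apply: leqW; rewrite !leq_max; apply/orP; right; apply/orP; right.
    exact: (@leq_bigmax _ (fun j : 'I_p.+1 => k j) (Ordinal jp)).
  by move=> _; have [c hc] := gm.2 v; exists c; split=> //; apply: Aall; exact: ltnW.
have g0 := good_down m0m gm; have g1 := good_down m10 g0.
pose Aj j := vsp (fun c : 'rV[F]_K.+1 => A j (emb c)).
have AjP j c : c \in Aj j <-> A j (emb c) by exact: (vspP (lclosed_emb _ (h1 j))).
pose U := vsp (fun c : 'rV[F]_K.+1 => inU m1 (emb c)).
have UP c : c \in U <-> inU m1 (emb c) by exact: (vspP (lclosed_emb _ (inU_vsub m1))).
pose Wp := vsp (fun c : 'rV[F]_K.+1 => evals m1 (emb c) = 0).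
have vW : vsub (fun v => evals m1 v = 0) by split=> [|a u v hu hv]; rewrite ?linear0 // linearP /= hu hv scaler0 addr0.
have WpP c : c \in Wp <-> evals m1 (emb c) = 0 by exact: (vspP (lclosed_emb _ vW)).
have Ale j : (Aj j <= Aj j.+1)%VS by apply/subvP => c /AjP/h2 ?; apply/AjP.
have stA j x : x \in lvl_mx m0 K -> stab (Aj j) x.
  move=> /(lvl_mxP g0) [X lX rX] c /AjP cA; apply/AjP; rewrite -rX.2.
  by apply: h3 cA; exact: lvl_le lX.
have Afull j : (p <= j)%N -> Aj j = fullv.
  by move=> pj; apply/eqP; rewrite eqEsubv subvf; apply/subvP => c _; apply/AjP; exact: Aall.
have th1 u v : evals m (u - v) = 0 -> evals m1 u = evals m1 v.
  by move=> /(evals_le m1m) /eqP; rewrite linearB /= subr_eq0 => /eqP.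
have lowupp j S : (Aj j <= S)%VS -> (S <= Aj j.+1)%VS -> (forall x, x \in lvl_mx m0 K -> stab S x) ->
    low U Wp Aj j S \/ upp U Wp Aj j S.
  move=> AS SA stS; case: (leqP p j) => jp.
    by left; rewrite /low (Afull j jp) subvf; split=> //; exact: subv_trans (subvf S) (addvSl _ _).
  (* S, known only in the window, becomes an invariant subspace of V containing A j. If its weight
     lay strictly between those of A j and A j.+1, it could be inserted into the chain. *)
  pose S' u := exists a s, [/\ A j a, s \in S & u = a + emb s].
  have vS' : vsub S'.
    split; first by exists 0, 0; rewrite linear0 addr0 mem0v; split=> //; exact: (h1 j).1.
    move=> c _ _ [a [s [Aa sS ->]]] [b [s' [Ab sS' ->]]].
    exists (c *: a + b), (c *: s + s'); rewrite memvPa // linearP scalerDr addrACA.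
    by split=> //; exact: (h1 j).2.
  have sS' : stable m0 S'.
    move=> X _ lX [a [s [Aa sS ->]]]; have [x rX] := rep_ex g0 lX.2.
    exists (X a), (s *m x); split.
    - by apply: h3 Aa; exact: lvl_le lX.
    - by apply: stS => //; apply/(lvl_mxP g0); exists X.
    - have [X' XE] := lin_comb (supported_lin rX.1).
      by rewrite XE linearD /= -XE rX.2.
  have AS' u : A j u -> S' u.
    by move=> Au; exists u, 0; rewrite linear0 addr0 mem0v.
  have SA' u : S' u -> A j.+1 u.
    move=> [a [s [Aa sS ->]]]; apply: (vsubD (h1 _)); first exact: h2.
    by apply/AjP; exact: (subvP SA).
  case: (leqP (wt m1 S') (wt m1 (A j))) => w1.
    left; have [hda hdb] := wt_eq (h1 j) vS' AS' w1; split; apply/subvP => c.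
      rewrite memv_cap => /andP [cS /UP [c1 ce]]; apply/AjP; rewrite ce.
      apply/(sub_partP _ (h1 j)); apply: (subvP hda); apply/(sub_partP _ vS'); rewrite -ce.
      by exists 0, c; rewrite add0r; split=> //; exact: (h1 j).1.
    move=> cS; have /(subvP hdb) : evals m1 (emb c) \in quo_part m1 S'.
      by apply/(quo_partP _ vS'); exists (emb c) => //; exists 0, c; rewrite add0r; split=> //; exact: (h1 j).1.
    move=> /(quo_partP _ (h1 j)) [a /AK [a' [Aa' /th1 ta]] tc].
    rewrite -[c](subrKC a') memv_add //; first by apply/AjP.
    by apply/WpP; rewrite linearB linearB /= -ta tc subrr.
  case: (leqP (wt m1 (A j.+1)) (wt m1 S')) => w2.
    right; have [hda hdb] := wt_eq vS' (h1 j.+1) SA' w2; split; apply/subvP => c.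
      rewrite memv_cap => /andP [/AjP cA /UP [c1 ce]].
      have : c1 \in sub_part m1 S' by apply: (subvP hda); apply/(sub_partP _ (h1 _)); rewrite -ce.
      move=> /(sub_partP _ vS'); rewrite -ce => -[a [s [Aa sS cE]]].
      rewrite -[c](subrK s) memvD //; apply: (subvP AS); apply/AjP.
      by rewrite linearB /= cE addrK.
    move=> /AjP cA; have /(subvP hdb) : evals m1 (emb c) \in quo_part m1 (A j.+1) by apply/(quo_partP _ (h1 _)); exists (emb c).
    move=> /(quo_partP _ vS') [_ [a [s [/AK [a' [Aa' /th1 ta]] sS ->]]] tc].
    rewrite -[c](subrKC (a' + s)) memv_add //; first by rewrite memvD // (subvP AS) //; apply/AjP.
    apply/WpP; have -> : emb (c - (a' + s)) = emb c - (emb a' + emb s) by rewrite linearB linearD.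
    by rewrite linearB /= -tc !linearD /= ta -opprD subrr.
  by case: nP; exact: (chain_refine h1 h2 (fun i X u lX => h3 i X u (lvl_le m0m lX)) h4 vS' sS' AS' SA' jp w1 w2).
have hsH : (lvl_mx m1 K <= lvl_mx m0 K)%VS.
  apply/subvP => x /(lvl_mxP g1) [X lX rX]; apply/(lvl_mxP g0); exists X; [exact: lvl_le lX|exact: rep_le rX].
have hsU X v : X \in lvl_mx m1 K -> v *m X \in U.
  by move=> /(lvl_mxP g1) [Y _ rY]; apply/UP; exact: rep_im rY.
have hsW X v : X \in lvl_mx m1 K -> v \in Wp -> v *m X = 0.
  by move=> /(lvl_mxP g1) [Y _ rY] /WpP; exact: rep_kill rY.
have Aj0 : Aj 0%N = 0%VS.
  by apply/eqP; rewrite -subv0; apply/subvP => c /AjP/Az/emb_inj0 ->; exact: mem0v.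
have [l [t [R lH tH hlt]]] := reductive_cover HF (lvl_mx_lie g0) (lvl_mx_splits g0) hsH hsU hsW Aj0
  (Afull p (leqnn p)) Ale stA lowupp.
exists m0, K, l, t; split=> //.
- by split=> //; rewrite !leq_max leqnn !orbT.
- exact: leq_maxl.
have ltH : (l + t <= lvl_mx m0 K)%VS by rewrite subv_add lH.
move=> X lX; have [x rX] := rep_ex g1 lX.2.
have [rho [rl hz]] := hlt x (mem_mat (lvl_lie m1).1 lX rX).
have [Y lY rY] := lvl_mx_rep g0 ltH rl; exists Y; first by exists rho.
have lX0 := lvl_le m10 lX; have rX0 := rep_le m10 rX.
have rZ := rep_comb (-1) rY rX0; set Z := fadd _ _ in rZ *.
have lZ : lvl m0 Z by apply: subspace_comb => //; exact: (lvl_lie m0).1.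
apply: stab_m => //.
(* The elements of level m lowering the chain form an ideal of nilpotent elements, which contains
   Z. *)
pose J W := lvl m W /\ forall j u, A j.+1 u -> A j (W u).
apply: (@lnrad_nil_ideal m J).
- have s1 := (lvl_lie m).1; apply: comb_subspace; first by split; [exact: s1.1|move=> j u _; exact: (h1 j).1].
  move=> a W W' [lW hW] [lW' hW']; split; first exact: (subspace_comb _ s1).
  by move=> j u Au; apply: (h1 j).2; [exact: hW|exact: hW'].
- by move=> W [].
- move=> W W' lW [lW' hW']; split; first exact: (lvl_lie m).2.
  move=> j u Au; rewrite /fbr addrC -scaleN1r; apply: (h1 j).2.
    by apply: hW'; exact: h3.
  by apply: h3 => //; exact: hW'.
- move=> W [_ hW]; exists p => u; apply: Az.
  suff : forall i, (i <= p)%N -> A (p - i)%N (iter i W u) by move=> /(_ p (leqnn p)); rewrite subnn.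
  elim=> [|i IH] ip; first by rewrite subn0; exact: Aall.
  by apply: hW; rewrite -subSn // subSS; apply: IH; exact: ltnW.
split; first exact: lvl_le m0m lZ.
move=> j u /AK [c [cA tc]].
have -> : Z u = Z (emb c).
  have [_ _ Zk] := (lvl_le m0m lZ).2; have [Z' ZE] := lin_comb (supported_lin lZ.2).
  by apply/eqP; rewrite -subr_eq0 ZE -linearB -ZE Zk.
rewrite rZ.2; apply/AjP; rewrite scaleN1r addrC; apply: hz; exact/AjP.
Qed.

Definition psum (A B : pset V) : pset V := fun X => exists Y Z, [/\ A Y, B Z & X = fadd Y Z].

Lemma of_mat_add m K (l t : {vspace 'M[F]_K.+1}) : good m K.+1 -> (l <= lvl_mx m K)%VS ->
  (t <= lvl_mx m K)%VS -> of_mat m (l + t)%VS = psum (of_mat m l) (of_mat m t).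
Proof.
move=> gd lH tH; have fE X Y : fadd X Y = fadd (fscale 1 X) Y.
  by apply/funext => u; rewrite /fadd /fscale scale1r.
apply/funext => X; apply/propext; split.
  move=> [_ /memv_addP [y yl [z zt ->]] rX].
  have [Y _ rY] := lvl_mx_rep gd lH yl; have [Z _ rZ] := lvl_mx_rep gd tH zt.
  exists Y, Z; split; [by exists y|by exists z|].
  by apply: (rep_inj gd rX); rewrite fE -[y]scale1r; exact: rep_comb.
move=> [Y [Z [[y yl rY] [z zt rZ] ->]]]; exists (y + z); first exact: memv_add.
by rewrite fE -[y]scale1r; exact: rep_comb.
Qed.

Lemma RedAt_lvl m K A B : good m K.+1 -> RedAt m K A B -> psubset (psum A B) (lvl m).
Proof.
move=> gd [l [t [R lH tH -> ->]]] X; rewrite -of_mat_add // => -[x xl rX].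
have ltH : (l + t <= lvl_mx m K)%VS by rewrite subv_add lH.
by apply: (mat_rep gd (lvl_lie m).1) rX; exact: (subvP ltH).
Qed.

(** [cover_level] covers level m1 + 1, and with it the given pair, modulo nilradical elements;
    [nest] then conjugates the new pair to contain the given one. The conjugation moves elements
    only within the nilradical, so the covering survives. *)
Lemma RedAt_step m1 K1 A B : good m1 K1.+1 -> RedAt m1 K1 A B -> exists m K A' B',
  [/\ (m1 < m)%N, (K1 <= K)%N, good m K.+1, RedAt m K A' B' & psubset (psum A B) (psum A' B') /\
   forall X, lvl m1 X -> exists2 Y, psum A' B' Y & gnrad (fadd (fscale (-1) Y) X)].
Proof.
move=> g1 R1; have [m [K [l [t [[m1m _] K1K gd [R lH tH] hlt]]]]] := @cover_level m1.+1 0 K1 (ltn0Sn _).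
have [l0 [t0 [R0 l0H t0H AE BE]]] := RedAt_le (ltnW m1m) K1K g1 gd R1.
pose NGm X := lvl m X /\ gnrad X; have [sNG [_ iNG]] := gnrad_ideal; have sl := (lvl_lie m).1.
have sN : subspace NGm.
  by apply: comb_subspace; [split; [exact: sl.1|exact: sNG.1]|move=> c X Y [? ?] [? ?]; split; [exact: (subspace_comb _ sl)|exact: (subspace_comb _ sNG)]].
pose a := mat m K NGm.
have ltH : (l + t <= lvl_mx m K)%VS by rewrite subv_add lH.
have ltH0 : (l0 + t0 <= lvl_mx m K)%VS by rewrite subv_add l0H.
have aH : (a <= lvl_mx m K)%VS by apply: matS => // X [].
have ia : ideal_of (lvl_mx m K) a.
  move=> x y /(lvl_mxP gd) [X lX rX] /(matP m _ sN) [Y [lY nY] rY].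
  rewrite lbN memvN; apply: (mem_mat sN _ (rep_br rX rY)).
  by split; [exact: (lvl_lie m).2|apply: iNG => //; exact: lX.1].
have [F0 Fn Fle st _] := flagP (lvl_mx m K).
have lift X : lvl m1.+1 X -> exists y z, [/\ y \in (l + t)%VS, z \in a & rep m X (y + z)].
  move=> lX; have [Y [y yl rY] nY] := hlt X lX; have lXm := lvl_le m1m lX.
  have lY : lvl m Y by apply: (mat_rep gd sl) rY; exact: (subvP ltH).
  have [x rX] := rep_ex gd lXm.2; exists y, (x - y); split=> //; last by rewrite subrKC.
  rewrite addrC -scaleN1r; apply: (mem_mat sN _ (rep_comb (-1) rY rX)).
  by split=> //; exact: (subspace_comb _ sl).
have [|||||h [h' [hh hY h0]]] := @nest F HF K l t l0 t0 a (flag (lvl_mx m K)) K.+1 R R0 F0 Fn Fle.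
- by move=> b x /(subvP ltH); exact: st.
- move=> y /(matP m _ sN) [Y [lY nY] rY]; have [y' /(nradP _) [_ sy] rY'] := gnrad_lnrad nY lY gd.
  by rewrite (rep_fun rY rY').
- by move=> x y /(subvP ltH); exact: ia.
- by move=> x y /(subvP aH); exact: ia.
- apply/subvP => x xl; have [X _ rX] := lvl_mx_rep gd ltH0 xl.
  have lX : lvl m1.+1 X.
    apply: lvl_le (leqnSn m1) _; apply: (RedAt_lvl g1 R1).
    by rewrite AE BE -of_mat_add //; exists x.
  by have [y [z [yl za rX']]] := lift X lX; rewrite (rep_fun rX rX') memv_add.
pose l' := linimg (cj h h') l; pose t' := linimg (cj h h') t.
have cH (s : {vspace 'M[F]_K.+1}) : (s <= l + t)%VS -> (linimg (cj h h') s <= lvl_mx m K)%VS.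
  move=> sl'; apply/subvP => _ /linimgP [x xs ->]; have xl := subvP sl' _ xs.
  rewrite -[X in X \in _](subrK x); apply: memvD; last exact: (subvP ltH).
  by apply: (subvP aH); apply: hY; apply: (subvP (addvSl _ _)).
have l'H := cH l (addvSl _ _); have t'H := cH t (addvSr _ _).
have cE x : x \in (l + t)%VS -> h' *m x *m h \in (l' + t')%VS.
  move=> /memv_addP [y yl [z zt ->]]; rewrite mulmxDr mulmxDl.
  by apply: memv_add; [exact: (mem_linimg (cj h h') yl)|exact: (mem_linimg (cj h h') zt)].
exists m, K, (of_mat m l'), (of_mat m t'); split=> //.
  by exists l', t'; split=> //; exact: Red_cj.
rewrite -(of_mat_add gd l'H t'H) AE BE -(of_mat_add gd l0H t0H); split.
  by move=> X [x /h0 [rho rl ->] rX]; exists (h' *m rho *m h) => //; exact: cE.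
move=> X lX; have [y [z [yl za rX]]] := lift X (lvl_le (leqnSn m1) lX).
have l't'H : (l' + t' <= lvl_mx m K)%VS by rewrite subv_add l'H.
have [Y lY rY] := lvl_mx_rep gd l't'H (cE y yl); exists Y; first by exists (h' *m y *m h) => //; exact: cE.
have rN := rep_comb (-1) rY rX.
suff [_ ] : NGm (fadd (fscale (-1) Y) X) by [].
apply: (mat_rep gd sN) rN; rewrite scaleN1r.
have -> : - (h' *m y *m h) + (y + z) = z - (h' *m y *m h - y) by rewrite opprB [RHS]addrA [z + y]addrC [LHS]addrC.
by apply: memvB => //; apply: hY; apply: (subvP (addvSl _ _)).
Qed.

Lemma complement_ex (A B : pset V) : subspace A -> subspace B -> exists C, [/\ subspace C, psubset C A,
  forall X, C X -> B X -> X = @fzero F V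
  & forall X, A X -> exists Y Z, [/\ B Y, C Z & X = fadd Y Z]].
Proof.
move=> sA sB; pose P (C : pset V) := [/\ psubset C A,
  forall a X Y, C X -> C Y -> C (fadd (fscale a X) Y) & forall X, C X -> B X -> X = @fzero F V].
have [|C [[CA Cc CB] mx]] := @classical_sets.Zorn_bigcup (Endo V) P.
  move=> G GP tot; split.
  - by move=> X [C /GP [CA _ _]]; exact: CA.
  - move=> a X Y [C1 G1 X1] [C2 G2 Y2]; case: (tot _ _ G1 G2) => h.
      by exists C2 => //; have [_ c _] := GP _ G2; apply: c => //; exact: h.
    by exists C1 => //; have [_ c _] := GP _ G1; apply: c => //; exact: h.
  - by move=> X [C /GP [_ _ CB]]; exact: CB.
(* [P] does not ask for 0, so that the empty union qualifies in Zorn's lemma; maximality recovers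
   it. *)
have C0 : C (@fzero F V).
  apply: contrapT => nC0; apply: (mx (fun X => C X \/ X = @fzero F V)).
    by split=> [X CX|h]; [left|apply: nC0; apply: h; right].
  split.
  - by move=> X [/CA //|->]; exact: sA.1.
  - have e1 a : fadd (fscale a (@fzero F V)) =1 id.
      by move=> Y; apply/funext => u; rewrite /fadd /fscale /fzero scaler0 add0r.
    have e2 a X : fadd (fscale a X) (@fzero F V) = fadd (fscale (a - 1) X) X.
      by apply/funext => u; rewrite /fadd /fscale /fzero addr0 scalerBl scale1r subrK.
    move=> a X Y [CX|->] [CY|->]; rewrite ?e1; [by left; exact: Cc| |by left|by right].
    by left; rewrite e2; exact: Cc.
  - by move=> X [/CB //|->].
have sC := comb_subspace C0 Cc; exists C; split=> // x Ax; apply: contrapT => nx.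
pose C1 X := exists c Y, C Y /\ X = fadd (fscale c x) Y.
have CC1 X : C X -> C1 X.
  by move=> CX; exists 0, X; split=> //; apply/funext => u; rewrite /fadd /fscale scale0r add0r.
have C1x : C1 x.
  by exists 1, (@fzero F V); split=> //; apply/funext => u; rewrite /fadd /fscale scale1r addr0.
apply: (mx C1).
  split=> // h; apply: nx; exists (@fzero F V), x; split; [exact: sB.1|exact: h|].
  by apply/funext => u; rewrite /fadd add0r.
split.
- by move=> _ [c [Y [/CA AY ->]]]; exact: (subspace_comb _ sA).
- move=> a _ _ [c [Y [CY ->]]] [c' [Y' [CY' ->]]].
  exists (a * c + c'), (fadd (fscale a Y) Y'); split; first exact: Cc.
  by apply/funext => u; rewrite /fadd /fscale scalerDr scalerDl scalerA addrACA.
- move=> _ [c [Y [CY ->]]]; have [->|c0] := eqVneq c 0.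
    have -> : fadd (fscale 0 x) Y = Y by apply/funext => u; rewrite /fadd /fscale scale0r add0r.
    exact: CB.
  move=> BZ; case: nx; exists (fscale c^-1 (fadd (fscale c x) Y)), (fscale (- c^-1) Y); split.
  - exact: sB.2.2.
  - exact: sC.2.2.
  - by apply/funext => u; rewrite /fadd /fscale scalerDr scalerA mulVf // scale1r scaleNr addrK.
Qed.

Lemma of_mat_fin_dim m K (S : {vspace 'M[F]_K.+1}) : good m K.+1 ->
  (forall x, x \in S -> exists2 X, lvl m X & rep m X x) -> fin_dim (of_mat m S).
Proof.
move=> gd hS; have /choice [X hX] : forall i : 'I_(\dim S), exists X, rep m X (vbasis S)`_i.
  move=> i; have [X _ rX] : exists2 X, lvl m X & rep m X (vbasis S)`_i.
    by apply/hS/vbasis_mem; rewrite mem_nth // size_tuple.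
  by exists X.
exists (\dim S), X; split=> [i|Y [y yS rY]].
  by exists (vbasis S)`_i => //; apply: vbasis_mem; rewrite mem_nth // size_tuple.
apply: (mat_rep gd (span_subspace _)) rY; apply: (subvP _ _ yS).
rewrite -{1}(span_basis (vbasisP S)); apply/span_subvP => x /(nthP 0) [i].
rewrite size_tuple => iS <-; apply: (mem_mat (span_subspace _) _ (hX (Ordinal iS))).
by apply: span_mem; exists (Ordinal iS).
Qed.

(** * Reductive pairs as Lie algebras of endomorphisms *)

Section RedV.
Variables (m K : nat) (A B : pset V).
Hypotheses (gd : good m K.+1) (R : RedAt m K A B).
Local Notation r := (psum A B).

Lemma RedAt_dec : exists l t : {vspace 'M[F]_K.+1},
  [/\ Red l t, (l + t <= lvl_mx m K)%VS, A = of_mat m l, B = of_mat m t & r = of_mat m (l + t)%VS].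
Proof.
have [l [t [Rlt lH tH AE BE]]] := R; exists l, t; rewrite subv_add lH tH AE BE.
by split=> //; rewrite of_mat_add.
Qed.

Lemma red_subspace : [/\ subspace A, subspace B & subspace r].
Proof. by have [l [t [_ _ -> -> E]]] := RedAt_dec; rewrite -?E; split; rewrite ?E; exact: of_mat_subspace. Qed.

Lemma red_lie : lie_subalg r.
Proof.
have [l [t [Rlt _ _ _ ->]]] := RedAt_dec; apply: of_mat_lie => x y xl yl.
by apply: (subvP (addvSl l t)); exact: Red_lie Rlt xl yl.
Qed.

Lemma red_fin_dim : fin_dim r.
Proof. by have [l [t [_ ltH _ _ ->]]] := RedAt_dec; apply: of_mat_fin_dim => //; exact: lvl_mx_rep. Qed.

Lemma red_l : psubset A r.
Proof.
have [_ sB _] := red_subspace; move=> X AX; exists X, (@fzero F V); split=> //; first exact: sB.1.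
by apply/funext => u; rewrite /fadd addr0.
Qed.

Lemma red_t : psubset B r.
Proof.
have [sA _ _] := red_subspace; move=> X AX; exists (@fzero F V), X; split=> //; first exact: sA.1.
by apply/funext => u; rewrite /fadd add0r.
Qed.

Lemma red_brack : psubset (brack r r) A.
Proof.
have [l [t [Rlt _ -> _ ->]]] := RedAt_dec; apply: span_sub; first exact: of_mat_subspace.
move=> _ [X [Y [[x xl rX] [[y yl rY] ->]]]]; exists (lb y x); last exact: rep_br.
exact: Red_lie Rlt yl xl.
Qed.

Lemma red_perfect : psubset A (brack A A).
Proof.
have [l [t [[hl sl _ _ _] ltH -> _ _]]] := RedAt_dec; move=> X [x xl rX].
have [|Y dY rY] := @der_derived m K (of_mat m l) l 1 _ x (subvP (semisP sl (subvv _) hl) _ xl).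
  move=> y yl; have [Y _ rY] := lvl_mx_rep gd (subv_trans (addvSl l t) ltH) yl.
  by exists Y => //; exists y.
by rewrite (rep_inj gd rX rY).
Qed.

Lemma red_central X Y : B X -> r Y -> fbr X Y = @fzero F V.
Proof.
have [l [t [[_ _ lt tt _] _ _ -> ->]]] := RedAt_dec; move=> [x xt rX] [_ /memv_addP [a al [b bt ->]] rY].
apply: (rep_inj gd (rep_br rX rY)); rewrite lbDl (lt a x) // (tt b x) // addr0; exact: rep0.
Qed.

Lemma red_nil0 X : r X -> gnrad X -> X = @fzero F V.
Proof.
have [l [t [Rlt ltH _ _ ->]]] := RedAt_dec; move=> [x xl rX] nX.
have lX : lvl m X by apply: (mat_rep gd (lvl_lie m).1) rX; exact: (subvP ltH).
have [y /(nradP _) [_ sy] rY] := gnrad_lnrad nX lX gd; have [F0 Fn Fle st _] := flagP (lvl_mx m K).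
have x0 : x = 0.
  apply: (red_strict0 HF Rlt F0 Fn Fle _ xl); last by rewrite (rep_fun rX rY).
  by move=> b z /(subvP ltH); exact: st.
by rewrite x0 in rX; apply: (rep_inj gd rX); exact: rep0.
Qed.

(** J meets the semisimple part in an ideal, which is both perfect and solvable. *)
Lemma red_solvable0 X J : ideal g J -> locally_solvable J -> J X -> A X -> X = @fzero F V.
Proof.
move=> [sJ [_ iJ]] lJ JX AX; have [l [t [[hl sl _ _ _] ltH AE _ _]]] := RedAt_dec.
have lH := subv_trans (addvSl l t) ltH.
pose C Y := J Y /\ A Y; have [sA _ _] := red_subspace.
have sC : subspace C.
  by apply: comb_subspace; [split; [exact: sJ.1|exact: sA.1]|move=> a Y Z [? ?] [? ?]; split; [exact: (subspace_comb _ sJ)|exact: (subspace_comb _ sA)]].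
have [k dk] := @locally_solvable_der m K J C lJ sC (fun Y => @proj1 _ _).
set I := mat m K C in dk.
have Il : (I <= l)%VS.
  by apply/subvP => x /(matP m _ sC) [Y [_]]; rewrite AE => -[y yl rY] /(rep_fun rY) <-.
have II : (I <= br I I)%VS.
  apply: (semisP sl Il) => x y xl /(matP m _ sC) [Y [JY AY] rY].
  have [Z lZ rZ] := lvl_mx_rep gd lH xl.
  have yl : y \in l by apply: (subvP Il); exact: (mem_mat sC (conj JY AY) rY).
  rewrite lbN memvN; apply: (mem_mat sC _ (rep_br rZ rY)).
  split; first by apply: iJ => //; exact: lZ.1.
  by rewrite AE; exists (lb y x); [exact: hl|exact: rep_br].
have Ik : (I <= der I k)%VS.
  by elim: k {dk} => [|k IH] /=; [exact: subvv|exact: subv_trans II (brS IH IH)].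
have := AX; rewrite AE => -[x xl rX]; have := subvP Ik x (mem_mat sC (conj JX AX) rX).
by rewrite dk memv0 => /eqP x0; rewrite x0 in rX; apply: (rep_inj gd rX); exact: rep0.
Qed.

(** The complement is the kernel of an equivariant projection onto the given submodule. *)
Lemma red_reductive (A' B' : pset V) : RedAt m K A' B' -> psubset (psum A' B') r ->
  reductive_in (psum A' B') r.
Proof.
move=> [l' [t' [R' l'H t'H -> ->]]]; rewrite -of_mat_add // => r'r Wd sW Wr stW.
have [l [t [Rlt ltH _ _ rE]]] := RedAt_dec; rewrite rE in r'r Wr *.
have l't'H : (l' + t' <= lvl_mx m K)%VS by rewrite subv_add l'H.
pose S := mat m K Wd.
have stS x y : x \in (l' + t')%VS -> y \in S -> lb y x \in S.
  move=> xl /(matP m _ sW) [Y WY rY]; have [X _ rX] := lvl_mx_rep gd l't'H xl.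
  by apply: (mem_mat sW _ (rep_br rX rY)); apply: stW => //; exists x.
have sub' x : x \in (l' + t')%VS -> x \in (l + t)%VS.
  move=> xl; have [X _ rX] := lvl_mx_rep gd l't'H xl.
  have [|y yl rY] := r'r X; first by exists x.
  by rewrite (rep_fun rX rY).
have Sl : (S <= l + t)%VS.
  by apply/subvP => x /(matP m _ sW) [Y /Wr [y yl rY]] /(rep_fun rY) <-.
have [||p [p1 p2 p3]] := @equivariant_proj F HF _ l' t' S R'.
- by move=> x y xl; apply: stS; apply: (subvP (addvSl _ _)).
- by move=> x y xl; apply: stS; apply: (subvP (addvSr _ _)).
exists (of_mat m ((l + t) :&: lker (linfun p))%VS); split; first exact: of_mat_subspace.
have inC x : x \in ((l + t) :&: lker (linfun p))%VS <-> x \in (l + t)%VS /\ p x = 0.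
  rewrite memv_cap memv_ker lfunE; split; first by move=> /andP [? /eqP].
  by move=> [-> ->]; rewrite eqxx.
split; first by move=> X [x /inC [xl _] rX]; exists x.
split.
  move=> X Y [x xl rX] [y /inC [yl py] rY]; exists (lb y x); last exact: rep_br.
  apply/inC; split; last by rewrite p3 // py lb0l.
  by apply: (subvP (addvSl l t)); apply: (Red_lie Rlt) => //; exact: sub'.
split.
  move=> Y WY [y /inC [_ py] rY]; have yS := mem_mat sW WY rY.
  by rewrite -(p2 y yS) py in rY; apply: (rep_inj gd rY); exact: rep0.
move=> Y [y yl rY]; have /(matP m _ sW) [Y1 W1 rY1] := p1 y.
exists Y1, (fadd (fscale (-1) Y1) Y); split=> //; split; last first.
  by apply/funext => u; rewrite /fadd /fscale scaleN1r addNKr.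
exists (- p y + y); last by rewrite -scaleN1r; exact: rep_comb.
apply/inC; split; last by rewrite linearD linearN /= (p2 _ (p1 y)) addNr.
by rewrite addrC memvB // (subvP Sl).
Qed.
End RedV.

(** * The increasing union of reductive subalgebras *)
Lemma red_seq : exists (m K : nat -> nat) (A B : nat -> pset V), forall n,
  [/\ good (m n) (K n).+1, RedAt (m n) (K n) (A n) (B n), (m n < m n.+1)%N /\ (K n <= K n.+1)%N,
      psubset (psum (A n) (B n)) (psum (A n.+1) (B n.+1))
    & forall X, lvl (m n) X -> exists2 Y, psum (A n.+1) (B n.+1) Y & gnrad (fadd (fscale (-1) Y) X)].
Proof.
pose St := {s : (nat * nat) * (pset V * pset V) | good s.1.1 s.1.2.+1 /\ RedAt s.1.1 s.1.2 s.2.1 s.2.2}.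
pose next (s s' : St) := let: (m, K, (A, B)) := sval s in let: (m', K', (A', B')) := sval s' in
  [/\ (m < m')%N /\ (K <= K')%N, psubset (psum A B) (psum A' B')
    & forall X, lvl m X -> exists2 Y, psum A' B' Y & gnrad (fadd (fscale (-1) Y) X)].
have /choice [nx hnx] : forall s, exists s', next s s'.
  move=> [[[m K] [A B]] /= [gd R]].
  have [m' [K' [A' [B' [h1 h2 h3 h4 [h5 h6]]]]]] := RedAt_step gd R.
  by exists (exist _ ((m', K'), (A', B')) (conj h3 h4)).
have [K0 g0] := good_ex 0.
have R0 : RedAt 0 K0 (of_mat 0 (0%VS : {vspace 'M[F]_K0.+1})) (of_mat 0 (0%VS : {vspace 'M[F]_K0.+1})).
  exists 0%VS, 0%VS; split; rewrite ?sub0v //; split.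
  - by move=> x y; rewrite !memv0 => /eqP -> _; rewrite lb0l.
  - by move=> I I0 _; apply: subv_trans I0 (sub0v _).
  - by move=> x y; rewrite !memv0 => /eqP -> _; rewrite lb0l.
  - by move=> x y; rewrite !memv0 => /eqP -> _; rewrite lb0l.
  - by move=> x; rewrite memv0 => /eqP ->; exact: dg0.
pose s n := iter n nx (exist _ ((0%N, K0), (_, _)) (conj g0 R0) : St).
exists (fun n => (sval (s n)).1.1), (fun n => (sval (s n)).1.2), (fun n => (sval (s n)).2.1),
  (fun n => (sval (s n)).2.2) => n.
have [gn Rn] := svalP (s n); have := hnx (s n); rewrite -/(s n.+1) /next.
move: gn Rn; case: (sval (s n)) => [[m K] [A B]] /= gn Rn.
by rewrite [nx (s n)]/(s n.+1); case: (sval (s n.+1)) => [[m' K'] [A' B']] /= [h1 h2 h3]; split.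
Qed.

Lemma span_mono (P Q : pset V) : psubset P Q -> psubset (Defs.span P) (Defs.span Q).
Proof. by move=> PQ X [n [c [x [xP ->]]]]; exists n, c, x; split=> // i; exact: PQ. Qed.

Lemma brack_mono (A A' B B' : pset V) : psubset A A' -> psubset B B' ->
  psubset (brack A B) (brack A' B').
Proof.
by move=> hA hB; apply: span_mono => _ [X [Y [/hA AX [/hB BY ->]]]]; exists X, Y.
Qed.

Lemma fbr_comb a (X Y Z : Endo V) : is_linear_map X ->
  fbr X (fadd (fscale a Y) Z) = fadd (fscale a (fbr X Y)) (fbr X Z).
Proof.
by move=> lX; apply/funext => u; rewrite /fbr /fadd /fscale lX opprD scalerBr addrACA.
Qed.

Lemma fbrN (X Y : Endo V) : fbr Y X = fscale (-1) (fbr X Y).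
Proof. by apply/funext => u; rewrite /fbr /fscale scaleN1r opprB. Qed.

Lemma gl_linear X : g X -> is_linear_map X.
Proof. by move=> /lvl_ex [m [_ /supported_lin]]. Qed.

Section Assembly.
Variables (m K : nat -> nat) (A B : nat -> pset V).
Hypothesis gd : forall n, good (m n) (K n).+1.
Hypothesis R : forall n, RedAt (m n) (K n) (A n) (B n).
Hypotheses (mS : forall n, (m n < m n.+1)%N) (KS : forall n, (K n <= K n.+1)%N).
Local Notation r n := (psum (A n) (B n)).
Hypothesis rS : forall n, psubset (r n) (r n.+1).
Hypothesis cov : forall n X, lvl (m n) X ->
  exists2 Y, r n.+1 Y & gnrad (fadd (fscale (-1) Y) X).

Let m_ge n : (n <= m n)%N.
Proof. by elim: n => // n IH; exact: leq_ltn_trans IH (mS n). Qed.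

Let mono (T : Type) (P : nat -> T -> Prop) : (forall n x, P n x -> P n.+1 x) ->
  forall i j x, (i <= j)%N -> P i x -> P j x.
Proof. by move=> h i j x /subnK <-; elim: (j - i)%N => // k IH Px; exact/h/IH. Qed.

Let K_le i j : (i <= j)%N -> (K i <= K j)%N.
Proof. by move=> ij; apply: (mono (P := fun n k => k <= K n)%N) ij (leqnn _) => n k h; exact: leq_trans (KS n). Qed.
Let m_le i j : (i <= j)%N -> (m i <= m j)%N.
Proof. by move=> ij; apply: (mono (P := fun n k => k <= m n)%N) ij (leqnn _) => n k h; exact: leq_trans (ltnW (mS n)). Qed.
Let r_le i j X : (i <= j)%N -> r i X -> r j X.
Proof. exact: (mono (P := fun n => r n)) rS i j X. Qed.

(** A n is its own derived algebra, and brackets of r n.+1 fall in A n.+1; only the toral parts may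
    fail to increase. *)
Let AS n X : A n X -> A n.+1 X.
Proof.
move=> /(red_perfect (gd n) (R n)) h; apply: (red_brack (gd n.+1) (R n.+1)).
by apply: brack_mono h => Y /(red_l (gd n) (R n)) /rS.
Qed.
Let A_le i j X : (i <= j)%N -> A i X -> A j X.
Proof. exact: (mono AS). Qed.

Definition gred : pset V := fun X => exists n, r n X.
Definition levi : pset V := fun X => exists n, A n X.

Lemma gred2 X Y : gred X -> gred Y -> exists n, r n X /\ r n Y.
Proof.
move=> [i rX] [j rY]; exists (maxn i j); split.
  by apply: r_le rX; exact: leq_maxl.
by apply: r_le rY; exact: leq_maxr.
Qed.

Lemma gred_lie : lie_subalg gred.
Proof.
split; last by move=> X Y hX /(gred2 hX) [n [rX rY]]; exists n; exact: (red_lie (gd n) (R n)).2.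
apply: comb_subspace; first by exists 0%N; exact: (red_lie (gd 0%N) (R 0%N)).1.1.
by move=> a X Y hX /(gred2 hX) [n [rX rY]]; exists n; exact: (subspace_comb _ (red_lie (gd n) (R n)).1).
Qed.

Lemma gred_g : psubset gred g.
Proof. by move=> X [n /(RedAt_lvl (gd n) (R n)) []]. Qed.

Lemma gred_locally_reductive : locally_reductive gred.
Proof.
exists (fun n => r n).
split; first by move=> n; exact: (red_lie (gd n) (R n)).
split; first by move=> n; exact: (red_fin_dim (gd n) (R n)).
split; first by move=> n; apply: (red_reductive (gd n) (R n) (R n)).
split; first exact: rS.
split=> // n; apply: (red_reductive (gd n.+1) (R n.+1) _ (@rS n)).
exact: (RedAt_le (ltnW (mS n)) (KS n) (gd n) (gd n.+1) (R n)).
Qed.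

Lemma levi_subspace : subspace levi.
Proof.
apply: comb_subspace; first by exists 0%N; have [[h _] _ _] := red_subspace (gd 0%N) (R 0%N).
move=> a X Y [i AX] [j AY]; exists (maxn i j); have [sA _ _] := red_subspace (gd (maxn i j)) (R (maxn i j)).
by apply: (subspace_comb _ sA); [apply: A_le AX; exact: leq_maxl|apply: A_le AY; exact: leq_maxr].
Qed.

Lemma gred_brack : brack gred gred = levi.
Proof.
apply/funext => X; apply/propext; split.
  move: X; apply: span_sub; first exact: levi_subspace.
  move=> _ [X [Y [hX [hY ->]]]]; have [n [rX rY]] := gred2 hX hY; exists n.
  by apply: (red_brack (gd n) (R n)); apply: span_mem; exists X, Y.
move=> [n /(red_perfect (gd n) (R n)) h].
by apply: brack_mono h => Y /(red_l (gd n) (R n)) rY; exists n.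
Qed.

Lemma cov_ex X : g X -> exists2 Y, gred Y & gnrad (fadd (fscale (-1) Y) X).
Proof.
move=> /lvl_ex [k lX]; have [Y rY nY] := cov (lvl_le (m_ge k) lX).
by exists Y => //; exists k.+1.
Qed.

Lemma faddNK (X Y : Endo V) : fadd (fadd (fscale (-1) Y) X) Y = X.
Proof. by apply/funext => u; rewrite /fadd /fscale scaleN1r addrAC addNr add0r. Qed.

Lemma gred_direct : direct_sum g gnrad gred.
Proof.
split=> [X|X nX [n rX]]; last exact: (red_nil0 (gd n) (R n) rX nX).
split=> [gX|[Z [Y [nZ [hY ->]]]]].
  have [Y hY nY] := cov_ex gX; exists (fadd (fscale (-1) Y) X), Y.
  by split=> //; split=> //; rewrite faddNK.
by apply: Hg.1.2.1; [exact: nZ.1|exact: gred_g].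
Qed.

(** With W = Z + Y and W' = Z' + Y' along nilradical and gred, [W, W'] is [Y, Y'] plus a nilradical
    element, which lies in [g, g] as a difference of brackets. Uniqueness is [red_solvable0]. *)
Lemma levi_direct : levi_component g levi.
Proof.
have sL := levi_subspace; have sB : subspace (brack g g) := span_subspace _.
have [sN [_ iN]] := gnrad_ideal.
have Lb : psubset levi (brack g g).
  by rewrite -gred_brack; apply: brack_mono; exact: gred_g.
split.
  split=> // X Y [i AX] [j AY].
  have [n [rX rY]] : exists n, r n X /\ r n Y.
    by apply: gred2; [exists i; exact: (red_l (gd i) (R i))|exists j; exact: (red_l (gd j) (R j))].
  by exists n; apply: (red_brack (gd n) (R n)); apply: span_mem; exists X, Y.
split=> [X|X [[J [iJ [lJ JX]]] _] [n AX]]; last exact: (red_solvable0 (gd n) (R n) iJ lJ JX AX).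
split=> [|[Z [Y [[_ bZ] [LY ->]]]]]; last by apply: sB.2.1 => //; exact: Lb.
move=> bX; suff [Z [Y [[nZ bZ] [LY ->]]]] : exists Z Y, (gnrad Z /\ brack g g Z) /\ levi Y /\ X = fadd Z Y.
  exists Z, Y; split=> //; split=> //; exists gnrad; split; first exact: gnrad_ideal.
  by split=> //; exact: gnrad_solvable.
pose Q W := exists Z Y, (gnrad Z /\ brack g g Z) /\ levi Y /\ W = fadd Z Y.
have sQ : subspace Q.
  apply: comb_subspace.
    exists (@fzero F V), (@fzero F V); split; first by split; [exact: sN.1|exact: sB.1].
    by split; [exact: sL.1|apply/funext => u; rewrite /fadd addr0].
  move=> a _ _ [Z [Y [[nZ bZ] [LY ->]]]] [Z' [Y' [[nZ' bZ'] [LY' ->]]]].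
  exists (fadd (fscale a Z) Z'), (fadd (fscale a Y) Y'); split.
    by split; [exact: (subspace_comb _ sN)|exact: (subspace_comb _ sB)].
  split; first exact: (subspace_comb _ sL).
  by apply/funext => u; rewrite /fadd /fscale scalerDr addrACA.
apply: (span_sub sQ _ bX) => _ [W [W' [gW [gW' ->]]]].
have [Y hY nY] := cov_ex gW; have [Y' hY' nY'] := cov_ex gW'.
exists (fadd (fscale (-1) (fbr Y Y')) (fbr W W')), (fbr Y Y'); split; last first.
  split; last by rewrite faddNK.
  have [n [rX rY]] := gred2 hY hY'; exists n; apply: (red_brack (gd n) (R n)).
  by apply: span_mem; exists Y, Y'.
have [gY gY'] := (gred_g hY, gred_g hY'); split; last first.
  by apply: (subspace_comb _ sB); apply: span_mem; [exists Y, Y'|exists W, W'].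
set Z := fadd _ W in nY; set Z' := fadd _ W' in nY'.
have -> : fadd (fscale (-1) (fbr Y Y')) (fbr W W') = fadd (fscale 1 (fbr W Z')) (fscale (-1) (fbr Y' Z)).
  rewrite (fbr_comb _ _ _ (gl_linear gW)) (fbr_comb _ _ _ (gl_linear gY')) (fbrN W Y') (fbrN Y Y').
  apply/funext => u; rewrite /fadd /fscale !scale1r !scaleN1r.
  move: (fbr W Y' u) (fbr Y Y' u) (fbr W W' u) => x y z.
  by rewrite opprK opprB [RHS]addrACA addNr add0r addrC.
apply: (subspace_comb _ sN); first exact: iN.
by apply: sN.2.2; exact: iN.
Qed.

(** The toral parts need not be nested, but of any two the later is central in an r n containing
    both, so they commute and their span [h] is abelian. *)
Let P X := exists n, B n X.
Let h := Defs.span P.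

Let sh : subspace h. Proof. exact: span_subspace. Qed.
Let P_gred : psubset P gred. Proof. by move=> X [n BX]; exists n; exact: (red_t (gd n) (R n)). Qed.
Let h_gred : psubset h gred. Proof. exact: span_sub gred_lie.1 P_gred. Qed.
Let P_lin X : P X -> is_linear_map X. Proof. by move=> /P_gred/gred_g/gl_linear. Qed.

Let PP X Y : P X -> P Y -> fbr X Y = @fzero F V.
Proof.
have c0 i j X' Y' : (i <= j)%N -> B j X' -> B i Y' -> fbr X' Y' = @fzero F V.
  move=> ij BX BY; apply: (red_central (gd j) (R j) BX); apply: r_le ij _.
  exact: (red_t (gd i) (R i)).
move=> [i BX] [j BY]; case: (leqP j i) => ij; first exact: c0 ij BX BY.
rewrite fbrN (c0 _ _ _ _ (ltnW ij) BY BX); apply/funext => u.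
by rewrite /fscale /fzero scaler0.
Qed.

Let hh X Y : h X -> h Y -> fbr X Y = @fzero F V.
Proof.
have cent (Q : pset V) Z : is_linear_map Z -> psubset Q (fun Y => fbr Z Y = @fzero F V) ->
    psubset (Defs.span Q) (fun Y => fbr Z Y = @fzero F V).
  move=> lZ; apply: span_sub; apply: comb_subspace.
    apply/funext => u; rewrite /fbr /fzero.
    by have [Z' ->] := lin_comb lZ; rewrite linear0 subrr.
  move=> a Y1 Y2 h1 h2; rewrite fbr_comb // h1 h2; apply/funext => u.
  by rewrite /fadd /fscale /fzero scaler0 addr0.
move=> hX; apply: (cent P X); first exact/gl_linear/gred_g/h_gred.
move=> Z PZ; rewrite fbrN; have -> : fbr Z X = @fzero F V.
  by apply: (cent P) hX => [|W PW]; [exact: P_lin|exact: PP].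
by apply/funext => u; rewrite /fscale /fzero scaler0.
Qed.

(** Diagonalizability is followed in all large windows, where the finitely many toral summands of Y
    are simultaneously present and commute. *)
Let h_dg Y : h Y -> exists n0, forall n, (n0 <= n)%N -> exists2 x, rep (m n) Y x & @dg F (K n).+1 x.
Proof.
pose D Y := h Y /\ exists n0, forall n, (n0 <= n)%N -> exists2 x, rep (m n) Y x & @dg F (K n).+1 x.
suff : psubset h D by move=> hD /hD [].
apply: span_sub.
  apply: comb_subspace.
    by split; [exact: sh.1|exists 0%N => n _; exists 0; [exact: rep0|exact: dg0]].
  move=> a X Z [hX [n1 h1]] [hZ [n2 h2]]; split; first exact: (subspace_comb _ sh).
  exists (maxn n1 n2) => n; rewrite geq_max => /andP [/h1 [x rX dx] /h2 [z rZ dz]].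
  exists (a *: x + z); first exact: rep_comb.
  apply: dg_add dz; last exact: dg_scale.
  rewrite -scalemxAl -scalemxAr; congr (_ *: _); apply/eqP; rewrite -subr_eq0.
  apply/eqP; have := rep_br rZ rX; rewrite (hh hZ hX) => rl; exact: (rep_fun rl (rep0 _ _)).
move=> X PX; split; first exact: span_mem.
have [n BX] := PX; exists n => k nk.
have [l [t [Rlt _ _ _ BE]]] := RedAt_le (m_le nk) (K_le nk) (gd n) (gd k) (R n).
by move: BX; rewrite BE => -[x xt rX]; exists x => //; case: Rlt => _ _ _ _; apply.
Qed.

(** gred is levi + h, and the sum need not be direct; [t] is a complement in [h] of its intersection
    with levi. *)
Lemma gred_torus : exists t : pset V, [/\ psubset t g, toral t, ideal gred levi
  & direct_sum gred levi t].
Proof.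
have [t [st tA tL ht]] := complement_ex sh levi_subspace; exists t.
have tg X : t X -> gred X by move=> /tA/h_gred.
have Lg X : levi X -> gred X by move=> [n AX]; exists n; exact: (red_l (gd n) (R n)).
split.
- by move=> X /tg/gred_g.
- split; first by split=> // X Y /tA hX /tA hY; rewrite (hh hX hY); exact: st.1.
  move=> X /tA /h_dg [n hn]; have [x rX dx] := hn n (leqnn n).
  exact: (rep_semisimple (gd n) rX dx).
- split; first exact: levi_subspace; split; first exact: Lg.
  move=> X Y hX /Lg hY; have [n [rX rY]] := gred2 hX hY; exists n.
  by apply: (red_brack (gd n) (R n)); apply: span_mem; exists X, Y.
- split=> [X|X LX tX]; last exact: tL.
  split=> [[n [Y [Z [AY BZ ->]]]]|[Y [Z [LY [tZ ->]]]]]; last first.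
    by apply: gred_lie.1.2.1; [exact: Lg|exact: tg].
  have [|Y' [Z' [LY' tZ' ->]]] := ht Z; first by apply: span_mem; exists n.
  exists (fadd Y Y'), Z'; split; first by apply: levi_subspace.2.1 => //; exists n.
  by split=> //; apply/funext => u; rewrite /fadd addrA.
Qed.
End Assembly.

Lemma splittable_decomposition : exists gred : pset V,
    lie_subalg gred /\ psubset gred g /\ locally_reductive gred /\
    ideal g (lin_nilrad g) /\ direct_sum g (lin_nilrad g) gred /\
    levi_component g (brack gred gred) /\
    exists t : pset V,
      psubset t g /\ toral t /\
      ideal gred (brack gred gred) /\ direct_sum gred (brack gred gred) t.
Proof.
have -> : lin_nilrad g = gnrad by apply/funext => X; apply/propext; exact: lin_nilradE.
have [m [K [A [B hs]]]] := red_seq.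
have gd n : good (m n) (K n).+1 by case: (hs n).
have R n : RedAt (m n) (K n) (A n) (B n) by case: (hs n).
have mS n : (m n < m n.+1)%N by case: (hs n) => _ _ [].
have KS n : (K n <= K n.+1)%N by case: (hs n) => _ _ [].
have rS n : psubset (psum (A n) (B n)) (psum (A n.+1) (B n.+1)) by case: (hs n).
have cov n := let: And5 _ _ _ _ c := hs n in c.
exists (gred A B); split; first exact: (gred_lie gd R rS).
split; first exact: (gred_g gd R).
split; first exact: (gred_locally_reductive gd R mS KS rS).
split; first exact: gnrad_ideal.
split; first exact: (gred_direct gd R mS cov).
rewrite (gred_brack gd R rS); split; first exact: (levi_direct gd R mS rS cov).
have [t [h1 h2 h3 h4]] := gred_torus gd R mS KS rS.
by exists t.
Qed.
End Levels.

Theorem theorem4p7 (F : closedFieldType) (HF : [pchar F] =i pred0)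
  (V Vs : lmodType F) (pair : V -> Vs -> F)
  (Hbil : bilinear_pairing pair) (Hnd : nondeg_pairing pair)
  (HV : countable_dim V) (HVs : countable_dim Vs)
  (g : pset V) (Hg : gl_subalg pair g) (Hsplit : splittable g) :
  exists gred : pset V,
    lie_subalg gred /\ psubset gred g /\ locally_reductive gred /\
    ideal g (lin_nilrad g) /\ direct_sum g (lin_nilrad g) gred /\
    levi_component g (brack gred gred) /\
    exists t : pset V,
      psubset t g /\ toral t /\
      ideal gred (brack gred gred) /\ direct_sum gred (brack gred gred) t.
Proof.
have [e [e_free e_span]] := HV; have [f [_ f_span]] := HVs; have [lg gg] := Hg.
exact: (splittable_decomposition Hbil e_free e_span f_span lg gg Hsplit HF).
Qed.
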